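(* For $0<t<1$ let \[Q(t)=\frac{3t+2\sqrt{(1-t)^3}-2}{t^2}.\] Then for all integers $n\geq 92$, \[f(n)+\frac{1000}{\mu(n-1)^5}<Q(u_n).\]
   Context: $\overline{p}(n)$ denotes the number of overpartitions of $n$ (partitions of $n$ in which the first occurrence of each distinct part may be overlined), and $u_n=\dfrac{\overline{p}(n-1)\overline{p}(n+1)}{\overline{p}(n)^2}$. Let $\mu(m)=\pi\sqrt{m}$. For an integer $n\geq 2$ put $x=\mu(n-1)$, $y=\mu(n)$, $z=\mu(n+1)$, and define \[f(n)=e^{x-2y+z}\,\frac{y^{14}(x^5-x^4-1)(z^5-z^4-1)}{x^7z^7(y^5-y^4+1)^2}.\] *)

(* Defs.v *)
From Stdlib Require Import Reals Lra Lia Arith List.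
Import ListNotations.
Open Scope R_scope.

(** * Overpartitions
   An overpartition of n is represented canonically as a list of pairs
   (part, overlined) with parts positive and listed in nonincreasing order,
   summing to n, where among equal parts only the first occurrence may be
   overlined (i.e. a later copy of an equal part is never overlined). *)

Fixpoint ovp_ok (l : list (nat * bool)) : bool :=
  match l with
  | [] => true
  | (a, _) :: rest =>
      (0 <? a)%nat &&
      match rest with
      | [] => true
      | (a', b') :: _ => (a' <=? a)%nat && (negb (a' =? a)%nat || negb b')
      end &&
      ovp_ok rest
  end.

Definition ovp_sum (l : list (nat * bool)) : nat :=
  fold_right (fun p s => (fst p + s)%nat) 0%nat l.

Definition is_overpartition (n : nat) (l : list (nat * bool)) : bool :=
  ovp_ok l && (ovp_sum l =? n)%nat.

(** all lists of length <= k over alphabet A (each exactly once if A has no duplicates) *)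
Fixpoint words {X : Type} (k : nat) (A : list X) : list (list X) :=
  match k with
  | O => [[]]
  | S k' => [] :: flat_map (fun a => map (cons a) (words k' A)) A
  end.

(** every overpartition of n has at most n parts, each in 1..n *)
Definition overpartitions (n : nat) : list (list (nat * bool)) :=
  filter (is_overpartition n) (words n (list_prod (seq 1 n) [true; false])).

Definition pbar (n : nat) : nat := length (overpartitions n).

Definition u (n : nat) : R :=
  INR (pbar (n - 1)) * INR (pbar (n + 1)) / (INR (pbar n)) ^ 2.

Definition mu (m : nat) : R := PI * sqrt (INR m).

Definition f_ov (n : nat) : R :=
  let x := mu (n - 1) in
  let y := mu n in
  let z := mu (n + 1) in
  exp (x - 2 * y + z) *
  (y ^ 14 * (x ^ 5 - x ^ 4 - 1) * (z ^ 5 - z ^ 4 - 1)) /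
  (x ^ 7 * z ^ 7 * (y ^ 5 - y ^ 4 + 1) ^ 2).

Definition Q (t : R) : R :=
  (3 * t + 2 * sqrt ((1 - t) ^ 3) - 2) / t ^ 2.

(* Main.v *)
Require Import Defs.
From Stdlib Require Import Reals Lra Lia Psatz Arith Factorial ClassicalEpsilon ZArith List Bool.
From Coquelicot Require Import Coquelicot.
Import ListNotations.
Open Scope R_scope.

(* The generating function of the overpartition numbers is [1 / theta(q)] with
   [theta(q) = sum over all integers of (-1)^l q^(l^2)] (Gauss). Poisson summation, in a
   form using the Fejer kernel, transforms [theta] near [q = 1] and gives
   [1 / theta(e^-z) = sqrt(z / pi) e^(pi^2 / (4 z)) / 2 + small]. Writing [sqrt(z / pi)] through the
   Gaussian integral turns this main term into [sum_k c_k / z^k] with positive [c_k]; replacing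
   [1 / z^(m+1)] by [sum_n n^m e^(-nz) / m!] yields a power series whose coefficients are exactly
   [(cosh mu(n) - sinh mu(n) / mu(n)) / (4 n)]. The difference of the two series is bounded on the
   circle of radius [e^-t], with [t] of order [1 / sqrt n]; away from [z = 0] the product for
   [1 / theta] is compared with its value at [|q|]. Averaging over roots of unity then bounds
   [pbar(n) - (cosh mu(n) - sinh mu(n) / mu(n)) / (4 n)].

   With [r = sqrt (1 - t)] one has [Q t = 1 - (r / (1 + r))^2], so a lower bound for [u n] suffices.
   For [n >= 1501] it is [f n <= u n], the fifth powers in [f] absorbing the exponentially small
   error, and [Q t - t], of order [(1 - t)^(3/2)], exceeds [1000 / mu(n-1)^5]. For [n <= 1501] the
   numbers are computed from the recurrence [sum (-1)^l pbar(n - l^2) = 0]. *)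

(** * Finite sums and complex limits *)

(** The obstacle is the factor [sqrt z]: it has no expansion in powers of [1 / z]. Up to a constant
    it is the integral of [e^(-pi^2 s^2 / z)] over [s >= 0]. After multiplication by
    [e^(pi^2 / (4 z))] the part [s >= 1/2] stays bounded and is discarded, while on [[0, 1/2]] the
    exponent is [pi^2 (1/4 - s^2) / z], whose exponential series has positive coefficients and
    converges for every [z <> 0]. With [t = pi / (2 sqrt n)], the minimum of [n t + pi^2 / (4 t)], a
    bound [M] on the circle costs [M e^(n t) = M e^(mu(n) / 2)]. The circle is cut at
    [|theta| = 6 t]: inside, the difference of the two series is bounded; outside, both are at most
    a constant times [e^(0.3 mu(n) / 2)]. This leaves an error of order [e^(0.65 mu(n))] against
    [e^(mu(n))], which drops below the relative size [1 / mu(n)^5] that [f] tolerates once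
    [n >= 1500]. Since [u n] involves [pbar (n - 1)], computation has to cover everything below
    1501. *)

Fixpoint rsum (u : nat -> R) (n : nat) : R :=
  match n with O => 0 | S k => rsum u k + u k end.

Fixpoint csum (u : nat -> C) (n : nat) : C :=
  match n with O => 0%C | S k => (csum u k + u k)%C end.

Lemma rsum_ext (u v : nat -> R) n :
  (forall i, (i < n)%nat -> u i = v i) -> rsum u n = rsum v n.
Proof.
  induction n as [|n IH]; simpl; intros H; [easy|].
  rewrite IH, H; auto with arith.
Qed.

Lemma csum_ext (u v : nat -> C) n :
  (forall i, (i < n)%nat -> u i = v i) -> csum u n = csum v n.
Proof.
  induction n as [|n IH]; simpl; intros H; [easy|].
  rewrite IH, H; auto with arith.
Qed.

Lemma rsum_le (u v : nat -> R) n :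
  (forall i, (i < n)%nat -> u i <= v i) -> rsum u n <= rsum v n.
Proof.
  induction n as [|n IH]; simpl; intros H; [lra|].
  apply Rplus_le_compat; auto with arith.
Qed.

Lemma rsum_nonneg (u : nat -> R) n :
  (forall i, (i < n)%nat -> 0 <= u i) -> 0 <= rsum u n.
Proof.
  induction n as [|n IH]; simpl; intros H; [lra|].
  apply Rplus_le_le_0_compat; auto with arith.
Qed.

Lemma rsum_le_length (u : nat -> R) n m :
  (forall i, 0 <= u i) -> (n <= m)%nat -> rsum u n <= rsum u m.
Proof.
  intros H; induction 1; simpl; [lra|]. specialize (H m); lra.
Qed.

Lemma rsum_scal (c : R) (u : nat -> R) n :
  rsum (fun i => c * u i) n = c * rsum u n.
Proof. induction n as [|n IH]; simpl; [|rewrite IH]; ring. Qed.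

Lemma csum_scal (c : C) (u : nat -> C) n :
  csum (fun i => c * u i)%C n = (c * csum u n)%C.
Proof. induction n as [|n IH]; simpl; [|rewrite IH]; ring. Qed.

Lemma rsum_plus (u v : nat -> R) n :
  rsum (fun i => u i + v i) n = rsum u n + rsum v n.
Proof. induction n as [|n IH]; simpl; [|rewrite IH]; ring. Qed.

Lemma csum_plus (u v : nat -> C) n :
  csum (fun i => u i + v i)%C n = (csum u n + csum v n)%C.
Proof. induction n as [|n IH]; simpl; [|rewrite IH]; ring. Qed.

Lemma csum_minus (u v : nat -> C) n :
  csum (fun i => u i - v i)%C n = (csum u n - csum v n)%C.
Proof. induction n as [|n IH]; simpl; [|rewrite IH]; ring. Qed.

Lemma rsum_split_first (u : nat -> R) n :
  rsum u (S n) = u O + rsum (fun i => u (S i)) n.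
Proof. induction n as [|n IH]; simpl in *; [|rewrite IH]; ring. Qed.

Lemma csum_split_first (u : nat -> C) n :
  csum u (S n) = (u O + csum (fun i => u (S i)) n)%C.
Proof. induction n as [|n IH]; simpl in *; [|rewrite IH]; ring. Qed.

Lemma rsum_rev (u : nat -> R) n :
  rsum u n = rsum (fun i => u (n - 1 - i)%nat) n.
Proof.
  induction n as [|n IH]; [easy|].
  rewrite (rsum_split_first (fun i => u (S n - 1 - i)%nat)). simpl rsum at 1.
  rewrite IH, Rplus_comm. f_equal; [f_equal; lia|].
  apply rsum_ext; intros; f_equal; lia.
Qed.

Lemma rsum_exchange (u : nat -> nat -> R) n m :
  rsum (fun i => rsum (u i) m) n = rsum (fun j => rsum (fun i => u i j) n) m.
Proof.
  induction n as [|n IH]; simpl.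
  - induction m as [|m IH]; simpl; [|rewrite <- IH]; ring.
  - rewrite IH, <- rsum_plus. easy.
Qed.

Lemma csum_exchange (u : nat -> nat -> C) n m :
  csum (fun i => csum (u i) m) n = csum (fun j => csum (fun i => u i j) n) m.
Proof.
  induction n as [|n IH]; simpl.
  - induction m as [|m IH]; simpl; [|rewrite <- IH]; ring.
  - rewrite IH, <- csum_plus. easy.
Qed.

Lemma Cmod_csum_le (u : nat -> C) (v : nat -> R) n :
  (forall i, (i < n)%nat -> Cmod (u i) <= v i) -> Cmod (csum u n) <= rsum v n.
Proof.
  induction n as [|n IH]; simpl; intros H; [rewrite Cmod_0; lra|].
  eapply Rle_trans; [apply Cmod_triangle|].
  apply Rplus_le_compat; auto with arith.
Qed.

Lemma csum_RtoC (u : nat -> R) n : csum (fun i => RtoC (u i)) n = RtoC (rsum u n).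
Proof. induction n as [|n IH]; simpl; [easy|]. rewrite IH, RtoC_plus. easy. Qed.

Lemma Re_csum (u : nat -> C) n : Re (csum u n) = rsum (fun i => Re (u i)) n.
Proof. induction n as [|n IH]; simpl; [|rewrite <- IH]; easy. Qed.

Lemma Im_csum (u : nat -> C) n : Im (csum u n) = rsum (fun i => Im (u i)) n.
Proof. induction n as [|n IH]; simpl; [|rewrite <- IH]; easy. Qed.

Lemma C_ext (a b : C) : Re a = Re b -> Im a = Im b -> a = b.
Proof. destruct a, b; unfold Re, Im; simpl; intros -> ->; easy. Qed.

Lemma Cmod_le_Re_Im (a : C) : Cmod a <= Rabs (Re a) + Rabs (Im a).
Proof.
  assert (Rabs (Re a) ^ 2 = Re a ^ 2 /\ Rabs (Im a) ^ 2 = Im a ^ 2) as [H1 H2].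
  { split; apply pow2_abs. }
  apply Rsqr_incr_0_var.
  2: { generalize (Rabs_pos (Re a)) (Rabs_pos (Im a)); lra. }
  rewrite !Rsqr_pow2, Cmod2_alt.
  generalize (Rabs_pos (Re a)) (Rabs_pos (Im a)); nra.
Qed.

Lemma im_le_Cmod (c : C) : Rabs (Im c) <= Cmod c.
Proof.
  eapply Rle_trans; [|apply Rmax_Cmod]. apply Rmax_r.
Qed.

Lemma Cmod_minus_sym (a b : C) : Cmod (a - b) = Cmod (b - a).
Proof. rewrite <- Cmod_opp. f_equal. ring. Qed.

Lemma Cmod_le_plus_diff (a b : C) : Cmod a <= Cmod b + Cmod (a - b).
Proof. replace a with (b + (a - b))%C at 1 by ring. apply Cmod_triangle. Qed.

(** * Limits of complex sequences *)

Definition Clim (u : nat -> C) (l : C) : Prop :=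
  is_lim_seq (fun n => Cmod (u n - l)) 0.

Lemma lim_seq_dominated (u v : nat -> R) :
  (forall n, 0 <= u n <= v n) -> is_lim_seq v 0 -> is_lim_seq u 0.
Proof.
  intros H Hv. apply (is_lim_seq_le_le (fun _ => 0) u v); auto.
  apply is_lim_seq_const.
Qed.

Lemma lim_seq_dominated_eventually (u v : nat -> R) N :
  (forall n, (N <= n)%nat -> 0 <= u n <= v n) -> is_lim_seq v 0 -> is_lim_seq u 0.
Proof.
  intros H Hv. apply (is_lim_seq_le_le_loc (fun _ => 0) u v); auto.
  - exists N; auto.
  - apply is_lim_seq_const.
Qed.

Lemma lim_seq_plus0 (u v : nat -> R) :
  is_lim_seq u 0 -> is_lim_seq v 0 -> is_lim_seq (fun n => u n + v n) 0.
Proof.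
  intros Hu Hv. replace (Finite 0) with (Finite (0 + 0)) by (f_equal; lra).
  apply is_lim_seq_plus'; auto.
Qed.

Lemma lim_seq_scal0 (c : R) (u : nat -> R) :
  is_lim_seq u 0 -> is_lim_seq (fun n => c * u n) 0.
Proof.
  intros Hu. replace (Finite 0) with (Rbar_mult c 0) by (simpl; f_equal; lra).
  apply is_lim_seq_scal_l; auto.
Qed.

Lemma lim_seq_mult0 (u v : nat -> R) :
  is_lim_seq u 0 -> is_lim_seq v 0 -> is_lim_seq (fun n => u n * v n) 0.
Proof.
  intros Hu Hv. replace (Finite 0) with (Finite (0 * 0)) by (f_equal; lra).
  apply is_lim_seq_mult'; auto.
Qed.

Lemma Clim_ext (u v : nat -> C) l : (forall n, u n = v n) -> Clim u l -> Clim v l.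
Proof.
  intros H. apply is_lim_seq_ext. intros n; rewrite H; easy.
Qed.

Lemma Clim_const (c : C) : Clim (fun _ => c) c.
Proof.
  apply is_lim_seq_ext with (fun _ => 0); [|apply is_lim_seq_const].
  intros _. replace (c - c)%C with (RtoC 0) by ring. rewrite Cmod_0; easy.
Qed.

Lemma Clim_plus (u v : nat -> C) l m :
  Clim u l -> Clim v m -> Clim (fun n => u n + v n)%C (l + m)%C.
Proof.
  intros Hu Hv. eapply lim_seq_dominated; [|apply (lim_seq_plus0 _ _ Hu Hv)].
  intros n; split; [apply Cmod_ge_0|].
  replace (u n + v n - (l + m))%C with ((u n - l) + (v n - m))%C by ring.
  apply Cmod_triangle.
Qed.

Lemma Clim_mult (u v : nat -> C) l m :
  Clim u l -> Clim v m -> Clim (fun n => u n * v n)%C (l * m)%C.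
Proof.
  intros Hu Hv.
  eapply lim_seq_dominated;
    [|apply (lim_seq_plus0 _ _ (lim_seq_mult0 _ _ Hu Hv)
         (lim_seq_plus0 _ _ (lim_seq_scal0 (Cmod m) _ Hu) (lim_seq_scal0 (Cmod l) _ Hv)))].
  intros n; split; [apply Cmod_ge_0|]; cbv beta.
  replace (u n * v n - l * m)%C with
    ((u n - l) * (v n - m) + (m * (u n - l) + l * (v n - m)))%C by ring.
  eapply Rle_trans; [apply Cmod_triangle|].
  rewrite Cmod_mult. apply Rplus_le_compat_l.
  eapply Rle_trans; [apply Cmod_triangle|]. rewrite !Cmod_mult. lra.
Qed.

Lemma Clim_scal (c : C) (u : nat -> C) l :
  Clim u l -> Clim (fun n => c * u n)%C (c * l)%C.
Proof. intros. apply Clim_mult; auto. apply Clim_const. Qed.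

Lemma Clim_minus (u v : nat -> C) l m :
  Clim u l -> Clim v m -> Clim (fun n => u n - v n)%C (l - m)%C.
Proof.
  intros Hu Hv. replace (l - m)%C with (l + (- (1)) * m)%C by ring.
  apply Clim_ext with (fun n => u n + (- (1)) * v n)%C; [intros; ring|].
  apply Clim_plus; auto. apply Clim_scal; auto.
Qed.

Lemma Clim_csum (u : nat -> nat -> C) (l : nat -> C) K :
  (forall i, (i < K)%nat -> Clim (u i) (l i)) ->
  Clim (fun n => csum (fun i => u i n) K) (csum l K).
Proof.
  induction K as [|K IH]; simpl; intros H; [apply Clim_const|].
  apply Clim_plus; auto with arith.
Qed.

Lemma Clim_shift (u : nat -> C) l k : Clim u l -> Clim (fun n => u (n + k)%nat) l.
Proof.
  unfold Clim. intros H.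
  apply (is_lim_seq_incr_n (fun n => Cmod (u n - l)) k). easy.
Qed.

Lemma Clim_le_eventually (u : nat -> C) l M N :
  Clim u l -> (forall n, (N <= n)%nat -> Cmod (u n) <= M) -> Cmod l <= M.
Proof.
  intros Hu H.
  assert (is_lim_seq (fun n => M + Cmod (u n - l)) (M + 0)) as HM.
  { apply is_lim_seq_plus'; auto. apply is_lim_seq_const. }
  rewrite Rplus_0_r in HM.
  apply (is_lim_seq_le_loc (fun _ => Cmod l) (fun n => M + Cmod (u n - l)) (Cmod l) M); auto.
  - exists N. intros n Hn. specialize (H n Hn).
    generalize (Cmod_le_plus_diff l (u n)). rewrite Cmod_minus_sym. lra.
  - apply is_lim_seq_const.
Qed.

Lemma Clim_le (u : nat -> C) l M :
  Clim u l -> (forall n, Cmod (u n) <= M) -> Cmod l <= M.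
Proof. intros Hu H. apply (Clim_le_eventually u l M 0); auto. Qed.

Lemma Clim_unique (u : nat -> C) l m : Clim u l -> Clim u m -> l = m.
Proof.
  intros Hl Hm.
  generalize (Clim_minus _ _ _ _ Hl Hm). intros H.
  assert (Cmod (l - m) <= 0) as H0.
  { apply (Clim_le _ _ _ H). intros n.
    replace (u n - u n)%C with (RtoC 0) by ring. rewrite Cmod_0; lra. }
  assert ((l - m)%C = 0) as H1.
  { apply Cmod_eq_0. generalize (Cmod_ge_0 (l - m)). lra. }
  replace l with (l - m + m)%C by ring. rewrite H1; ring.
Qed.

Lemma Clim_of_zero_diff (u v : nat -> C) l :
  Clim u l -> is_lim_seq (fun n => Cmod (v n - u n)) 0 -> Clim v l.
Proof.
  intros Hu Hd. eapply lim_seq_dominated; [|apply (lim_seq_plus0 _ _ Hd Hu)].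
  intros n; split; [apply Cmod_ge_0|].
  replace (v n - l)%C with ((v n - u n) + (u n - l))%C by ring.
  apply Cmod_triangle.
Qed.

Lemma Clim_RtoC (u : nat -> R) (l : R) :
  is_lim_seq u l -> Clim (fun n => RtoC (u n)) (RtoC l).
Proof.
  intros H. unfold Clim.
  apply is_lim_seq_ext with (fun n => Rabs (u n - l)).
  { intros n. rewrite <- RtoC_minus, Cmod_R; easy. }
  replace (Finite 0) with (Finite (Rabs 0)) by (f_equal; apply Rabs_R0).
  apply (is_lim_seq_abs (fun n => u n - l) 0).
  replace (Finite 0) with (Finite (l - l)) by (f_equal; lra).
  apply is_lim_seq_minus'; auto. apply is_lim_seq_const.
Qed.

Lemma rsum_sum_n (u : nat -> R) n : rsum u (S n) = sum_n u n.
Proof.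
  induction n as [|n IH].
  - rewrite sum_O. simpl. ring.
  - rewrite sum_Sn, <- IH. easy.
Qed.

(** [rsum u n] omits the index [n] while [sum_n u n] includes it; the shift by one disappears in the
    limit. *)
Lemma rsum_lim_iff_series (u : nat -> R) (l : R) :
  is_lim_seq (rsum u) l <-> is_series u l.
Proof.
  change (is_series u l) with (is_lim_seq (sum_n u) (Finite l)). split; intros H.
  - apply is_lim_seq_incr_1 in H. revert H.
    apply is_lim_seq_ext. intros; apply rsum_sum_n.
  - apply is_lim_seq_incr_1. revert H.
    apply is_lim_seq_ext. intros; symmetry; apply rsum_sum_n.
Qed.

Lemma rsum_bounded_cv (v : nat -> R) B :
  (forall i, 0 <= v i) -> (forall n, rsum v n <= B) ->
  exists l : R, is_lim_seq (rsum v) l /\ (forall n, rsum v n <= l) /\ l <= B.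
Proof.
  intros Hv HB.
  assert (Hi : forall n, rsum v n <= rsum v (S n)) by (intros n; simpl; specialize (Hv n); lra).
  destruct (ex_finite_lim_seq_incr (rsum v) B Hi HB) as [l Hl].
  exists l; split; [easy|]; split.
  - intros n. apply (is_lim_seq_incr_compare _ _ Hl Hi).
  - apply (is_lim_seq_le (rsum v) (fun _ => B) l B); auto. apply is_lim_seq_const.
Qed.

Lemma csum_dominated_cv (u : nat -> C) (v : nat -> R) B :
  (forall i, Cmod (u i) <= v i) -> (forall n, rsum v n <= B) ->
  exists l, Clim (csum u) l.
Proof.
  intros Huv HB.
  assert (Hv : forall i, 0 <= v i).
  { intros i. eapply Rle_trans; [apply Cmod_ge_0|apply Huv]. }
  destruct (rsum_bounded_cv v B Hv HB) as [s [Hs _]].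
  apply rsum_lim_iff_series in Hs.
  assert (Hc : forall w : nat -> R, (forall i, Rabs (w i) <= v i) ->
            exists l : R, is_lim_seq (rsum w) l).
  { intros w Hw. destruct (ex_series_le w v) as [l Hl].
    - intros n. apply Hw.
    - exists s; easy.
    - exists l. apply rsum_lim_iff_series. easy. }
  destruct (Hc (fun i => Re (u i))) as [a Ha].
  { intros i. eapply Rle_trans; [apply re_le_Cmod|apply Huv]. }
  destruct (Hc (fun i => Im (u i))) as [b Hb].
  { intros i. eapply Rle_trans; [apply im_le_Cmod|apply Huv]. }
  exists (a, b).
  apply Clim_RtoC in Ha. apply Clim_RtoC in Hb.
  replace ((a, b) : C) with (a + Ci * b)%C.
  2: { apply C_ext; unfold Re, Im; simpl; ring. }
  eapply Clim_ext; [|apply (Clim_plus _ _ _ _ Ha (Clim_scal Ci _ _ Hb))].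
  intros n. cbv beta. rewrite <- Re_csum, <- Im_csum.
  destruct (csum u n) as [x y]. apply C_ext; unfold Re, Im; simpl; ring.
Qed.

Lemma csum_shift (a : nat -> C) n k :
  csum a (n + k) = (csum a n + csum (fun i => a (n + i)%nat) k)%C.
Proof.
  induction k as [|k IH]; simpl.
  - rewrite Nat.add_0_r; ring.
  - rewrite Nat.add_succ_r; simpl. rewrite IH; ring.
Qed.

Lemma rsum_shift (a : nat -> R) n k :
  rsum a (n + k) = rsum a n + rsum (fun i => a (n + i)%nat) k.
Proof.
  induction k as [|k IH]; simpl.
  - rewrite Nat.add_0_r; ring.
  - rewrite Nat.add_succ_r; simpl. rewrite IH; ring.
Qed.

(** For [m >= n] the difference [csum u m - csum u n] is at most [rsum v m - rsum v n], and [m]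
    tends to infinity. Exchanges of a limit with a series below rest on this explicit tail. *)
Lemma Cmod_csum_tail_le (u : nat -> C) (v : nat -> R) (l : C) (s : R) n :
  (forall i, Cmod (u i) <= v i) -> is_lim_seq (rsum v) s -> Clim (csum u) l ->
  Cmod (l - csum u n) <= s - rsum v n.
Proof.
  intros Huv Hs Hl.
  assert (Hv : forall i, 0 <= v i).
  { intros i. eapply Rle_trans; [apply Cmod_ge_0|apply Huv]. }
  assert (H : Clim (fun m => csum u m - csum u n)%C (l - csum u n)).
  { apply Clim_minus; auto. apply Clim_const. }
  apply (Clim_le_eventually _ _ _ n H). intros m Hm.
  replace m with (n + (m - n))%nat by lia.
  rewrite csum_shift.
  match goal with |- Cmod ?x <= _ =>
    replace x with (csum (fun i => u (n + i)%nat) (m - n)) by ring end.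
  eapply Rle_trans; [apply Cmod_csum_le; intros; apply Huv|].
  assert (Hi : forall n, rsum v n <= rsum v (S n)) by (intros k; simpl; specialize (Hv k); lra).
  generalize (is_lim_seq_incr_compare _ _ Hs Hi m).
  replace m with (n + (m - n))%nat at 1 by lia. rewrite rsum_shift. lra.
Qed.

(** * The complex exponential *)

Definition cexp (z : C) : C := (exp (Re z) * cos (Im z), exp (Re z) * sin (Im z)).

Lemma cexp_plus (a b : C) : cexp (a + b) = (cexp a * cexp b)%C.
Proof.
  unfold cexp. destruct a as [a1 a2], b as [b1 b2].
  apply C_ext; unfold Re, Im; simpl; rewrite exp_plus; [rewrite cos_plus|rewrite sin_plus]; ring.
Qed.

Lemma cexp_0 : cexp 0 = 1.
Proof.
  apply C_ext; unfold cexp, Re, Im; simpl; rewrite exp_0; [rewrite cos_0|rewrite sin_0]; ring.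
Qed.

Lemma Cmod_cexp (z : C) : Cmod (cexp z) = exp (Re z).
Proof.
  unfold Cmod, cexp; simpl.
  replace (_ + _) with (Rsqr (exp (Re z))).
  { apply sqrt_Rsqr. left; apply exp_pos. }
  generalize (sin2_cos2 (Im z)). unfold Rsqr. nra.
Qed.

Lemma cexp_RtoC (x : R) : cexp x = exp x.
Proof.
  apply C_ext; unfold cexp, Re, Im; simpl; [rewrite cos_0|rewrite sin_0]; ring.
Qed.

Lemma cexp_opp (z : C) : (cexp z * cexp (- z) = 1)%C.
Proof. rewrite <- cexp_plus, <- cexp_0. f_equal. ring. Qed.

Lemma cexp_pow (z : C) n : (cexp z ^ n)%C = cexp (RtoC (INR n) * z).
Proof.
  induction n as [|n IH].
  - simpl. rewrite <- cexp_0. f_equal. ring.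
  - rewrite Cpow_S, IH, <- cexp_plus. f_equal. rewrite S_INR, RtoC_plus. ring.
Qed.

(** * Calculus of complex-valued functions of a real variable *)

(** Continuity, derivative and integral are componentwise, the first two at all real points, so that
    the real results transfer without conditions on a domain. *)
Definition Ccont (f : R -> C) : Prop :=
  forall x, continuous (fun s => Re (f s)) x /\ continuous (fun s => Im (f s)) x.

Definition Cder (f f' : R -> C) : Prop :=
  forall x, is_derive (fun s => Re (f s)) x (Re (f' x)) /\
            is_derive (fun s => Im (f s)) x (Im (f' x)).

Definition CInt (f : R -> C) (a b : R) : C :=
  (RInt (fun s => Re (f s)) a b, RInt (fun s => Im (f s)) a b).

Lemma continuous_ex_RInt (f : R -> R) a b : (forall x, continuous f x) -> ex_RInt f a b.
Proof. intros H. apply (ex_RInt_continuous (V := R_CompleteNormedModule)); auto. Qed.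

Lemma Ccont_plus f g : Ccont f -> Ccont g -> Ccont (fun s => f s + g s)%C.
Proof.
  intros Hf Hg x. destruct (Hf x), (Hg x). split.
  - apply (continuous_plus (fun s => Re (f s)) (fun s => Re (g s))); easy.
  - apply (continuous_plus (fun s => Im (f s)) (fun s => Im (g s))); easy.
Qed.

Lemma Ccont_mult f g : Ccont f -> Ccont g -> Ccont (fun s => f s * g s)%C.
Proof.
  intros Hf Hg x. destruct (Hf x), (Hg x). split; unfold Re, Im in *; simpl.
  - apply (continuous_minus (V := R_NormedModule)
      (fun s => fst (f s) * fst (g s)) (fun s => snd (f s) * snd (g s)));
    apply (continuous_mult (K := R_AbsRing)); easy.
  - apply (continuous_plus (V := R_NormedModule)
      (fun s => fst (f s) * snd (g s)) (fun s => snd (f s) * fst (g s)));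
    apply (continuous_mult (K := R_AbsRing)); easy.
Qed.

Lemma Ccont_const (c : C) : Ccont (fun _ => c).
Proof. intros x; split; apply continuous_const. Qed.

Lemma Ccont_RtoC (f : R -> R) : (forall x, continuous f x) -> Ccont (fun s => RtoC (f s)).
Proof. intros H x; split; simpl; auto. apply continuous_const. Qed.

Lemma Ccont_ext (f g : R -> C) : (forall x, f x = g x) -> Ccont f -> Ccont g.
Proof.
  intros H Hf x; destruct (Hf x); split.
  - apply continuous_ext with (fun s => Re (f s)); [intros; rewrite H|]; easy.
  - apply continuous_ext with (fun s => Im (f s)); [intros; rewrite H|]; easy.
Qed.

Lemma Ccont_csum (f : nat -> R -> C) K :
  (forall i, Ccont (f i)) -> Ccont (fun s => csum (fun i => f i s) K).
Proof.
  intros H; induction K as [|K IH]; simpl; [apply Ccont_const|].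
  apply Ccont_plus; auto.
Qed.

Lemma Ccont_cexp f : Ccont f -> Ccont (fun s => cexp (f s)).
Proof.
  intros Hf x. destruct (Hf x) as [H1 H2]. unfold cexp; split; unfold Re, Im in *; simpl;
  apply (continuous_mult (K := R_AbsRing)).
  - apply (continuous_comp (fun s => fst (f s)) exp); auto. apply continuous_exp.
  - apply (continuous_comp (fun s => snd (f s)) cos); auto. apply continuous_cos.
  - apply (continuous_comp (fun s => fst (f s)) exp); auto. apply continuous_exp.
  - apply (continuous_comp (fun s => snd (f s)) sin); auto. apply continuous_sin.
Qed.

Lemma Ccont_Cmod f : Ccont f -> forall x, continuous (fun s => Cmod (f s)) x.
Proof.
  intros Hf x. destruct (Hf x) as [H1 H2]. unfold Cmod.
  apply (continuous_comp (fun s => fst (f s) ^ 2 + snd (f s) ^ 2) sqrt).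
  - apply (continuous_plus (V := R_NormedModule)
      (fun s => fst (f s) ^ 2) (fun s => snd (f s) ^ 2));
    apply (continuous_comp _ (fun y => y ^ 2)); auto;
    apply (ex_derive_continuous (fun y => y ^ 2)); auto_derive; auto.
  - apply continuous_sqrt.
Qed.

Lemma Cder_Ccont f f' : Cder f f' -> Ccont f.
Proof.
  intros H x; destruct (H x) as [H1 H2]; split;
  [apply (ex_derive_continuous (fun s => Re (f s)))|apply (ex_derive_continuous (fun s => Im (f s)))];
  eexists; eauto.
Qed.

Lemma Cder_ext f f' g' : (forall x, f' x = g' x) -> Cder f f' -> Cder f g'.
Proof. intros H Hf x. rewrite <- H. apply Hf. Qed.

Lemma Cder_plus f f' g g' : Cder f f' -> Cder g g' ->
  Cder (fun s => f s + g s)%C (fun s => f' s + g' s)%C.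
Proof.
  intros Hf Hg x. destruct (Hf x), (Hg x). split.
  - apply (is_derive_plus (fun s => Re (f s)) (fun s => Re (g s))); easy.
  - apply (is_derive_plus (fun s => Im (f s)) (fun s => Im (g s))); easy.
Qed.

Lemma is_derive_mult_R (f g : R -> R) x (a b c : R) :
  is_derive f x a -> is_derive g x b -> c = a * g x + f x * b ->
  is_derive (fun s => f s * g s) x c.
Proof.
  intros H1 H2 ->. apply (is_derive_mult f g x a b H1 H2). intros; apply Rmult_comm.
Qed.

Lemma Cder_mult f f' g g' : Cder f f' -> Cder g g' ->
  Cder (fun s => f s * g s)%C (fun s => f' s * g s + f s * g' s)%C.
Proof.
  intros Hf Hg x. destruct (Hf x) as [f1 f2], (Hg x) as [g1 g2].
  unfold Re, Im in *; simpl; split.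
  - evar_last.
    + apply (is_derive_minus (V := R_NormedModule)
        (fun s => fst (f s) * fst (g s)) (fun s => snd (f s) * snd (g s)));
      (eapply is_derive_mult_R; [eassumption|eassumption|reflexivity]).
    + unfold minus, plus, opp; simpl. ring.
  - evar_last.
    + apply (is_derive_plus (V := R_NormedModule)
        (fun s => fst (f s) * snd (g s)) (fun s => snd (f s) * fst (g s)));
      (eapply is_derive_mult_R; [eassumption|eassumption|reflexivity]).
    + unfold minus, plus, opp; simpl. ring.
Qed.

Lemma Cder_const (c : C) : Cder (fun _ => c) (fun _ => RtoC 0).
Proof. intros x; split; apply (is_derive_const (V := R_NormedModule)). Qed.

Lemma Cder_RtoC (f f' : R -> R) : (forall x, is_derive f x (f' x)) ->
  Cder (fun s => RtoC (f s)) (fun s => RtoC (f' s)).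
Proof. intros H x; split; simpl; auto. apply (is_derive_const (V := R_NormedModule)). Qed.

Lemma Cder_scal (c : C) f f' : Cder f f' -> Cder (fun s => c * f s)%C (fun s => c * f' s)%C.
Proof.
  intros H. eapply Cder_ext; [|apply (Cder_mult _ _ _ _ (Cder_const c) H)].
  intros x; cbv beta; ring.
Qed.

Lemma Cder_cexp f f' : Cder f f' -> Cder (fun s => cexp (f s)) (fun s => f' s * cexp (f s))%C.
Proof.
  intros Hf x. destruct (Hf x) as [f1 f2].
  unfold cexp, Re, Im in *; simpl; split.
  - eapply (is_derive_mult_R (fun s => exp (fst (f s))) (fun s => cos (snd (f s)))).
    + apply (is_derive_comp exp (fun s => fst (f s)) x (exp (fst (f x)))); [apply is_derive_exp|exact f1].
    + apply (is_derive_comp cos (fun s => snd (f s)) x (- sin (snd (f x)))); [apply is_derive_cos|exact f2].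
    + unfold scal; simpl; unfold mult; simpl. ring.
  - eapply (is_derive_mult_R (fun s => exp (fst (f s))) (fun s => sin (snd (f s)))).
    + apply (is_derive_comp exp (fun s => fst (f s)) x (exp (fst (f x)))); [apply is_derive_exp|exact f1].
    + apply (is_derive_comp sin (fun s => snd (f s)) x (cos (snd (f x)))); [apply is_derive_sin|exact f2].
    + unfold scal; simpl; unfold mult; simpl. ring.
Qed.

Lemma Cder_cexp_lin (c : C) :
  Cder (fun s => cexp (c * RtoC s)) (fun s => c * cexp (c * RtoC s))%C.
Proof.
  eapply Cder_ext; [|apply Cder_cexp, Cder_scal, (Cder_RtoC (fun s => s) (fun _ => 1))].
  - intros x; cbv beta. ring.
  - intros x. apply (is_derive_id (K := R_AbsRing)).
Qed.

Lemma CInt_ext f g a b : (forall s, f s = g s) -> CInt f a b = CInt g a b.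
Proof. intros H; unfold CInt; f_equal; apply RInt_ext; intros; rewrite H; easy. Qed.

Lemma CInt_plus f g a b : Ccont f -> Ccont g ->
  CInt (fun s => f s + g s)%C a b = (CInt f a b + CInt g a b)%C.
Proof.
  intros Hf Hg; unfold CInt, Cplus; simpl; f_equal.
  - apply (RInt_plus (V := R_CompleteNormedModule) (fun s => Re (f s)) (fun s => Re (g s)));
    apply continuous_ex_RInt; intros; [apply Hf|apply Hg].
  - apply (RInt_plus (V := R_CompleteNormedModule) (fun s => Im (f s)) (fun s => Im (g s)));
    apply continuous_ex_RInt; intros; [apply Hf|apply Hg].
Qed.

Lemma RInt_lin2 (f g : R -> R) (u v a b : R) :
  (forall x, continuous f x) -> (forall x, continuous g x) ->
  RInt (fun s => u * f s + v * g s) a b = u * RInt f a b + v * RInt g a b.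
Proof.
  intros Hf Hg.
  assert (If : ex_RInt f a b) by (apply continuous_ex_RInt; auto).
  assert (Ig : ex_RInt g a b) by (apply continuous_ex_RInt; auto).
  rewrite (RInt_plus (V := R_CompleteNormedModule) (fun s => u * f s) (fun s => v * g s)).
  - rewrite (RInt_scal (V := R_CompleteNormedModule) f), (RInt_scal (V := R_CompleteNormedModule) g); auto.
  - apply (ex_RInt_scal (V := R_CompleteNormedModule) f); auto.
  - apply (ex_RInt_scal (V := R_CompleteNormedModule) g); auto.
Qed.

Lemma RInt_scal_R (k : R) (f : R -> R) a b : (forall x, continuous f x) ->
  RInt (fun s => k * f s) a b = k * RInt f a b.
Proof.
  intros H. apply (RInt_scal (V := R_CompleteNormedModule) f). apply continuous_ex_RInt; auto.
Qed.

Lemma CInt_scal (c : C) f a b : Ccont f ->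
  CInt (fun s => c * f s)%C a b = (c * CInt f a b)%C.
Proof.
  intros Hf; unfold CInt; apply C_ext; unfold Re, Im; simpl.
  - rewrite (RInt_ext _ (fun s => fst c * Re (f s) + (- snd c) * Im (f s)))
      by (intros; unfold Re, Im; simpl; ring).
    rewrite RInt_lin2; [unfold Re, Im; simpl; ring| |]; intros; apply Hf.
  - rewrite (RInt_ext _ (fun s => fst c * Im (f s) + snd c * Re (f s)))
      by (intros; unfold Re, Im; simpl; ring).
    rewrite RInt_lin2; [unfold Re, Im; simpl; ring| |]; intros; apply Hf.
Qed.

Lemma CInt_RtoC (f : R -> R) a b : (forall x, continuous f x) ->
  CInt (fun s => RtoC (f s)) a b = RtoC (RInt f a b).
Proof.
  intros Hf. unfold CInt. apply C_ext; unfold Re, Im; simpl; [easy|].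
  rewrite RInt_const. unfold scal; simpl; unfold mult; simpl. ring.
Qed.

Lemma CInt_csum (f : nat -> R -> C) K a b : (forall i, Ccont (f i)) ->
  CInt (fun s => csum (fun i => f i s) K) a b = csum (fun i => CInt (f i) a b) K.
Proof.
  intros H; induction K as [|K IH]; simpl.
  - unfold CInt. apply C_ext; unfold Re, Im; simpl; rewrite RInt_const;
    unfold scal; simpl; unfold mult; simpl; ring.
  - rewrite CInt_plus, IH; auto. apply Ccont_csum; auto.
Qed.

Lemma CInt_der f f' a b : Cder f f' -> Ccont f' -> CInt f' a b = (f b - f a)%C.
Proof.
  intros Hd Hc. unfold CInt, Cminus, Cplus, Copp; simpl. apply f_equal2.
  - rewrite (is_RInt_unique (fun s => Re (f' s)) a b (minus (Re (f b)) (Re (f a)))); [easy|].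
    apply (is_RInt_derive (fun s => Re (f s))); intros; [apply Hd|apply Hc].
  - rewrite (is_RInt_unique (fun s => Im (f' s)) a b (minus (Im (f b)) (Im (f a)))); [easy|].
    apply (is_RInt_derive (fun s => Im (f s))); intros; [apply Hd|apply Hc].
Qed.

Lemma CInt_Chasles f a b c : Ccont f -> (CInt f a b + CInt f b c)%C = CInt f a c.
Proof.
  intros Hf. unfold CInt, Cplus; simpl. f_equal.
  - apply (RInt_Chasles (V := R_CompleteNormedModule) (fun s => Re (f s)));
    apply continuous_ex_RInt; intros; apply Hf.
  - apply (RInt_Chasles (V := R_CompleteNormedModule) (fun s => Im (f s)));
    apply continuous_ex_RInt; intros; apply Hf.
Qed.

Lemma Cmod_CInt_le f (g : R -> R) a b : a <= b -> Ccont f -> (forall x, continuous g x) ->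
  (forall s, a <= s <= b -> Cmod (f s) <= g s) -> Cmod (CInt f a b) <= RInt g a b.
Proof.
  intros Hab Hf Hg H.
  assert (Hi : is_RInt (V := C_R_NormedModule) f a b (CInt f a b)).
  { apply (is_RInt_fct_extend_pair (U := R_NormedModule) (V := R_NormedModule) f a b).
    - apply (RInt_correct (V := R_CompleteNormedModule) (fun s => Re (f s))).
      apply continuous_ex_RInt; intros; apply Hf.
    - apply (RInt_correct (V := R_CompleteNormedModule) (fun s => Im (f s))).
      apply continuous_ex_RInt; intros; apply Hf. }
  rewrite Cmod_norm.
  apply (norm_RInt_le (V := C_R_NormedModule) f g a b); auto.
  - intros x Hx. specialize (H x Hx). rewrite Cmod_norm in H. exact H.
  - apply (RInt_correct (V := R_CompleteNormedModule)). apply continuous_ex_RInt; auto.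
Qed.

(** The mean value theorem fails for complex values, so it is applied to the real and the imaginary
    part separately; this is the source of the factor 2. *)
Lemma Cder_bound f f' (a b B : R) : a <= b -> Cder f f' ->
  (forall s, a <= s <= b -> Cmod (f' s) <= B) -> Cmod (f b - f a) <= 2 * B * (b - a).
Proof.
  intros Hab Hd HB.
  assert (HM : forall (g g' : R -> R), (forall x, is_derive g x (g' x)) ->
     (forall s, a <= s <= b -> Rabs (g' s) <= B) -> Rabs (g b - g a) <= B * (b - a)).
  { intros g g' Hg Hb.
    destruct (MVT_gen g a b g') as [c [Hc Heq]].
    - intros; apply Hg.
    - intros x _. apply continuity_pt_filterlim, (ex_derive_continuous g). eexists; apply Hg.
    - rewrite Rmin_left, Rmax_right in Hc by easy.
      rewrite Heq, Rabs_mult, (Rabs_right (b - a)) by lra.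
      apply Rmult_le_compat_r; [lra|]. auto. }
  eapply Rle_trans; [apply Cmod_le_Re_Im|].
  assert (H1 := HM (fun s => Re (f s)) (fun s => Re (f' s)) (fun x => proj1 (Hd x))).
  assert (H2 := HM (fun s => Im (f s)) (fun s => Im (f' s)) (fun x => proj2 (Hd x))).
  unfold Re, Im in *; simpl in *.
  cut (Rabs (fst (f b) - fst (f a)) <= B * (b - a) /\ Rabs (snd (f b) - snd (f a)) <= B * (b - a)).
  { unfold Rminus. lra. }
  split; [apply H1|apply H2]; intros s Hs; eapply Rle_trans; [|apply (HB s Hs)| |apply (HB s Hs)].
  - apply re_le_Cmod.
  - apply im_le_Cmod.
Qed.

(** * Coefficient extraction *)

(** Multiplied by [2 sin b], [b = pi l / N], the sum telescopes to a difference of two sines whose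
    arguments differ by [2 l pi]; [0 < l < N] makes [sin b] positive. *)
Lemma sum_cos_progression (alpha : R) (N l : nat) : (0 < l < N)%nat ->
  rsum (fun j => cos (alpha + INR j * (2 * PI * INR l / INR N))) N = 0.
Proof.
  intros Hl. assert (HN : 0 < INR N) by (apply lt_0_INR; lia).
  assert (Hl0 : 0 < INR l) by (apply lt_0_INR; lia).
  assert (HlN : INR l < INR N) by (apply lt_INR; lia).
  set (b := PI * INR l / INR N).
  assert (Hb : 0 < b < PI).
  { generalize PI_RGT_0; intros HP. unfold b. split.
    - apply Rdiv_lt_0_compat; [apply Rmult_lt_0_compat|]; lra.
    - apply Rmult_lt_reg_r with (INR N); [easy|]. unfold Rdiv.
      rewrite Rmult_assoc, Rinv_l, Rmult_1_r by lra. apply Rmult_lt_compat_l; lra. }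
  assert (Hs : 0 < sin b) by (apply sin_gt_0; lra).
  assert (H : forall n, 2 * sin b * rsum (fun j => cos (alpha + INR j * (2 * PI * INR l / INR N))) n
     = sin (alpha + (2 * INR n - 1) * b) - sin (alpha - b)).
  { induction n as [|n IH].
    - simpl. replace (alpha + (2 * 0 - 1) * b) with (alpha - b) by ring. ring.
    - cbn [rsum]. rewrite Rmult_plus_distr_l, IH, S_INR.
      replace (alpha + INR n * (2 * PI * INR l / INR N)) with (alpha + 2 * INR n * b)
        by (unfold b; field; lra).
      replace (alpha + (2 * INR n - 1) * b) with ((alpha + 2 * INR n * b) - b) by ring.
      replace (alpha + (2 * (INR n + 1) - 1) * b) with ((alpha + 2 * INR n * b) + b) by ring.
      rewrite sin_plus, sin_minus. ring. }
  specialize (H N).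
  replace (alpha + (2 * INR N - 1) * b) with ((alpha - b) + 2 * INR l * PI) in H
    by (unfold b; field; lra).
  rewrite sin_period in H.
  apply Rmult_eq_reg_l with (2 * sin b); lra.
Qed.

Lemma Re_RtoC_mult (x : R) (c : C) : Re (RtoC x * c) = x * Re c.
Proof. unfold Re; simpl. ring. Qed.

Lemma exp_pow_INR (x : R) n : exp x ^ n = exp (INR n * x).
Proof.
  rewrite <- Rpower_pow by apply exp_pos. unfold Rpower. rewrite ln_exp; easy.
Qed.

Lemma Re_cexp_shift_pow (t theta : R) (i n : nat) :
  Re (cexp (- (t, theta)) ^ i * cexp (0, INR n * theta))
  = exp (- t) ^ i * cos ((INR n - INR i) * theta).
Proof.
  rewrite cexp_pow, <- cexp_plus. unfold cexp, Re, Im; simpl.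
  replace (exp (- t) ^ i) with (exp (INR i * - t)).
  2: { rewrite exp_pow_INR. easy. }
  f_equal; f_equal; ring.
Qed.

Lemma rsum_single (u : nat -> R) N n : (n < N)%nat ->
  (forall i, (i < N)%nat -> i <> n -> u i = 0) -> rsum u N = u n.
Proof.
  induction N as [|N IH]; [lia|]. intros Hn H. simpl.
  destruct (Nat.eq_dec n N) as [->|Hne].
  - rewrite (rsum_ext u (fun _ => 0 * 0)), rsum_scal by (intros; rewrite H; [ring|lia|lia]). ring.
  - rewrite IH, (H N); [ring|lia|lia|lia|]. intros; apply H; lia.
Qed.

(* Averaging over the [N]-th roots of unity isolates one coefficient. *)
Lemma coefficient_bound (E : nat -> R) (t B M : R) :
  (forall n, rsum (fun i => Rabs (E i) * exp (- t) ^ i) n <= B) ->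
  (forall theta, - PI <= theta <= PI ->
     exists D, Clim (csum (fun i => E i * cexp (- (t, theta)) ^ i)%C) D /\ Cmod D <= M) ->
  forall n, Rabs (E n) <= M * exp (INR n * t).
Proof.
  intros HB HD n.
  set (v := fun i => Rabs (E i) * exp (- t) ^ i) in *.
  assert (Hv : forall i, 0 <= v i).
  { intros i; unfold v. apply Rmult_le_pos; [apply Rabs_pos|]. apply pow_le; left; apply exp_pos. }
  destruct (rsum_bounded_cv v B Hv HB) as [s [Hs _]].
  set (q := fun theta => cexp (- (t, theta))).
  set (F := fun N theta => csum (fun i => E i * q theta ^ i)%C N).
  assert (HF : forall N theta, - PI <= theta <= PI -> Cmod (F N theta) <= M + (s - rsum v N)).
  { intros N theta Ht. destruct (HD theta Ht) as [D [HD1 HD2]].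
    eapply Rle_trans; [apply (Cmod_le_plus_diff _ D)|].
    apply Rplus_le_compat; [easy|]. rewrite Cmod_minus_sym.
    apply Cmod_csum_tail_le; auto.
    intros i. unfold v, q. rewrite Cmod_mult, Cmod_R, Cmod_pow, Cmod_cexp. simpl. lra. }
  (* An average over [N] nodes separates exponents only modulo [N], so the series is first cut at
     [N > n]; the cut costs the tail [s - rsum v N], which vanishes as [N] grows. *)
  assert (HN : forall N, (n < N)%nat -> Rabs (E n) * exp (- t) ^ n <= M + (s - rsum v N)).
  { intros N HnN. assert (HN0 : 0 < INR N) by (apply lt_0_INR; lia).
    set (th := fun j : nat => - PI + INR j * (2 * PI / INR N)).
    assert (Hth : forall j, (j < N)%nat -> - PI <= th j <= PI).
    { intros j Hj. unfold th. apply lt_INR in Hj. generalize PI_RGT_0 (pos_INR j); intros HP Hj0.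
      assert (0 <= INR j * (2 * PI / INR N) <= 2 * PI); [|lra]. split.
      - apply Rmult_le_pos; [easy|]. left; apply Rdiv_lt_0_compat; lra.
      - apply Rmult_le_reg_r with (INR N); [easy|].
        replace (INR j * (2 * PI / INR N) * INR N) with (INR j * (2 * PI)) by (field; lra).
        rewrite Rmult_comm. apply Rmult_le_compat_l; lra. }
    assert (Hsum : rsum (fun j => Re (F N (th j) * cexp (0, INR n * th j))) N
                   = INR N * (E n * exp (- t) ^ n)).
    { rewrite (rsum_ext _ (fun j => rsum (fun i => E i * exp (- t) ^ i * cos ((INR n - INR i) * th j)) N)).
      2: { intros j _. unfold F. rewrite Cmult_comm, <- csum_scal, Re_csum.
           apply rsum_ext. intros i _.
           replace (cexp (0, (INR n * th j)%R) * (E i * q (th j) ^ i))%C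
             with (E i * (q (th j) ^ i * cexp (0, (INR n * th j)%R)))%C by ring.
           rewrite Re_RtoC_mult. unfold q. rewrite Re_cexp_shift_pow. ring. }
      rewrite rsum_exchange.
      rewrite (rsum_single _ N n HnN).
      - rewrite (rsum_ext _ (fun _ => E n * exp (- t) ^ n * 1)).
        2: { intros. replace ((INR n - INR n) * th i) with 0 by ring. rewrite cos_0; easy. }
        rewrite rsum_scal. replace (rsum (fun _ => 1) N) with (INR N); [ring|].
        clear. induction N as [|N IH]; [easy|]. cbn [rsum]. rewrite <- IH, S_INR; easy.
      (* The nodes start at [- PI]; this offset becomes the constant phase of the cosine
         progression. *)
      - intros i Hi Hne. rewrite rsum_scal.
        apply Rmult_eq_0_compat. right.
        destruct (Nat.lt_ge_cases i n) as [Hlt|Hge].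
        + rewrite <- (sum_cos_progression (- INR (n - i) * PI) N (n - i)) by lia.
          apply rsum_ext; intros j _. f_equal. unfold th. rewrite minus_INR by lia. field. lra.
        + rewrite <- (sum_cos_progression (- INR (i - n) * PI) N (i - n)) by lia.
          apply rsum_ext; intros j _. rewrite <- cos_neg. f_equal. unfold th.
          rewrite minus_INR by lia. field. lra. }
    assert (Habs : Rabs (INR N * (E n * exp (- t) ^ n)) <= INR N * (M + (s - rsum v N))).
    { rewrite <- Hsum.
      rewrite <- Re_csum.
      eapply Rle_trans; [apply re_le_Cmod|].
      eapply Rle_trans; [apply Cmod_csum_le with (v := fun _ => (M + (s - rsum v N)) * 1)|].
      - intros j Hj. rewrite Cmod_mult, Cmod_cexp. simpl. rewrite exp_0.
        apply Rmult_le_compat_r; [lra|]. apply HF; auto.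
      - rewrite rsum_scal. replace (rsum (fun _ => 1) N) with (INR N); [lra|].
        clear. induction N as [|N IH]; [easy|]. cbn [rsum]. rewrite <- IH, S_INR; easy. }
    rewrite !Rabs_mult, (Rabs_right (INR N)), (Rabs_right (exp (- t) ^ n)) in Habs.
    - apply Rmult_le_reg_l with (INR N); easy.
    - apply Rle_ge, pow_le; left; apply exp_pos.
    - lra. }
  assert (Hfin : Rabs (E n) * exp (- t) ^ n <= M).
  { apply (is_lim_seq_le_loc (fun _ => Rabs (E n) * exp (- t) ^ n) (fun N => M + (s - rsum v N))
      (Rabs (E n) * exp (- t) ^ n) M).
    - exists (S n). intros N HnN. apply HN; lia.
    - apply is_lim_seq_const.
    - replace (Finite M) with (Finite (M + (s - s))) by (f_equal; ring).
      apply is_lim_seq_plus'; [apply is_lim_seq_const|].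
      apply is_lim_seq_minus'; [apply is_lim_seq_const|easy]. }
  rewrite exp_pow_INR in Hfin.
  apply Rmult_le_reg_r with (exp (INR n * - t)); [apply exp_pos|].
  rewrite Rmult_assoc, <- exp_plus. replace (INR n * t + INR n * - t) with 0 by ring.
  rewrite exp_0. lra.
Qed.

(** * The series sum of n^m q^n / m! *)

Definition power_coef (m n : nat) : R := INR n ^ m / INR (fact m).
Definition power_sum (m : nat) (q : C) (N : nat) : C :=
  csum (fun n => power_coef m n * q ^ n)%C N.

Lemma power_coef_nonneg m n : 0 <= power_coef m n.
Proof.
  apply Rmult_le_pos; [apply pow_le, pos_INR|]. left; apply Rinv_0_lt_compat, INR_fact_lt_0.
Qed.

Lemma power_coef_S m n :
  power_coef m (S n) = rsum (fun i => power_coef i n / INR (fact (m - i))) (S m).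
Proof.
  unfold power_coef. rewrite S_INR, binomial, <- sum_n_Reals, <- rsum_sum_n.
  unfold Rdiv at 1. rewrite Rmult_comm, <- rsum_scal. apply rsum_ext.
  intros i Hi. rewrite pow1. unfold Binomial.C. field.
  repeat split; apply INR_fact_neq_0.
Qed.

Lemma exp_series_lim (x : R) : is_lim_seq (rsum (fun l => x ^ l / INR (fact l))) (exp x).
Proof.
  apply rsum_lim_iff_series. generalize (is_exp_Reals x). unfold is_pseries.
  apply is_series_ext. intros n. unfold scal; simpl; unfold mult; simpl.
  rewrite pow_n_pow. unfold Rdiv. ring.
Qed.

Lemma exp_partial_sum_le (x : R) n : 0 <= x -> rsum (fun l => x ^ l / INR (fact l)) n <= exp x.
Proof.
  intros Hx. apply (is_lim_seq_incr_compare _ _ (exp_series_lim x)).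
  intros k; simpl. assert (0 <= x ^ k / INR (fact k)); [|lra].
  apply Rmult_le_pos; [apply pow_le; easy|]. left; apply Rinv_0_lt_compat, INR_fact_lt_0.
Qed.

Lemma fact_inv_pos n : 0 < / INR (fact n).
Proof. apply Rinv_0_lt_compat, INR_fact_lt_0. Qed.

(** Shifting the index turns [n^m] into [(n + 1)^m], and the binomial theorem expresses the sum
    through all [L_i] with [i <= m]. The term [n = 0] survives only for [m = 0], because
    [0 ^ 0 = 1]. *)
Lemma power_sum_S (m : nat) (q : C) N :
  power_sum m q (S N) =
  ((if Nat.eqb m 0 then 1 else 0) +
   q * csum (fun i => / INR (fact (m - i)) * power_sum i q N) (S m))%C.
Proof.
  unfold power_sum. rewrite csum_split_first. f_equal.
  - unfold power_coef. destruct m; simpl.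
    + replace (1 / 1) with 1 by field. ring.
    + rewrite Rmult_0_l. unfold Rdiv. rewrite Rmult_0_l. ring.
  - rewrite (csum_ext (fun i => / INR (fact (m - i)) * csum (fun n => power_coef i n * q ^ n) N)%C
       (fun i => csum (fun n => / INR (fact (m - i)) * (power_coef i n * q ^ n)) N)%C)
      by (intros; rewrite csum_scal; easy).
    rewrite csum_exchange, <- csum_scal. apply csum_ext. intros n _.
    rewrite power_coef_S, <- csum_RtoC, Cpow_S.
    rewrite (csum_ext (fun i => / INR (fact (m - i)) * (power_coef i n * q ^ n))%C
      (fun i => q ^ n * RtoC (power_coef i n / INR (fact (m - i))))%C (S m)).
    + rewrite csum_scal. ring.
    + intros i _. rewrite RtoC_div by apply INR_fact_neq_0. field.
      intros H. apply RtoC_inj in H. apply (INR_fact_neq_0 _ H).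
Qed.

Lemma power_sum_RtoC m (rho : R) N :
  power_sum m rho N = RtoC (rsum (fun n => power_coef m n * rho ^ n) N).
Proof.
  unfold power_sum. rewrite <- csum_RtoC. apply csum_ext. intros.
  rewrite RtoC_mult, RtoC_pow. easy.
Qed.

(** After reversal the sum is [V ^ S m] times a partial sum of the series of [exp (/ V) - 1]. *)
Lemma exp_minus_one_weights (V d : R) m : 0 < V -> exp (/ V) <= 1 + d ->
  rsum (fun i => / INR (fact (S m - i)) * V ^ i) (S m) <= d * V ^ S m.
Proof.
  intros HV Hd.
  rewrite rsum_rev.
  rewrite (rsum_ext _ (fun i => V ^ S m * ((/ V) ^ S i / INR (fact (S i))))).
  - rewrite rsum_scal, Rmult_comm. apply Rmult_le_compat_r; [apply pow_le; lra|].
    assert (HiV : 0 <= / V) by (left; apply Rinv_0_lt_compat; easy).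
    generalize (exp_partial_sum_le (/ V) (S (S m)) HiV).
    rewrite rsum_split_first. simpl (_ ^ 0). simpl (fact 0). simpl (INR 1). lra.
  - intros i Hi. replace (S m - (S m - 1 - i))%nat with (S i) by lia.
    replace (V ^ S m) with (V ^ (S m - 1 - i) * V ^ S i) by (rewrite <- pow_add; f_equal; lia).
    rewrite pow_inv. field. split; [apply pow_nonzero; lra|apply INR_fact_neq_0].
Qed.

(* The recursion [(1 - q) L_m = q * sum_{i < m} L_i / (m - i)!] keeps [L_m] below
   [V ^ m / |1 - q|] as soon as [exp (1 / V) - 1 <= |1 - q|]. *)
Lemma real_power_sum_bound (rho V : R) m N : 0 < rho < 1 -> 0 < V -> exp (/ V) <= 1 + (1 - rho) ->
  rsum (fun n => power_coef m n * rho ^ n) N <= V ^ m / (1 - rho).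
Proof.
  intros Hr HV He. revert N. induction m as [m IH] using lt_wf_ind. intros N.
  set (X := fun i => rsum (fun n => power_coef i n * rho ^ n) N).
  assert (Hpos : forall i, 0 <= X i).
  { intros i; apply rsum_nonneg; intros; apply Rmult_le_pos; [apply power_coef_nonneg|apply pow_le; lra]. }
  assert (Hrec : X m <= (if Nat.eqb m 0 then 1 else 0) +
      rho * rsum (fun i => / INR (fact (m - i)) * X i) (S m)).
  { assert (Hle : X m <= rsum (fun n => power_coef m n * rho ^ n) (S N)).
    { apply rsum_le_length; [|lia]. intros; apply Rmult_le_pos; [apply power_coef_nonneg|apply pow_le; lra]. }
    eapply Rle_trans; [apply Hle|]. right.
    apply RtoC_inj. rewrite <- power_sum_RtoC, power_sum_S.
    rewrite RtoC_plus, RtoC_mult, <- csum_RtoC. f_equal.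
    - destruct (Nat.eqb m 0); easy.
    - f_equal. apply csum_ext. intros i _. rewrite RtoC_mult, RtoC_inv, power_sum_RtoC by apply INR_fact_neq_0. easy. }
  change (X m <= V ^ m / (1 - rho)).
  apply Rmult_le_reg_r with (1 - rho); [lra|].
  unfold Rdiv. rewrite Rmult_assoc, Rinv_l, Rmult_1_r by lra.
  destruct m as [|m].
  - simpl in *. rewrite Rinv_1 in Hrec. lra.
  - cbn [Nat.eqb] in Hrec. change (rsum ?u (S ?n)) with (rsum u n + u n) in Hrec. cbv beta in Hrec.
    replace (S m - S m)%nat with 0%nat in Hrec by lia.
    replace (/ INR (fact 0)) with 1 in Hrec by (simpl; field). rewrite Rmult_1_l in Hrec.
    assert (Hs : rsum (fun i => / INR (fact (S m - i)) * X i) (S m) <=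
       / (1 - rho) * rsum (fun i => / INR (fact (S m - i)) * V ^ i) (S m)).
    { rewrite <- rsum_scal. apply rsum_le. intros i Hi.
      generalize (IH i Hi N) (fact_inv_pos (S m - i)). fold (X i). unfold Rdiv. nra. }
    assert (Hw := exp_minus_one_weights V (1 - rho) m HV He).
    assert (Hs2 : rsum (fun i => / INR (fact (S m - i)) * X i) (S m) <= V ^ S m).
    { eapply Rle_trans; [apply Hs|].
      apply Rmult_le_reg_l with (1 - rho); [lra|].
      rewrite <- Rmult_assoc, Rinv_r, Rmult_1_l by lra. exact Hw. }
    assert (0 <= rsum (fun i => / INR (fact (S m - i)) * X i) (S m)).
    { apply rsum_nonneg; intros; apply Rmult_le_pos; [left; apply fact_inv_pos|apply Hpos]. }
    nra.
Qed.

Definition is_power_series_sums (q : C) (L : nat -> C) : Prop :=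
  forall m, Clim (power_sum m q) (L m).

(** Makes [V = 1 + / d] admissible in the bounds on power sums; the inequality is
    [ln (1 + d) >= d / (1 + d)]. *)
Lemma exp_inv_le_of_gap (d : R) : 0 < d -> exp (/ (1 + / d)) <= 1 + d.
Proof.
  intros Hd.
  assert (Hx : / (1 + / d) = 1 - / (1 + d)) by (field; split; lra).
  rewrite Hx.
  generalize (exp_ineq1_le (- (1 - / (1 + d)))). rewrite exp_Ropp. intros H.
  replace (1 + - (1 - / (1 + d))) with (/ (1 + d)) in H by ring.
  apply Rinv_le_contravar in H; [|apply Rinv_0_lt_compat; lra].
  rewrite !Rinv_inv in H. exact H.
Qed.

Lemma power_terms_le (q : C) m i :
  Cmod (power_coef m i * q ^ i)%C <= power_coef m i * Cmod q ^ i.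
Proof.
  rewrite Cmod_mult, Cmod_R, Cmod_pow, Rabs_right; [lra|].
  apply Rle_ge, power_coef_nonneg.
Qed.

Lemma power_series_sums_exist (q : C) : 0 < Cmod q < 1 -> exists L, is_power_series_sums q L.
Proof.
  intros Hq.
  assert (H : forall m, exists l, Clim (power_sum m q) l).
  { intros m. unfold power_sum.
    apply csum_dominated_cv with (v := fun i => power_coef m i * Cmod q ^ i)
      (B := (1 + / (1 - Cmod q)) ^ m / (1 - Cmod q)).
    - apply power_terms_le.
    - intros n. apply real_power_sum_bound; [easy| |apply exp_inv_le_of_gap; lra].
      assert (0 < / (1 - Cmod q)) by (apply Rinv_0_lt_compat; lra). lra. }
  exists (fun m => proj1_sig (constructive_indefinite_description _ (H m))).
  intros m. apply (proj2_sig (constructive_indefinite_description _ (H m))).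
Qed.

Lemma power_series_sums_rec (q : C) L m : is_power_series_sums q L ->
  L m = ((if Nat.eqb m 0 then 1 else 0) + q * csum (fun i => / INR (fact (m - i)) * L i) (S m))%C.
Proof.
  intros HL. apply (Clim_unique (fun N => power_sum m q (N + 1))).
  - apply Clim_shift, HL.
  - apply Clim_ext with (fun N => (if Nat.eqb m 0 then 1 else 0) +
       q * csum (fun i => / INR (fact (m - i)) * power_sum i q N) (S m))%C.
    { intros n. rewrite Nat.add_1_r, power_sum_S. easy. }
    apply Clim_plus; [apply Clim_const|]. apply Clim_scal.
    apply Clim_csum with (u := fun i N => (/ INR (fact (m - i)) * power_sum i q N)%C).
    intros i _. apply Clim_scal. apply HL.
Qed.

Lemma Cmod_inv_fact n : Cmod (/ INR (fact n))%C = / INR (fact n).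
Proof.
  rewrite <- RtoC_inv by apply INR_fact_neq_0.
  rewrite Cmod_R, Rabs_right; [easy|]. left; apply fact_inv_pos.
Qed.

(** The induction of the real case with [|1 - q|] in place of [1 - rho]. Away from the positive axis
    this is much better than the bound at [|q|], as the minor arc requires. *)
Lemma power_series_sums_bound (q : C) L V m : is_power_series_sums q L ->
  Cmod q <= 1 -> 0 < Cmod (1 - q) -> 0 < V -> exp (/ V) <= 1 + Cmod (1 - q) ->
  Cmod (L m) <= V ^ m / Cmod (1 - q).
Proof.
  intros HL Hq Hd HV He. induction m as [m IH] using lt_wf_ind.
  assert (Hrec := power_series_sums_rec q L m HL).
  change (csum ?u (S ?n)) with (csum u n + u n)%C in Hrec. cbv beta in Hrec.
  replace (m - m)%nat with 0%nat in Hrec by lia.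
  replace (/ INR (fact 0))%C with (RtoC 1) in Hrec by (simpl; field; apply RtoC_neq; lra).
  set (S0 := csum (fun i => / INR (fact (m - i)) * L i)%C m) in *.
  assert (Hm : ((1 - q) * L m = (if Nat.eqb m 0 then 1 else 0) + q * S0)%C).
  { transitivity (L m - q * L m)%C; [ring|]. rewrite Hrec at 1. ring. }
  apply Rmult_le_reg_l with (Cmod (1 - q)); [easy|].
  replace (Cmod (1 - q) * (V ^ m / Cmod (1 - q))) with (V ^ m) by (field; lra).
  rewrite <- Cmod_mult, Hm.
  destruct m as [|m].
  - unfold S0; simpl. replace (1 + q * 0)%C with (RtoC 1) by ring. rewrite Cmod_1; lra.
  - cbn [Nat.eqb]. replace (0 + q * S0)%C with (q * S0)%C by ring. rewrite Cmod_mult.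
    assert (HS : Cmod S0 <= V ^ S m).
    { eapply Rle_trans.
      - apply Cmod_csum_le with (v := fun i => / Cmod (1 - q) * (/ INR (fact (S m - i)) * V ^ i)).
        intros i Hi. rewrite Cmod_mult, Cmod_inv_fact.
        generalize (IH i Hi) (fact_inv_pos (S m - i)). unfold Rdiv. nra.
      - rewrite rsum_scal. apply Rmult_le_reg_l with (Cmod (1 - q)); [easy|].
        rewrite <- Rmult_assoc, Rinv_r, Rmult_1_l by lra.
        apply exp_minus_one_weights; easy. }
    generalize (Cmod_ge_0 S0) (Cmod_ge_0 q). nra.
Qed.

(* [laplace_psi l z] and [laplace_chi l z] are, up to sign, the coefficients of [y ^ l] in
   [(1 - e^(y - z)) / (z - y)] and in its difference quotient with [1]; they express
   [sum_n n^m q^n / m! - z^-(m+1)] without its pole at [z = 0]. *)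
Definition laplace_psi (l : nat) (z : C) : C :=
  CInt (fun s => RtoC (s ^ l / INR (fact l)) * cexp (- z * RtoC s))%C 0 1.
Definition laplace_chi (l : nat) (z : C) : C :=
  CInt (fun s => RtoC ((1 - s) * (s ^ l / INR (fact l))) * cexp (- z * RtoC s))%C 0 1.

Lemma continuous_of_derivable (f f' : R -> R) : (forall x, is_derive f x (f' x)) ->
  forall x, continuous f x.
Proof. intros H x. apply (ex_derive_continuous f). eexists; apply H. Qed.

Lemma is_derive_pow_fact l x :
  is_derive (fun s => s ^ S l / INR (fact (S l))) x (x ^ l / INR (fact l)).
Proof.
  assert (H : INR (S l) * 1 * x ^ l * / INR (fact (S l)) = x ^ l / INR (fact l)).
  { change (fact (S l)) with (S l * fact l)%nat. rewrite mult_INR. field.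
    split; [apply INR_fact_neq_0|apply not_0_INR; lia]. }
  rewrite <- H.
  apply (is_derive_scal_l (fun s => s ^ S l) x (INR (S l) * 1 * x ^ l) (/ INR (fact (S l)))).
  apply (is_derive_pow (fun s => s) (S l) x 1). apply (is_derive_id (K := R_AbsRing)).
Qed.

Lemma continuous_pow_fact l x : continuous (fun s => s ^ l / INR (fact l)) x.
Proof.
  destruct l as [|l].
  - apply (continuous_ext (fun _ => 1 / 1)); [intros; simpl; easy|apply continuous_const].
  - apply (continuous_of_derivable _ _ (is_derive_pow_fact l)).
Qed.

Lemma Cder_pow_fact_exp l (z : C) :
  Cder (fun s => RtoC (s ^ S l / INR (fact (S l))) * cexp (- z * RtoC s))%C
       (fun s => RtoC (s ^ l / INR (fact l)) * cexp (- z * RtoC s) +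
                 (- z) * (RtoC (s ^ S l / INR (fact (S l))) * cexp (- z * RtoC s)))%C.
Proof.
  eapply Cder_ext.
  2: { apply Cder_mult; [apply (Cder_RtoC _ _ (is_derive_pow_fact l))|apply Cder_cexp_lin]. }
  intros x; cbv beta. ring.
Qed.

Lemma Ccont_cexp_lin (c : C) : Ccont (fun s => cexp (c * RtoC s)).
Proof. apply (Cder_Ccont _ _ (Cder_cexp_lin c)). Qed.

Lemma Ccont_pow_fact_exp l (z : C) :
  Ccont (fun s => RtoC (s ^ l / INR (fact l)) * cexp (- z * RtoC s))%C.
Proof.
  apply Ccont_mult; [|apply Ccont_cexp_lin]. apply Ccont_RtoC. apply continuous_pow_fact.
Qed.

Lemma continuous_one_minus x : continuous (fun s => 1 - s) x.
Proof. apply (continuous_minus (V := R_NormedModule)); [apply continuous_const|apply continuous_id]. Qed.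

Lemma continuous_chi_weight l x : continuous (fun s => (1 - s) * (s ^ l / INR (fact l))) x.
Proof. apply (continuous_mult (K := R_AbsRing)); [apply continuous_one_minus|apply continuous_pow_fact]. Qed.

Lemma laplace_psi_0 (z : C) : (z * laplace_psi 0 z = 1 - cexp (- z))%C.
Proof.
  unfold laplace_psi. rewrite <- CInt_scal by apply Ccont_pow_fact_exp.
  assert (H := CInt_der _ _ 0 1 (Cder_scal (-(1))%C _ _ (Cder_cexp_lin (- z)))).
  cbv beta in H.
  replace (1 - cexp (- z))%C with (- (1) * cexp (- z * 1) - - (1) * cexp (- z * 0))%C.
  - rewrite <- H.
    + apply CInt_ext. intros s. simpl. replace (1 / 1) with 1 by field. ring.
    + apply Ccont_mult; [apply Ccont_const|]. apply Ccont_mult; [apply Ccont_const|].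
      apply Ccont_cexp_lin.
  - replace (- z * 0)%C with (RtoC 0) by ring. rewrite cexp_0.
    replace (- z * 1)%C with (- z)%C by ring. ring.
Qed.

(** A linear relation among integrals read off from one antiderivative; the integrations by parts
    for [laplace_psi], [laplace_chi] and the Gaussian are instances. *)
Lemma CInt_der_lin3 (F f0 f1 f2 : R -> C) (c0 c1 c2 : C) a b :
  Ccont f0 -> Ccont f1 -> Ccont f2 ->
  Cder F (fun s => c0 * f0 s + (c1 * f1 s + c2 * f2 s))%C ->
  (F b - F a = c0 * CInt f0 a b + (c1 * CInt f1 a b + c2 * CInt f2 a b))%C.
Proof.
  intros H0 H1 H2 HF.
  assert (K0 : Ccont (fun s => c0 * f0 s)%C) by (apply Ccont_mult; [apply Ccont_const|easy]).
  assert (K1 : Ccont (fun s => c1 * f1 s)%C) by (apply Ccont_mult; [apply Ccont_const|easy]).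
  assert (K2 : Ccont (fun s => c2 * f2 s)%C) by (apply Ccont_mult; [apply Ccont_const|easy]).
  assert (K12 := Ccont_plus _ _ K1 K2).
  rewrite <- (CInt_der _ _ a b HF) by exact (Ccont_plus _ _ K0 K12).
  rewrite (CInt_plus (fun s => c0 * f0 s)%C (fun s => c1 * f1 s + c2 * f2 s)%C) by easy.
  rewrite (CInt_plus (fun s => c1 * f1 s)%C (fun s => c2 * f2 s)%C) by easy.
  rewrite (CInt_scal c0 f0), (CInt_scal c1 f1), (CInt_scal c2 f2) by easy. easy.
Qed.

Lemma RtoC_minus_one : RtoC (- 1) = (- (1))%C.
Proof. rewrite <- RtoC_opp. f_equal. Qed.

Lemma Ccont_chi_integrand l (z : C) :
  Ccont (fun s => RtoC ((1 - s) * (s ^ l / INR (fact l))) * cexp (- z * RtoC s))%C.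
Proof.
  apply Ccont_mult; [|apply Ccont_cexp_lin]. apply Ccont_RtoC. apply continuous_chi_weight.
Qed.

Lemma laplace_psi_S l (z : C) :
  (z * laplace_psi (S l) z = laplace_psi l z - cexp (- z) * / INR (fact (S l)))%C.
Proof.
  assert (H : (RtoC (1 ^ S l / INR (fact (S l))) * cexp (- z * 1) -
     RtoC (0 ^ S l / INR (fact (S l))) * cexp (- z * 0) =
     1 * laplace_psi l z + (- z * laplace_psi (S l) z + 0 * laplace_psi (S l) z))%C).
  { apply (CInt_der_lin3 (fun s => RtoC (s ^ S l / INR (fact (S l))) * cexp (- z * RtoC s))%C
      _ _ _ 1 (- z) 0 0 1 (Ccont_pow_fact_exp l z) (Ccont_pow_fact_exp (S l) z)
      (Ccont_pow_fact_exp (S l) z)).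
    eapply Cder_ext; [|apply Cder_pow_fact_exp]. intros x; cbv beta; ring. }
  replace (1 ^ S l / INR (fact (S l))) with (/ INR (fact (S l))) in H
    by (rewrite pow1; field; apply INR_fact_neq_0).
  replace (0 ^ S l / INR (fact (S l))) with 0 in H
    by (rewrite pow_i by lia; unfold Rdiv; ring).
  replace (- z * 1)%C with (- z)%C in H by ring.
  rewrite RtoC_inv in H by apply INR_fact_neq_0.
  replace (z * laplace_psi (S l) z)%C with
    (laplace_psi l z - (1 * laplace_psi l z + (- z * laplace_psi (S l) z + 0 * laplace_psi (S l) z)))%C by ring.
  rewrite <- H. ring.
Qed.

Lemma laplace_chi_0 (z : C) : (z * laplace_chi 0 z = 1 - laplace_psi 0 z)%C.
Proof.
  assert (H : (RtoC (1 - 1) * cexp (- z * 1) - RtoC (1 - 0) * cexp (- z * 0) =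
     - (1) * laplace_psi 0 z + (- z * laplace_chi 0 z + 0 * laplace_chi 0 z))%C).
  { apply (CInt_der_lin3 (fun s => RtoC (1 - s) * cexp (- z * RtoC s))%C
      _ _ _ (- (1)) (- z) 0 0 1 (Ccont_pow_fact_exp 0 z) (Ccont_chi_integrand 0 z)
      (Ccont_chi_integrand 0 z)).
    eapply Cder_ext.
    2: { apply Cder_mult; [apply (Cder_RtoC (fun s => 1 - s) (fun _ => - 1))|apply Cder_cexp_lin].
         intros x. auto_derive; auto; ring. }
    intros x; cbv beta. simpl (x ^ 0). simpl (INR (fact 0)).
    replace (1 / 1) with 1 by field. rewrite Rmult_1_r, RtoC_minus_one. ring. }
  replace (z * laplace_chi 0 z)%C with
    (- laplace_psi 0 z - (- (1) * laplace_psi 0 z + (- z * laplace_chi 0 z + 0 * laplace_chi 0 z)))%C by ring.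
  rewrite <- H.
  replace (- z * 0)%C with (RtoC 0) by ring. rewrite cexp_0.
  replace (1 - 1) with 0 by ring. replace (1 - 0) with 1 by ring. ring.
Qed.

Lemma laplace_chi_S l (z : C) : (z * laplace_chi (S l) z = laplace_chi l z - laplace_psi (S l) z)%C.
Proof.
  assert (H : (RtoC ((1 - 1) * (1 ^ S l / INR (fact (S l)))) * cexp (- z * 1) -
     RtoC ((1 - 0) * (0 ^ S l / INR (fact (S l)))) * cexp (- z * 0) =
     1 * laplace_chi l z + (- (1) * laplace_psi (S l) z + - z * laplace_chi (S l) z))%C).
  { apply (CInt_der_lin3 (fun s => RtoC ((1 - s) * (s ^ S l / INR (fact (S l)))) * cexp (- z * RtoC s))%C
      _ _ _ 1 (- (1)) (- z) 0 1 (Ccont_chi_integrand l z) (Ccont_pow_fact_exp (S l) z)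
      (Ccont_chi_integrand (S l) z)).
    eapply Cder_ext.
    2: { apply Cder_mult; [|apply Cder_cexp_lin].
         apply (Cder_RtoC _ (fun x => - 1 * (x ^ S l / INR (fact (S l))) + (1 - x) * (x ^ l / INR (fact l)))).
         intros x. eapply is_derive_mult_R; [|apply is_derive_pow_fact|reflexivity].
         auto_derive; auto; ring. }
    intros x; cbv beta. rewrite RtoC_plus, (RtoC_mult (- 1)), RtoC_minus_one. ring. }
  replace (z * laplace_chi (S l) z)%C with
    (laplace_chi l z - laplace_psi (S l) z -
      (1 * laplace_chi l z + (- (1) * laplace_psi (S l) z + - z * laplace_chi (S l) z)))%C by ring.
  rewrite <- H.
  replace (0 ^ S l / INR (fact (S l))) with 0 by (rewrite pow_i by lia; unfold Rdiv; ring).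
  replace (1 - 1) with 0 by ring. rewrite Rmult_0_l, Rmult_0_r. ring.
Qed.

Lemma RInt_pow_fact l : RInt (fun s => s ^ l / INR (fact l)) 0 1 = / INR (fact (S l)).
Proof.
  apply is_RInt_unique.
  assert (E : 1 ^ S l / INR (fact (S l)) - 0 ^ S l / INR (fact (S l)) = / INR (fact (S l))).
  { rewrite pow1, pow_i by lia. unfold Rdiv. ring. }
  rewrite <- E.
  apply (is_RInt_derive (fun s => s ^ S l / INR (fact (S l)))); intros.
  - apply is_derive_pow_fact.
  - apply continuous_pow_fact.
Qed.

Lemma RInt_chi_weight l :
  RInt (fun s => (1 - s) * (s ^ l / INR (fact l))) 0 1 = / INR (fact (S (S l))).
Proof.
  rewrite (RInt_ext _ (fun s => 1 * (s ^ l / INR (fact l)) + (- INR (S l)) * (s ^ S l / INR (fact (S l))))).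
  - rewrite RInt_lin2; [|apply continuous_pow_fact|apply continuous_pow_fact].
    rewrite !RInt_pow_fact. change (fact (S (S l))) with (S (S l) * fact (S l))%nat.
    rewrite mult_INR, (S_INR (S l)). match goal with |- ?a = ?b => change (@eq R a b) end. field.
    split; [apply INR_fact_neq_0|]. rewrite <- (S_INR (S l)). apply not_0_INR; lia.
  - intros x _. change (fact (S l)) with (S l * fact l)%nat. rewrite mult_INR.
    simpl pow. match goal with |- ?a = ?b => change (@eq R a b) end. field. split; [apply INR_fact_neq_0|apply not_0_INR; lia].
Qed.

Lemma Cmod_cexp_decay (z : C) s : 0 <= Re z -> 0 <= s -> Cmod (cexp (- z * RtoC s)) <= 1.
Proof.
  intros Hz Hs. rewrite Cmod_cexp, <- exp_0. unfold Re in *; simpl.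
  assert (- fst z * s - - snd z * 0 <= 0) as H by nra.
  destruct H as [H|H]; [left; apply exp_increasing; easy|rewrite H; lra].
Qed.

Lemma laplace_psi_bound l (z : C) : 0 <= Re z -> Cmod (laplace_psi l z) <= / INR (fact (S l)).
Proof.
  intros Hz. rewrite <- RInt_pow_fact. apply Cmod_CInt_le; [lra| | |].
  - apply Ccont_pow_fact_exp.
  - apply continuous_pow_fact.
  - intros s Hs. rewrite Cmod_mult, Cmod_R.
    assert (0 <= s ^ l / INR (fact l)).
    { apply Rmult_le_pos; [apply pow_le; lra|left; apply fact_inv_pos]. }
    rewrite Rabs_right by lra.
    generalize (Cmod_cexp_decay z s Hz (proj1 Hs)). nra.
Qed.

Lemma laplace_chi_bound l (z : C) : 0 <= Re z -> Cmod (laplace_chi l z) <= / INR (fact (S (S l))).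
Proof.
  intros Hz. rewrite <- RInt_chi_weight. apply Cmod_CInt_le; [lra| | |].
  - apply Ccont_mult; [|apply Ccont_cexp_lin]. apply Ccont_RtoC, continuous_chi_weight.
  - apply continuous_chi_weight.
  - intros s Hs. rewrite Cmod_mult, Cmod_R.
    assert (0 <= (1 - s) * (s ^ l / INR (fact l))).
    { apply Rmult_le_pos; [lra|]. apply Rmult_le_pos; [apply pow_le; lra|left; apply fact_inv_pos]. }
    rewrite Rabs_right by lra.
    generalize (Cmod_cexp_decay z s Hz (proj1 Hs)). nra.
Qed.

(** * Removing the pole of the power sums at [z = 0] *)

Definition cconv (a b : nat -> C) (m : nat) : C := csum (fun i => a i * b (m - i)%nat)%C (S m).

Lemma cconv_last (a b : nat -> C) m :
  cconv a b m = (csum (fun i => a i * b (m - i)%nat) m + a m * b O)%C.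
Proof.
  unfold cconv. change (csum ?u (S ?n)) with (csum u n + u n)%C. cbv beta.
  rewrite Nat.sub_diag. easy.
Qed.

Lemma cconv_S_psi (a : nat -> C) (z : C) m :
  (z * cconv a (fun l => laplace_psi l z) (S m) =
   cconv a (fun l => laplace_psi l z) m + a (S m)
   - cexp (- z) * csum (fun i => / INR (fact (S m - i)) * a i) (S (S m)))%C.
Proof.
  rewrite cconv_last.
  rewrite Cmult_plus_distr_l, <- csum_scal.
  rewrite (csum_ext _ (fun i => a i * laplace_psi (m - i) z
      - cexp (- z) * (/ INR (fact (S m - i)) * a i))%C (S m)).
  - rewrite csum_minus, csum_scal.
    change (csum (fun i => / INR (fact (S m - i)) * a i)%C (S (S m))) with
      (csum (fun i => / INR (fact (S m - i)) * a i) (S m) + / INR (fact (S m - S m)) * a (S m))%C.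
    rewrite Nat.sub_diag.
    replace (z * (a (S m) * laplace_psi 0 z))%C with (a (S m) * (z * laplace_psi 0 z))%C by ring.
    rewrite laplace_psi_0. unfold cconv. simpl (fact 0). simpl (INR 1).
    replace (/ 1)%C with (RtoC 1) by (field; apply RtoC_neq; lra). ring.
  - intros i Hi. replace (S m - i)%nat with (S (m - i)) by lia.
    replace (z * (a i * laplace_psi (S (m - i)) z))%C with (a i * (z * laplace_psi (S (m - i)) z))%C by ring.
    rewrite laplace_psi_S. ring.
Qed.

(** In generating functions in [y]: the [L m] belong to [1 / (1 - e^(y - z))], the [laplace_psi l z]
    to [(1 - e^(y - z)) / (z - y)], and the product [1 / (z - y)] has the coefficients
    [1 / z^(m+1)]. *)
Lemma cconv_power_sums_psi (z : C) L m : z <> 0 -> is_power_series_sums (cexp (- z)) L ->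
  cconv L (fun l => laplace_psi l z) m = (/ z ^ S m)%C.
Proof.
  intros Hz HL. induction m as [|m IH].
  - unfold cconv; simpl csum. simpl Nat.sub.
    assert (H0 := power_series_sums_rec _ L 0 HL). simpl in H0.
    replace (/ 1)%C with (RtoC 1) in H0 by (field; apply RtoC_neq; lra).
    assert (H1 := laplace_psi_0 z).
    assert (H2 : (L 0%nat * (1 - cexp (- z)) = 1)%C).
    { transitivity (L 0%nat - cexp (- z) * L 0%nat)%C; [ring|]. rewrite H0 at 1. ring. }
    rewrite <- H1 in H2. simpl.
    replace (0 + L 0%nat * laplace_psi 0 z)%C with (L 0%nat * (z * laplace_psi 0 z) / z)%C by (field; easy).
    rewrite H2. field; easy.
  - assert (H := cconv_S_psi L z m). rewrite IH in H.
    assert (Hr := power_series_sums_rec _ L (S m) HL). cbn [Nat.eqb] in Hr.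
    replace (/ z ^ S (S m))%C with ((/ z ^ S m) / z)%C.
    2: { simpl. field. repeat split; try apply Cpow_nz; assumption. }
    replace (cconv L (fun l : nat => laplace_psi l z) (S m)) with
      ((z * cconv L (fun l : nat => laplace_psi l z) (S m)) / z)%C by (field; easy).
    rewrite H, Hr. f_equal. rewrite <- Hr.
    set (S0 := csum _ _). rewrite Hr. fold S0. ring.
Qed.

(** With [w = z - y], the generating function of [laplace_psi] is [psi = (1 - e^(-w)) / w] and that
    of [laplace_chi] is [(1 - psi) / w]; so [psi / w] is [1 / w] minus the latter. *)
Lemma cconv_inv_pow_psi (z : C) m : z <> 0 ->
  cconv (fun i => / z ^ S i)%C (fun l => laplace_psi l z) m = (/ z ^ S m - laplace_chi m z)%C.
Proof.
  intros Hz.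
  assert (Hcancel : forall a b : C, (z * a = z * b)%C -> a = b).
  { intros a b H. replace a with (/ z * (z * a))%C by (field; easy).
    rewrite H. field; easy. }
  induction m as [|m IH]; apply Hcancel.
  - unfold cconv. simpl csum. simpl Nat.sub. simpl Cpow.
    replace (z * (/ (z * 1) - laplace_chi 0 z))%C with (1 - z * laplace_chi 0 z)%C by (field; easy).
    rewrite laplace_chi_0. field; easy.
  - replace (z * (/ z ^ S (S m) - laplace_chi (S m) z))%C
      with (/ z ^ S m - z * laplace_chi (S m) z)%C.
    2: { rewrite (Cpow_S z (S m)). field. repeat split; try apply Cpow_nz; assumption. }
    rewrite laplace_chi_S.
    unfold cconv. rewrite csum_split_first, Cmult_plus_distr_l, <- csum_scal.
    rewrite (csum_ext _ (fun i => / z ^ S i * laplace_psi (m - i) z)%C (S m)).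
    + fold (cconv (fun i => / z ^ S i)%C (fun l => laplace_psi l z) m). rewrite IH.
      rewrite Nat.sub_0_r. simpl (z ^ 1)%C. field. repeat split; try apply Cpow_nz; assumption.
    + intros i Hi. rewrite (Cpow_S z (S i)). replace (S m - S i)%nat with (m - i)%nat by lia.
      field. repeat split; try apply Cpow_nz; assumption.
Qed.

(** From [(1 - 1/64)^64 <= e^-1]; the exponent 64 gives about 2.74. *)
Lemma exp_1_lt : exp 1 < 2.75.
Proof.
  assert (H : (63/64) ^ 64 <= exp (- (1))).
  { replace (- (1)) with (INR 64 * (- (1/64))) by (simpl; lra).
    rewrite <- exp_pow_INR. apply pow_incr. generalize (exp_ineq1_le (- (1/64))). lra. }
  rewrite exp_Ropp in H. apply Rinv_le_contravar in H; [|lra].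
  rewrite Rinv_inv in H. eapply Rle_lt_trans; [exact H|]. lra.
Qed.

Lemma laplace_psi_0_lower (z : C) : 0 <= Re z -> 1 - Cmod z / 2 <= Cmod (laplace_psi 0 z).
Proof.
  intros Hz. assert (H := laplace_chi_0 z). assert (Hb := laplace_chi_bound 0 z Hz).
  assert (H1 : Cmod (1 - laplace_psi 0 z) <= Cmod z / 2).
  { rewrite <- H, Cmod_mult. simpl in Hb. generalize (Cmod_ge_0 z). nra. }
  assert (H2 := Cmod_le_plus_diff 1 (laplace_psi 0 z)). rewrite Cmod_1 in H2. lra.
Qed.

(** The differences [d m] satisfy [d * psi = chi] as a convolution, in which no pole is left.
    Solving for [d m] by induction, the earlier terms contribute at most [20 (e - 2) < 15] and [chi]
    at most [1/2], while [|psi 0| >= 0.8] for [|z| <= 0.4]. As [15.5 / 0.8 < 20], the bound 20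
    reproduces itself, uniformly in [m]. *)
Lemma power_sums_minus_pole_bound (z : C) L m :
  0 <= Re z -> z <> 0 -> Cmod z <= 0.4 -> is_power_series_sums (cexp (- z)) L ->
  Cmod (L m - / z ^ S m) <= 20.
Proof.
  intros Hre Hz Hz4 HL.
  set (d := fun i => (L i - / z ^ S i)%C).
  assert (Hconv : forall m, cconv d (fun l => laplace_psi l z) m = laplace_chi m z).
  { intros k. unfold cconv.
    rewrite (csum_ext _ (fun i => L i * laplace_psi (k - i) z - / z ^ S i * laplace_psi (k - i) z)%C)
      by (intros; unfold d; ring).
    rewrite csum_minus.
    fold (cconv L (fun l => laplace_psi l z) k).
    fold (cconv (fun i => / z ^ S i)%C (fun l => laplace_psi l z) k).
    rewrite cconv_inv_pow_psi, cconv_power_sums_psi by easy. ring. }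
  change (Cmod (d m) <= 20).
  induction m as [m IH] using lt_wf_ind.
  assert (H := Hconv m). rewrite cconv_last in H.
  assert (H' : (d m * laplace_psi 0 z)%C =
     (laplace_chi m z - csum (fun i => d i * laplace_psi (m - i) z) m)%C).
  { rewrite <- H. ring. }
  assert (Hchi : Cmod (laplace_chi m z) <= / 2).
  { eapply Rle_trans; [apply laplace_chi_bound; easy|].
    apply Rinv_le_contravar; [lra|]. change 2 with (INR (fact 2)).
    apply le_INR, fact_le; lia. }
  assert (Hsum : Cmod (csum (fun i => d i * laplace_psi (m - i) z)%C m) <= 15).
  { eapply Rle_trans.
    - apply Cmod_csum_le with (v := fun i => 20 * / INR (fact (S (m - i)))).
      intros i Hi. rewrite Cmod_mult.
      apply Rmult_le_compat; try apply Cmod_ge_0; [apply IH; easy|].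
      apply laplace_psi_bound; easy.
    - rewrite rsum_scal, rsum_rev.
      rewrite (rsum_ext _ (fun i => 1 ^ S (S i) / INR (fact (S (S i))))).
      + generalize (exp_partial_sum_le 1 (S (S m)) ltac:(lra)). rewrite !rsum_split_first.
        simpl (1 ^ 0). simpl (1 ^ 1). simpl (fact 0). simpl (fact 1). simpl (INR 1).
        generalize exp_1_lt. lra.
      + intros i Hi. rewrite pow1. unfold Rdiv. rewrite Rmult_1_l.
        do 3 f_equal. lia. }
  assert (Hl := laplace_psi_0_lower z Hre).
  assert (Hprod : Cmod (d m) * Cmod (laplace_psi 0 z) <= 15.5).
  { rewrite <- Cmod_mult, H'. unfold Cminus. eapply Rle_trans; [apply Cmod_triangle|].
    rewrite Cmod_opp. lra. }
  generalize (Cmod_ge_0 (d m)). nra.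
Qed.

Lemma PI_bounds_coarse : 3.1 < PI < 3.2.
Proof.
  assert (H := PI_2_3_7_ineq 1). simpl in H.
  unfold tg_alt, PI_2_3_7_tg, Ratan_seq in H. simpl in H. lra.
Qed.

(** From [sin y >= y - y^3 / 6] and [y^2 <= 1.6^2]. *)
Lemma sin_ge_linear y : 0 <= y <= PI / 2 -> 0.57 * y <= sin y.
Proof.
  intros Hy. generalize PI_bounds_coarse; intros HP.
  destruct (sin_bound y 0) as [H _]; [lra|lra|].
  unfold sin_approx, sin_term in H. simpl in H.
  assert (y ^ 2 <= 2.56) by nra. nra.
Qed.

(** * The Fejer kernel *)

(** The mean of the first [N] Dirichlet kernels. Doubling the sum over [0 <= l <= j] and subtracting
    1 gives the sum over [|l| <= j]. *)
Definition fejer (N : nat) (x : R) : R :=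
  / INR N * rsum (fun j => 2 * rsum (fun l => cos (2 * PI * INR l * x)) (S j) - 1) N.

Lemma dirichlet_sin (x : R) j :
  sin (PI * x) * (2 * rsum (fun l => cos (2 * PI * INR l * x)) (S j) - 1)
  = sin ((2 * INR j + 1) * (PI * x)).
Proof.
  induction j as [|j IH].
  - simpl. replace (2 * PI * 0 * x) with 0 by ring. rewrite cos_0.
    replace ((2 * 0 + 1) * (PI * x)) with (PI * x) by ring. ring.
  - change (rsum ?u (S (S j))) with (rsum u (S j) + u (S j)). cbv beta.
    rewrite Rmult_plus_distr_l.
    replace (sin (PI * x) * (2 * rsum (fun l => cos (2 * PI * INR l * x)) (S j) +
       2 * cos (2 * PI * INR (S j) * x) - 1)) with
      (sin (PI * x) * (2 * rsum (fun l => cos (2 * PI * INR l * x)) (S j) - 1) +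
       2 * sin (PI * x) * cos (2 * PI * INR (S j) * x)) by ring.
    rewrite IH, S_INR.
    replace ((2 * INR j + 1) * (PI * x)) with (2 * PI * (INR j + 1) * x - PI * x) by ring.
    replace ((2 * (INR j + 1) + 1) * (PI * x)) with (2 * PI * (INR j + 1) * x + PI * x) by ring.
    rewrite sin_plus, sin_minus. ring.
Qed.

(** Induction on [N] through [sin b * sin ((2 N + 1) b) = sin^2 ((N + 1) b) - sin^2 (N b)]. *)
Lemma fejer_sin_sqr N (x : R) : (0 < N)%nat ->
  INR N * fejer N x * (sin (PI * x)) ^ 2 = (sin (INR N * (PI * x))) ^ 2.
Proof.
  intros HN. assert (0 < INR N) by (apply lt_0_INR; easy).
  unfold fejer. rewrite <- Rmult_assoc, Rinv_r, Rmult_1_l by lra.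
  set (u := fun j => 2 * rsum (fun l => cos (2 * PI * INR l * x)) (S j) - 1).
  clear HN H. induction N as [|N IH].
  - simpl. rewrite !Rmult_0_l, sin_0. ring.
  - cbn [rsum].
    replace ((rsum u N + u N) * sin (PI * x) ^ 2) with
      (rsum u N * sin (PI * x) ^ 2 + sin (PI * x) * (sin (PI * x) * u N)) by ring.
    rewrite IH. unfold u at 1. rewrite dirichlet_sin, S_INR.
    set (a := INR N * (PI * x)). set (b := PI * x).
    replace ((2 * INR N + 1) * b) with (a + (a + b)) by (unfold a, b; ring).
    replace ((INR N + 1) * b) with (a + b) by (unfold a, b; ring).
    rewrite !sin_plus, cos_plus.
    generalize (sin2_cos2 a) (sin2_cos2 b). unfold Rsqr. intros Ha Hb.
    set (sa := sin a) in *; set (ca := cos a) in *; set (sb := sin b) in *; set (cb := cos b) in *.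
    assert (Ea : ca * ca = 1 - sa * sa) by lra. assert (Eb : cb * cb = 1 - sb * sb) by lra.
    nra.
Qed.

(** From [N F(x) sin^2 (pi x) = sin^2 (N pi x)] together with [|x| <= |sin (pi x)|], valid because
    [0.57 * 3.1 > 1]. At [x = 0] that identity is void and the cosines are summed directly. *)
Lemma fejer_bounds N (x : R) : (0 < N)%nat -> - (1/2) <= x <= 1/2 ->
  0 <= fejer N x /\ x ^ 2 * fejer N x <= / INR N.
Proof.
  intros HN Hx. assert (HN0 : 0 < INR N) by (apply lt_0_INR; easy).
  destruct (Req_dec x 0) as [->|Hx0].
  - assert (0 <= fejer N 0).
    { unfold fejer. apply Rmult_le_pos; [left; apply Rinv_0_lt_compat; easy|].
      apply rsum_nonneg; intros j _.
      rewrite (rsum_ext _ (fun _ => 1)).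
      2: { intros; rewrite Rmult_0_r, cos_0; easy. }
      rewrite rsum_split_first.
      assert (0 <= rsum (fun _ => 1) j) by (apply rsum_nonneg; intros; lra). lra. }
    split; [easy|]. rewrite pow_i by lia. rewrite Rmult_0_l. left; apply Rinv_0_lt_compat; easy.
  - assert (Hs : x ^ 2 <= sin (PI * x) ^ 2).
    { generalize PI_bounds_coarse; intros HP.
      assert (Hpos : forall y, 0 <= y <= 1/2 -> y <= sin (PI * y)).
      { intros y Hy. assert (H := sin_ge_linear (PI * y)).
        assert (0 <= PI * y <= PI / 2) by nra. specialize (H H0). nra. }
      destruct (Rle_dec 0 x).
      - assert (H := Hpos x ltac:(lra)). nra.
      - assert (H := Hpos (- x) ltac:(lra)).
        replace (PI * - x) with (- (PI * x)) in H by ring. rewrite sin_neg in H. nra. }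
    assert (Hx2 : 0 < x ^ 2) by nra.
    assert (H := fejer_sin_sqr N x HN).
    assert (H1 : sin (INR N * (PI * x)) ^ 2 <= 1).
    { generalize (SIN_bound (INR N * (PI * x))). nra. }
    assert (H0 : 0 <= fejer N x).
    { apply Rmult_le_reg_l with (INR N * sin (PI * x) ^ 2); [nra|].
      rewrite Rmult_0_r. replace (INR N * sin (PI * x) ^ 2 * fejer N x) with
        (INR N * fejer N x * sin (PI * x) ^ 2) by ring. rewrite H. nra. }
    split; [easy|].
    apply Rmult_le_reg_l with (INR N); [easy|]. rewrite Rinv_r by lra.
    assert (INR N * fejer N x * x ^ 2 <= INR N * fejer N x * sin (PI * x) ^ 2).
    { apply Rmult_le_compat_l; [apply Rmult_le_pos; lra|easy]. }
    lra.
Qed.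

Lemma continuous_rsum (u : nat -> R -> R) n x : (forall i, continuous (u i) x) ->
  continuous (fun s => rsum (fun i => u i s) n) x.
Proof.
  intros H; induction n as [|n IH]; simpl; [apply continuous_const|].
  apply (continuous_plus (V := R_NormedModule) (fun s => rsum (fun i => u i s) n) (u n)); auto.
Qed.

Lemma continuous_cos_lin a x : continuous (fun s => cos (a * s)) x.
Proof. apply (ex_derive_continuous (fun s => cos (a * s))). auto_derive. easy. Qed.

Lemma continuous_fejer N c x : continuous (fun s => fejer N (s - c)) x.
Proof.
  unfold fejer.
  apply (continuous_scal_r (V := R_NormedModule) (/ INR N)
    (fun s => rsum (fun j => 2 * rsum (fun l => cos (2 * PI * INR l * (s - c))) (S j) - 1) N)).
  apply continuous_rsum. intros j.
  apply (continuous_minus (V := R_NormedModule)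
    (fun s => 2 * rsum (fun l => cos (2 * PI * INR l * (s - c))) (S j)) (fun _ => 1));
  [|apply continuous_const].
  apply (continuous_scal_r (V := R_NormedModule) 2
    (fun s => rsum (fun l => cos (2 * PI * INR l * (s - c))) (S j))).
  apply continuous_rsum. intros l.
  apply (ex_derive_continuous (fun s => cos (2 * PI * INR l * (s - c)))). auto_derive. easy.
Qed.

Lemma RInt_rsum (u : nat -> R -> R) n a b : (forall i x, continuous (u i) x) ->
  RInt (fun s => rsum (fun i => u i s) n) a b = rsum (fun i => RInt (u i) a b) n.
Proof.
  intros H; induction n as [|n IH]; simpl.
  - rewrite RInt_const. unfold scal; simpl; unfold mult; simpl. ring.
  - rewrite <- IH.
    apply (RInt_plus (V := R_CompleteNormedModule) (fun s => rsum (fun i => u i s) n) (u n));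
    apply continuous_ex_RInt; auto. intros x; apply continuous_rsum; auto.
Qed.

Lemma RInt_cos_period l c : RInt (fun s => cos (2 * PI * INR l * (s - c))) (c - 1/2) (c + 1/2)
  = if Nat.eqb l 0 then 1 else 0.
Proof.
  generalize PI_bounds_coarse; intros HP.
  destruct l as [|l].
  - rewrite (RInt_ext _ (fun _ => 1)).
    + rewrite RInt_const. unfold scal; simpl; unfold mult; simpl. lra.
    + intros x _. simpl. replace (2 * PI * 0 * (x - c)) with 0 by ring. apply cos_0.
  - cbn [Nat.eqb].
    assert (Hl : 0 < INR (S l)) by (apply lt_0_INR; lia).
    apply is_RInt_unique.
    assert (E : sin (2 * PI * INR (S l) * (c + 1/2 - c)) / (2 * PI * INR (S l)) -
      sin (2 * PI * INR (S l) * (c - 1/2 - c)) / (2 * PI * INR (S l)) = 0).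
    { replace (2 * PI * INR (S l) * (c + 1/2 - c)) with
        (- (PI * INR (S l)) + 2 * INR (S l) * PI) by field.
      rewrite sin_period.
      replace (2 * PI * INR (S l) * (c - 1/2 - c)) with (- (PI * INR (S l))) by field. ring. }
    rewrite <- E.
    assert (Hb : 2 * PI * INR (S l) <> 0).
    { apply Rgt_not_eq. apply Rmult_lt_0_compat; lra. }
    revert Hb. generalize (2 * PI * INR (S l)). intros b Hb.
    apply (is_RInt_derive (fun s => sin (b * (s - c)) / b)).
    + intros x _. auto_derive; auto. unfold Rminus. field. easy.
    + intros x _. apply (ex_derive_continuous (fun s => cos (b * (s - c)))).
      auto_derive. easy.
Qed.

Lemma rsum_const (c : R) n : rsum (fun _ => c) n = INR n * c.
Proof. induction n as [|n IH]; [simpl; ring|]. cbn [rsum]. rewrite IH, S_INR. ring. Qed.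

Lemma RInt_fejer N c : (0 < N)%nat -> RInt (fun s => fejer N (s - c)) (c - 1/2) (c + 1/2) = 1.
Proof.
  intros HN. assert (HN0 : 0 < INR N) by (apply lt_0_INR; easy).
  assert (Hc1 : forall l x, continuous (fun s => cos (2 * PI * INR l * (s - c))) x).
  { intros l x. apply (ex_derive_continuous (fun s => cos (2 * PI * INR l * (s - c)))).
    auto_derive. easy. }
  assert (Hc2 : forall j x, continuous (fun s => rsum (fun l => cos (2 * PI * INR l * (s - c))) (S j)) x).
  { intros j x. apply continuous_rsum with (u := fun l s => cos (2 * PI * INR l * (s - c))). auto. }
  rewrite (RInt_ext _ (fun s => rsum (fun j => 2 / INR N * rsum (fun l => cos (2 * PI * INR l * (s - c))) (S j)
      + (- / INR N) * 1) N)).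
  2: { intros x _. unfold fejer. rewrite <- rsum_scal. apply rsum_ext. intros. field. lra. }
  rewrite (RInt_rsum (fun j s => 2 / INR N * rsum (fun l => cos (2 * PI * INR l * (s - c))) (S j)
      + (- / INR N) * 1)).
  - rewrite (rsum_ext _ (fun _ => / INR N)).
    + rewrite rsum_const. match goal with |- ?a = ?b => change (@eq R a b) end. field. lra.
    + intros j _. rewrite RInt_lin2; auto; [|intros; apply continuous_const].
      rewrite RInt_const.
      rewrite (RInt_rsum (fun l s => cos (2 * PI * INR l * (s - c)))) by auto.
      rewrite (rsum_single _ (S j) 0) by
        (first [lia|intros i Hi Hne; rewrite RInt_cos_period; destruct i; [lia|easy]]).
      rewrite RInt_cos_period. unfold scal; simpl; unfold mult; simpl. field. lra.
  - intros j x.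
    apply (continuous_plus (V := R_NormedModule)
     (fun s => 2 / INR N * rsum (fun l => cos (2 * PI * INR l * (s - c))) (S j)) (fun _ => - / INR N * 1));
    [|apply continuous_const].
    apply (continuous_scal_r (V := R_NormedModule) (2 / INR N)
      (fun s => rsum (fun l => cos (2 * PI * INR l * (s - c))) (S j))). auto.
Qed.

(** The kernel has mass 1 and satisfies [x^2 F(x) <= 1 / N] pointwise; hence its first absolute
    moment is at most [d = 1 / sqrt N]. Against a Lipschitz function this gives an explicit rate. *)
Lemma fejer_approximation (h : R -> C) N c (l : R) : (0 < N)%nat -> Ccont h -> 0 <= l ->
  (forall x, c - 1/2 <= x <= c + 1/2 -> Cmod (h x - h c) <= l * Rabs (x - c)) ->
  Cmod (CInt (fun s => h s * RtoC (fejer N (s - c))) (c - 1/2) (c + 1/2) - h c)%C <= l * / sqrt (INR N).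
Proof.
  intros HN Hh Hl Hlip. assert (HN0 : 0 < INR N) by (apply lt_0_INR; easy).
  set (d := / sqrt (INR N)).
  assert (Hd : 0 < d) by (apply Rinv_0_lt_compat, sqrt_lt_R0; easy).
  assert (Hd2 : d * d = / INR N).
  { unfold d. rewrite <- Rinv_mult, sqrt_sqrt; lra. }
  assert (HF : Ccont (fun s => RtoC (fejer N (s - c)))).
  { apply Ccont_RtoC. intros; apply continuous_fejer. }
  assert (HcF : Ccont (fun s => h c * RtoC (fejer N (s - c)))%C).
  { apply Ccont_mult; [apply Ccont_const|easy]. }
  assert (HhF : Ccont (fun s => h s * RtoC (fejer N (s - c)))%C) by (apply Ccont_mult; easy).
  assert (HdF : Ccont (fun s => (h s - h c) * RtoC (fejer N (s - c)))%C).
  { apply Ccont_mult; [|easy]. apply (Ccont_ext (fun s => h s + - h c)%C); [easy|].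
    apply Ccont_plus; [easy|apply Ccont_const]. }
  assert (E : (CInt (fun s => h s * RtoC (fejer N (s - c))) (c - 1/2) (c + 1/2) - h c)%C
     = CInt (fun s => (h s - h c) * RtoC (fejer N (s - c)))%C (c - 1/2) (c + 1/2)).
  { rewrite (CInt_ext (fun s => h s * RtoC (fejer N (s - c)))%C
      (fun s => (h s - h c) * RtoC (fejer N (s - c)) + h c * RtoC (fejer N (s - c)))%C)
      by (intros; ring).
    rewrite (CInt_plus (fun s => (h s - h c) * RtoC (fejer N (s - c)))%C
      (fun s => h c * RtoC (fejer N (s - c)))%C) by easy.
    rewrite (CInt_scal (h c) (fun s => RtoC (fejer N (s - c)))) by easy.
    rewrite CInt_RtoC by (intros; apply continuous_fejer).
    rewrite RInt_fejer by easy. ring. }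
  rewrite E.
  assert (Hcont : forall x, continuous (fun s => l * d / 2 * fejer N (s - c) + l * d / 2 * 1) x).
  { intros x. apply (continuous_plus (V := R_NormedModule)
      (fun s => l * d / 2 * fejer N (s - c)) (fun s => l * d / 2 * 1)); [|apply continuous_const].
    apply (continuous_scal_r (V := R_NormedModule) (l * d / 2) (fun s => fejer N (s - c))).
    apply continuous_fejer. }
  eapply Rle_trans; [apply Cmod_CInt_le with (g := fun s => l * d / 2 * fejer N (s - c) + l * d / 2 * 1)|].
  - lra.
  - easy.
  - easy.
  - intros s Hs. rewrite Cmod_mult, Cmod_R.
    destruct (fejer_bounds N (s - c) HN) as [H0 H1]; [lra|].
    rewrite (Rabs_right (fejer N (s - c))) by lra.
    set (F := fejer N (s - c)) in *. set (x := s - c) in *.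
    assert (Ha : Cmod (h s - h c) <= l * Rabs x) by (apply Hlip; easy).
    assert (Hab : Rabs x * Rabs x = x ^ 2) by (rewrite <- Rabs_mult, Rabs_right; [ring|nra]).
    (* [2 |x| d <= d^2 + x^2] *)
    assert (Hamgm : Rabs x * F <= d / 2 * F + d / 2).
    { apply Rmult_le_reg_l with (2 * d); [lra|].
      assert (2 * d * Rabs x <= d * d + x ^ 2).
      { rewrite <- Hab. generalize (Rle_0_sqr (Rabs x - d)). unfold Rsqr. nra. }
      nra. }
    apply Rle_trans with (l * Rabs x * F); [apply Rmult_le_compat_r; easy|]. nra.
  - rewrite RInt_lin2; [|intros; apply continuous_fejer|intros; apply continuous_const].
    rewrite RInt_fejer by easy. rewrite RInt_const.
    unfold scal; simpl; unfold mult; simpl. right. field.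
Qed.

(** * The Fourier transform of the Gaussian *)

Lemma is_derive_of_quadratic_remainder (f : R -> R) x d K :
  (forall y, Rabs (f y - f x - (y - x) * d) <= K * (y - x) ^ 2) -> is_derive f x d.
Proof.
  intros H. apply is_derive_Reals. intros eps Heps.
  assert (HK : 0 <= K).
  { generalize (Rabs_pos (f (x + 1) - f x - (x + 1 - x) * d)) (H (x + 1)). nra. }
  assert (Hd : 0 < eps / (K + 1)) by (apply Rdiv_lt_0_compat; lra).
  exists (mkposreal _ Hd). intros h Hh0 Hh. simpl in Hh.
  specialize (H (x + h)). replace (x + h - x) with h in H by ring.
  replace ((f (x + h) - f x) / h - d) with ((f (x + h) - f x - h * d) / h) by (field; easy).
  unfold Rdiv. rewrite Rabs_mult, Rabs_inv.
  assert (Hp : 0 < Rabs h) by (apply Rabs_pos_lt; easy).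
  apply Rmult_lt_reg_r with (Rabs h); [easy|].
  rewrite Rmult_assoc, Rinv_l, Rmult_1_r by lra.
  eapply Rle_lt_trans; [apply H|]. rewrite <- pow2_abs.
  assert (Rabs h * (K + 1) < eps).
  { apply Rmult_lt_reg_r with (/ (K + 1)); [apply Rinv_0_lt_compat; lra|].
    rewrite Rmult_assoc, Rinv_r, Rmult_1_r by lra. exact Hh. }
  nra.
Qed.

Lemma cos_second_order a b : Rabs (cos b - cos a + (b - a) * sin a) <= (b - a) ^ 2.
Proof.
  assert (Hsin : forall u v, Rabs (sin u - sin v) <= Rabs (u - v)).
  { intros u v. destruct (MVT_gen sin v u cos) as [c [_ Hc]].
    - intros; apply is_derive_sin.
    - intros; apply continuity_sin.
    - rewrite Hc, Rabs_mult. assert (H := COS_bound c).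
      assert (Rabs (cos c) <= 1) by (apply Rabs_le; lra).
      generalize (Rabs_pos (u - v)); nra. }
  destruct (MVT_gen cos a b (fun x => - sin x)) as [c [Hc Heq]].
  - intros; apply is_derive_cos.
  - intros; apply continuity_cos.
  - rewrite Heq. replace (- sin c * (b - a) + (b - a) * sin a) with ((sin a - sin c) * (b - a)) by ring.
    rewrite Rabs_mult, <- (pow2_abs (b - a)). simpl. rewrite Rmult_1_r.
    apply Rmult_le_compat_r; [apply Rabs_pos|].
    eapply Rle_trans; [apply Hsin|].
    unfold Rmin, Rmax in Hc; destruct (Rle_dec a b); unfold Rabs; repeat destruct Rcase_abs; lra.
Qed.

Lemma Cder_of_quadratic_remainder (f f' : R -> C) (K : R -> R) :
  (forall x y, Cmod (f y - f x - RtoC (y - x) * f' x) <= K x * (y - x) ^ 2) -> Cder f f'.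
Proof.
  intros H x. split; apply is_derive_of_quadratic_remainder with (K x); intros y.
  - eapply Rle_trans; [|apply (H x y)]. eapply Rle_trans; [|apply re_le_Cmod].
    right; f_equal; unfold Re; simpl; ring.
  - eapply Rle_trans; [|apply (H x y)]. eapply Rle_trans; [|apply im_le_Cmod].
    right; f_equal; unfold Im; simpl; ring.
Qed.

Lemma continuous_sin_lin a x : continuous (fun s => sin (a * s)) x.
Proof. apply (ex_derive_continuous (fun s => sin (a * s))). auto_derive. easy. Qed.

(** Differentiation under the integral sign: the second-order bound for the cosine integrates to a
    remainder quadratic in the increment, which characterises the derivative. *)
Lemma Cder_CInt_cos (g : R -> C) L : 0 <= L -> Ccont g ->
  Cder (fun xi => CInt (fun s => g s * RtoC (cos (2 * PI * xi * s)))%C 0 L)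
       (fun xi => CInt (fun s => g s * RtoC (- (2 * PI * s) * sin (2 * PI * xi * s)))%C 0 L).
Proof.
  intros HL Hg.
  assert (C1 : forall xi, Ccont (fun s => g s * RtoC (cos (2 * PI * xi * s)))%C).
  { intros xi. apply Ccont_mult; [easy|]. apply Ccont_RtoC. apply continuous_cos_lin. }
  assert (Cs : forall x, continuous (fun s => - (2 * PI * s)) x).
  { intros x. apply (ex_derive_continuous (fun s => - (2 * PI * s))). auto_derive. easy. }
  assert (C2 : forall xi, Ccont (fun s => g s * RtoC (- (2 * PI * s) * sin (2 * PI * xi * s)))%C).
  { intros xi. apply Ccont_mult; [easy|]. apply Ccont_RtoC. intros x.
    apply (continuous_mult (K := R_AbsRing)); [apply Cs|apply continuous_sin_lin]. }
  apply Cder_of_quadratic_remainder with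
    (fun _ => RInt (fun s => Cmod (g s) * (2 * PI * s) ^ 2) 0 L).
  intros x y.
  set (rem := fun s => cos (2 * PI * y * s) - cos (2 * PI * x * s) + (y - x) * (2 * PI * s * sin (2 * PI * x * s))).
  assert (Crem : forall u, continuous rem u).
  { intros u. apply (ex_derive_continuous rem). unfold rem. auto_derive. easy. }
  assert (Cgrem : Ccont (fun s => g s * RtoC (rem s))%C).
  { apply Ccont_mult; [easy|]. apply Ccont_RtoC; easy. }
  assert (Csq : forall u, continuous (fun s => Cmod (g s) * (2 * PI * s) ^ 2) u).
  { intros u. apply (continuous_mult (K := R_AbsRing)); [apply Ccont_Cmod; easy|].
    apply (ex_derive_continuous (fun s => (2 * PI * s) ^ 2)). auto_derive. easy. }
  assert (E : (CInt (fun s => g s * RtoC (cos (2 * PI * y * s)))%C 0 L =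
    CInt (fun s => g s * RtoC (cos (2 * PI * x * s)))%C 0 L +
    (RtoC (y - x) * CInt (fun s => g s * RtoC (- (2 * PI * s) * sin (2 * PI * x * s)))%C 0 L +
     CInt (fun s => g s * RtoC (rem s)) 0 L))%C).
  { rewrite <- CInt_scal by apply C2.
    assert (C3 : Ccont (fun s => RtoC (y - x) * (g s * RtoC (- (2 * PI * s) * sin (2 * PI * x * s))))%C).
    { apply Ccont_mult; [apply Ccont_const|apply C2]. }
    rewrite <- (CInt_plus (fun s => RtoC (y - x) * (g s * RtoC (- (2 * PI * s) * sin (2 * PI * x * s))))%C
       (fun s => g s * RtoC (rem s))%C) by easy.
    rewrite <- (CInt_plus (fun s => g s * RtoC (cos (2 * PI * x * s)))%C
       (fun s => RtoC (y - x) * (g s * RtoC (- (2 * PI * s) * sin (2 * PI * x * s))) + g s * RtoC (rem s))%C).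
    - apply CInt_ext. intros s.
      replace (cos (2 * PI * y * s)) with (cos (2 * PI * x * s) +
        ((y - x) * (- (2 * PI * s) * sin (2 * PI * x * s)) + rem s)) by (unfold rem; ring).
      rewrite !RtoC_plus, RtoC_mult. ring.
    - apply C1.
    - apply (Ccont_plus (fun s => RtoC (y - x) * (g s * RtoC (- (2 * PI * s) * sin (2 * PI * x * s))))%C
       (fun s => g s * RtoC (rem s))%C); easy. }
  rewrite E.
  match goal with |- Cmod ?u <= _ => replace u with (CInt (fun s => g s * RtoC (rem s))%C 0 L) by ring end.
  eapply Rle_trans; [apply Cmod_CInt_le with (g := fun s => (y - x) ^ 2 * (Cmod (g s) * (2 * PI * s) ^ 2))|].
  - easy.
  - easy.
  - intros u. apply (continuous_scal_r (V := R_NormedModule) ((y - x) ^ 2)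
      (fun s => Cmod (g s) * (2 * PI * s) ^ 2)). apply Csq.
  - intros s _. rewrite Cmod_mult, Cmod_R.
    replace ((y - x) ^ 2 * (Cmod (g s) * (2 * PI * s) ^ 2)) with
      (Cmod (g s) * (2 * PI * y * s - 2 * PI * x * s) ^ 2) by ring.
    apply Rmult_le_compat_l; [apply Cmod_ge_0|].
    eapply Rle_trans; [|apply cos_second_order]. right; f_equal. unfold rem. ring.
  - rewrite (RInt_scal_R ((y - x) ^ 2) (fun s => Cmod (g s) * (2 * PI * s) ^ 2)) by easy.
    right; ring.
Qed.

(** The Gaussian whose cosine transform at an integer [l] is proportional to [q^(l^2)] with
    [q = e^(-z)]; its values at [k + 1/2] are the terms of the transformed theta series. *)
Definition gauss (z : C) (s : R) : C := cexp (- (RtoC (PI ^ 2) / z) * RtoC (s ^ 2)).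

Lemma Cder_gauss (z : C) : Cder (gauss z) (fun s => - (RtoC (2 * PI ^ 2) / z) * RtoC s * gauss z s)%C.
Proof.
  eapply Cder_ext.
  2: { apply Cder_cexp. apply Cder_scal. apply (Cder_RtoC (fun s => s ^ 2) (fun s => 2 * s)).
       intros x. auto_derive; auto; ring. }
  intros s. cbv beta. fold (gauss z s). rewrite !RtoC_mult. unfold Cdiv. ring.
Qed.

Lemma Ccont_gauss (z : C) : Ccont (gauss z).
Proof. apply (Cder_Ccont _ _ (Cder_gauss z)). Qed.

Lemma Cmod_gauss (z : C) s : Cmod (gauss z s) = exp (- (PI ^ 2 * Re (/ z) * s ^ 2)).
Proof.
  unfold gauss. rewrite Cmod_cexp. f_equal. unfold Cdiv, Re. simpl. ring.
Qed.

Lemma Re_inv_pos (z : C) : 0 < Re z -> 0 < Re (/ z).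
Proof.
  intros H. unfold Re in *. simpl. apply Rdiv_lt_0_compat; [easy|]. nra.
Qed.

Lemma C_nz_of_Re_pos (z : C) : 0 < Re z -> z <> 0.
Proof. intros H E. rewrite E in H. simpl in H. lra. Qed.

Definition gauss_cos (z : C) (L xi : R) : C :=
  CInt (fun s => gauss z s * RtoC (cos (2 * PI * xi * s)))%C 0 L.

Lemma gauss_cos_0 z L : gauss_cos z L 0 = CInt (gauss z) 0 L.
Proof.
  apply CInt_ext. intros s. replace (2 * PI * 0 * s) with 0 by ring. rewrite cos_0. ring.
Qed.

(* Integration by parts: [-2 pi s g(s) = (z / pi) g'(s)], so the Fourier transform of the
   Gaussian satisfies [K' = -2 xi z K] up to a boundary term at [L]. *)
Lemma Cder_gauss_cos z L : 0 < Re z -> 0 <= L ->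
  Cder (gauss_cos z L)
    (fun xi => z / RtoC PI * gauss z L * RtoC (sin (2 * PI * xi * L)) - RtoC (2 * xi) * z * gauss_cos z L xi)%C.
Proof.
  intros Hz HL. assert (Hz0 := C_nz_of_Re_pos z Hz).
  assert (HPI : RtoC PI <> 0).
  { intros H. apply RtoC_inj in H. generalize PI_RGT_0; lra. }
  eapply Cder_ext; [|apply Cder_CInt_cos; [easy|apply Ccont_gauss]].
  intros xi. cbv beta.
  set (f1 := fun s => (gauss z s * RtoC (- (2 * PI * s) * sin (2 * PI * xi * s)))%C).
  set (f2 := fun s => (gauss z s * RtoC (cos (2 * PI * xi * s)))%C).
  assert (C1 : Ccont f1).
  { apply Ccont_mult; [apply Ccont_gauss|]. apply Ccont_RtoC. intros x.
    apply (ex_derive_continuous (fun s => - (2 * PI * s) * sin (2 * PI * xi * s))). auto_derive. easy. }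
  assert (C2 : Ccont f2).
  { apply Ccont_mult; [apply Ccont_gauss|]. apply Ccont_RtoC. intros x. apply continuous_cos_lin. }
  assert (Hd : Cder (fun s => gauss z s * RtoC (sin (2 * PI * xi * s)))%C
     (fun s => (RtoC PI / z) * f1 s + (RtoC (2 * PI * xi) * f2 s + 0 * f2 s))%C).
  { eapply Cder_ext.
    2: { apply Cder_mult; [apply Cder_gauss|].
         apply (Cder_RtoC _ (fun s => 2 * PI * xi * cos (2 * PI * xi * s))).
         intros x. auto_derive; auto; ring. }
    intros s. cbv beta. unfold f1, f2. rewrite !RtoC_mult, !RtoC_opp, !RtoC_mult, RtoC_pow. field. easy. }
  assert (H := CInt_der_lin3 _ _ _ _ _ _ _ 0 L C1 C2 C2 Hd). cbv beta in H.
  fold f1 f2. change (gauss_cos z L xi) with (CInt f2 0 L).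
  replace (2 * PI * xi * 0) with 0 in H by ring. rewrite sin_0 in H.
  assert (H' : (CInt f1 0 L = z / RtoC PI * (RtoC PI / z * CInt f1 0 L + (RtoC (2 * PI * xi) * CInt f2 0 L + 0 * CInt f2 0 L))
      - RtoC (2 * xi) * z * CInt f2 0 L)%C).
  { rewrite !RtoC_mult. field. split; easy. }
  rewrite H', <- H. ring.
Qed.

(** The derivative of [e^(z xi^2) K(xi)] consists of the boundary term at [L] alone, so this
    function is nearly constant on [[0, n]]. The factor [e^(n^2 Re z)] is harmless: [L] tends to
    infinity with [n] fixed. *)
Lemma gauss_cos_transform z (n : nat) L : 0 < Re z -> 0 <= L ->
  Cmod (gauss_cos z L (INR n) - cexp (- (RtoC (INR n ^ 2) * z)) * CInt (gauss z) 0 L)%C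
  <= 2 * (exp (INR n ^ 2 * Re z) * (Cmod z / PI)) * INR n * exp (- (PI ^ 2 * Re (/ z) * L ^ 2)).
Proof.
  intros Hz HL. generalize PI_RGT_0 (pos_INR n); intros HPI Hn.
  assert (Hd : Cder (fun xi => cexp (z * RtoC (xi ^ 2)) * gauss_cos z L xi)%C
     (fun xi => cexp (z * RtoC (xi ^ 2)) * (z / RtoC PI * gauss z L * RtoC (sin (2 * PI * xi * L))))%C).
  { eapply Cder_ext.
    2: { apply Cder_mult; [|apply Cder_gauss_cos; easy].
         apply Cder_cexp, Cder_scal, (Cder_RtoC (fun x => x ^ 2) (fun x => 2 * x)).
         intros x. auto_derive; auto; ring. }
    intros xi. cbv beta. ring. }
  assert (H := Cder_bound _ _ 0 (INR n)
     (exp (INR n ^ 2 * Re z) * (Cmod z / PI) * exp (- (PI ^ 2 * Re (/ z) * L ^ 2))) Hn Hd).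
  cbv beta in H. rewrite gauss_cos_0 in H.
  replace (z * RtoC (0 ^ 2))%C with (RtoC 0) in H by (simpl; rewrite Rmult_0_l; ring).
  rewrite cexp_0, Rminus_0_r in H.
  replace (gauss_cos z L (INR n) - cexp (- (RtoC (INR n ^ 2) * z)) * CInt (gauss z) 0 L)%C with
    (cexp (- (RtoC (INR n ^ 2) * z)) * (cexp (z * RtoC (INR n ^ 2)) * gauss_cos z L (INR n) - 1 * CInt (gauss z) 0 L))%C.
  2: { rewrite (Cmult_comm z). generalize (cexp_opp (RtoC (INR n ^ 2) * z)). intros E.
       transitivity ((cexp (RtoC (INR n ^ 2) * z) * cexp (- (RtoC (INR n ^ 2) * z))) * gauss_cos z L (INR n)
         - cexp (- (RtoC (INR n ^ 2) * z)) * CInt (gauss z) 0 L)%C; [ring|]. rewrite E. ring. }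
  rewrite Cmod_mult, Cmod_cexp.
  assert (He : exp (Re (- (RtoC (INR n ^ 2) * z))) <= 1).
  { rewrite <- exp_0. unfold Re in *. simpl.
    assert (- (INR n * (INR n * 1) * fst z - 0 * snd z) <= 0) as [K|K] by nra.
    - left; apply exp_increasing; exact K.
    - rewrite K; lra. }
  eapply Rle_trans.
  - apply Rmult_le_compat_r; [apply Cmod_ge_0|exact He].
  - rewrite Rmult_1_l. eapply Rle_trans; [apply H|right; ring].
    intros s Hs. rewrite !Cmod_mult, Cmod_cexp, Cmod_gauss, Cmod_R.
    rewrite Cmod_div, Cmod_R, (Rabs_right PI) by (try lra; intros E; apply RtoC_inj in E; lra).
    assert (H1 : exp (Re (z * RtoC (s ^ 2))) <= exp (INR n ^ 2 * Re z)).
    { unfold Re in *; simpl.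
      assert (fst z * (s * (s * 1)) - snd z * 0 <= INR n * (INR n * 1) * fst z) as [K|K].
      { assert (s * s <= INR n * INR n) by nra. nra. }
      - left; apply exp_increasing; exact K.
      - rewrite K; lra. }
    assert (H2 : Rabs (sin (2 * PI * s * L)) <= 1) by (apply Rabs_le, SIN_bound).
    assert (H3 : 0 <= Cmod z / PI).
    { apply Rmult_le_pos; [apply Cmod_ge_0|left; apply Rinv_0_lt_compat; easy]. }
    assert (H4 := exp_pos (- (PI ^ 2 * Re (/ z) * L ^ 2))).
    assert (H5 := exp_pos (Re (z * RtoC (s ^ 2)))).
    assert (H6 : 0 <= Cmod z / PI * exp (- (PI ^ 2 * Re (/ z) * L ^ 2))) by (apply Rmult_le_pos; lra).
    rewrite (Rmult_assoc (exp (INR n ^ 2 * Re z))).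
    apply Rmult_le_compat; [lra| |exact H1|].
    + apply Rmult_le_pos; [easy|apply Rabs_pos].
    + generalize (Rabs_pos (sin (2 * PI * s * L))). nra.
Qed.

Lemma INR_le_sqr n : INR n <= INR n ^ 2.
Proof.
  replace (INR n ^ 2) with (INR (n * n)) by (rewrite mult_INR; ring).
  apply le_INR. nia.
Qed.

Lemma lim_exp_quadratic_decay (a : R) : 0 < a -> is_lim_seq (fun L => exp (- (a * INR L ^ 2))) 0.
Proof.
  intros Ha. apply lim_seq_dominated_eventually with (fun n => exp (- a) ^ n) O.
  - intros n _. split; [left; apply exp_pos|]. rewrite exp_pow_INR.
    assert (- (a * INR n ^ 2) <= INR n * - a) as [H|H].
    { generalize (INR_le_sqr n). nra. }
    + left; apply exp_increasing; easy.
    + rewrite H; lra.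
  - apply is_lim_seq_geom. rewrite Rabs_right by (left; apply exp_pos).
    rewrite <- exp_0. apply exp_increasing. lra.
Qed.

(** * Modular transformation of the theta function *)

Definition theta_term (q : C) (l : nat) : C := ((- (1)) ^ l * q ^ (l * l))%C.

(* Partial sums of [theta(q) = sum over all integers of (-1)^l q^(l^2)]. *)
Definition theta_partial (q : C) (j : nat) : C := (2 * csum (theta_term q) (S j) - 1)%C.
(** Cesaro means, because integration against the Fejer kernel produces averages of
    [theta_partial]. *)
Definition theta_cesaro (q : C) (N : nat) : C := (/ RtoC (INR N) * csum (theta_partial q) N)%C.

Lemma cos_half_shift l k s :
  cos (2 * PI * INR l * (s - (INR k + 1 / 2))) = (-1) ^ l * cos (2 * PI * INR l * s).
Proof.
  replace (2 * PI * INR l * (s - (INR k + 1 / 2))) with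
    (- (- (2 * PI * INR l * s) + PI * INR l + 2 * INR (l * k) * PI)) by (rewrite mult_INR; field).
  rewrite cos_neg, cos_period.
  induction l as [|l IH].
  - simpl. replace (- (2 * PI * 0 * s) + PI * 0) with (- (2 * PI * 0 * s)) by ring.
    rewrite cos_neg. ring.
  - clear IH. generalize (2 * PI * INR (S l) * s). intros y.
    assert (H : forall m x, cos (x + PI * INR m) = (-1) ^ m * cos x).
    { induction m as [|m IH]; intros x.
      - simpl. rewrite Rmult_0_r, Rplus_0_r. ring.
      - rewrite S_INR. replace (x + PI * (INR m + 1)) with (x + PI * INR m + PI) by ring.
        rewrite neg_cos, IH. simpl. ring. }
    rewrite H, cos_neg. easy.
Qed.

(** Centred at any [k + 1/2] the kernel is the same function: integer shifts are periods, and the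
    half shift produces the signs [(-1)^l] of theta. *)
Lemma fejer_shift N k s : fejer N (s - (INR k + 1 / 2)) =
  / INR N * rsum (fun j => 2 * rsum (fun l => (-1) ^ l * cos (2 * PI * INR l * s)) (S j) - 1) N.
Proof.
  unfold fejer. f_equal. apply rsum_ext. intros j _. do 2 f_equal.
  apply rsum_ext. intros l _. apply cos_half_shift.
Qed.

Lemma RtoC_pow_minus_one l : RtoC ((-1) ^ l) = ((- (1)) ^ l)%C.
Proof. rewrite RtoC_pow, RtoC_minus_one. easy. Qed.

Lemma CInt_gauss_fejer z N L : (0 < N)%nat ->
  CInt (fun s => gauss z s * RtoC (fejer N (s - (INR 0 + 1 / 2))))%C 0 L =
  (/ RtoC (INR N) * csum (fun j => 2 * csum (fun l => (- (1)) ^ l * gauss_cos z L (INR l)) (S j)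
      - gauss_cos z L 0) N)%C.
Proof.
  intros HN.
  assert (HN0 : INR N <> 0) by (apply not_0_INR; lia).
  assert (HNC : RtoC (INR N) <> 0) by (intros H; apply RtoC_inj in H; easy).
  assert (C1 : forall xi, Ccont (fun s => gauss z s * RtoC (cos (2 * PI * xi * s)))%C).
  { intros xi. apply Ccont_mult; [apply Ccont_gauss|]. apply Ccont_RtoC, continuous_cos_lin. }
  assert (C2 : forall l, Ccont (fun s => (- (1)) ^ l * (gauss z s * RtoC (cos (2 * PI * INR l * s))))%C).
  { intros l. apply Ccont_mult; [apply Ccont_const|apply C1]. }
  assert (C3 : forall j, Ccont (fun s => csum (fun l => (- (1)) ^ l * (gauss z s * RtoC (cos (2 * PI * INR l * s))))%C (S j))).
  { intros j. apply (Ccont_csum (fun l s => ((- (1)) ^ l * (gauss z s * RtoC (cos (2 * PI * INR l * s))))%C)). easy. }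
  assert (C4 : Ccont (fun s => (- (1)) * (gauss z s * RtoC (cos (2 * PI * 0 * s))))%C).
  { apply Ccont_mult; [apply Ccont_const|apply C1]. }
  assert (C5 : forall j, Ccont (fun s => 2 * csum (fun l => (- (1)) ^ l * (gauss z s * RtoC (cos (2 * PI * INR l * s))))%C (S j))%C).
  { intros j. apply Ccont_mult; [apply Ccont_const|apply C3]. }
  set (u := fun j s => (2 * csum (fun l => (- (1)) ^ l * (gauss z s * RtoC (cos (2 * PI * INR l * s)))) (S j)
     + (- (1)) * (gauss z s * RtoC (cos (2 * PI * 0 * s))))%C).
  assert (C6 : forall j, Ccont (u j)).
  { intros j. apply (Ccont_plus (fun s => 2 * csum (fun l => (- (1)) ^ l * (gauss z s * RtoC (cos (2 * PI * INR l * s))))%C (S j))%C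
      (fun s => (- (1)) * (gauss z s * RtoC (cos (2 * PI * 0 * s))))%C); easy. }
  assert (C7 : Ccont (fun s => csum (fun j => u j s) N)) by (apply (Ccont_csum u); easy).
  rewrite (CInt_ext _ (fun s => / RtoC (INR N) * csum (fun j => u j s) N)%C).
  - rewrite (CInt_scal _ (fun s => csum (fun j => u j s) N)) by easy. f_equal.
    rewrite (CInt_csum u) by easy. apply csum_ext. intros j _. unfold u.
    rewrite (CInt_plus (fun s => 2 * csum (fun l => (- (1)) ^ l * (gauss z s * RtoC (cos (2 * PI * INR l * s))))%C (S j))%C
      (fun s => (- (1)) * (gauss z s * RtoC (cos (2 * PI * 0 * s))))%C) by easy.
    rewrite (CInt_scal 2 (fun s => csum (fun l => (- (1)) ^ l * (gauss z s * RtoC (cos (2 * PI * INR l * s))))%C (S j))) by easy.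
    rewrite (CInt_scal (- (1)) (fun s => gauss z s * RtoC (cos (2 * PI * 0 * s)))%C) by easy.
    rewrite (CInt_csum (fun l s => ((- (1)) ^ l * (gauss z s * RtoC (cos (2 * PI * INR l * s))))%C)) by easy.
    rewrite (csum_ext (fun i => CInt (fun s => (- (1)) ^ i * (gauss z s * RtoC (cos (2 * PI * INR i * s))))%C 0 L)
      (fun l => (- (1)) ^ l * gauss_cos z L (INR l))%C).
    + unfold gauss_cos. ring.
    + intros l _. rewrite (CInt_scal _ (fun s => gauss z s * RtoC (cos (2 * PI * INR l * s)))%C) by easy. easy.
  - intros s. rewrite fejer_shift, RtoC_mult, RtoC_inv by easy.
    rewrite Cmult_comm, <- Cmult_assoc. f_equal.
    rewrite <- csum_RtoC, Cmult_comm, <- csum_scal. apply csum_ext. intros j _. unfold u.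
    rewrite RtoC_minus, RtoC_mult, <- csum_RtoC.
    rewrite (csum_ext (fun l => (- (1)) ^ l * (gauss z s * RtoC (cos (2 * PI * INR l * s))))%C
      (fun l => gauss z s * RtoC ((-1) ^ l * cos (2 * PI * INR l * s)))%C).
    + rewrite csum_scal. replace (2 * PI * 0 * s) with 0 by ring. rewrite cos_0. ring.
    + intros l _. rewrite RtoC_mult, RtoC_pow_minus_one. ring.
Qed.

Lemma CInt_pieces (h : R -> C) L : Ccont h ->
  CInt h 0 (INR L) = csum (fun k => CInt h (INR k) (INR k + 1)) L.
Proof.
  intros Hh. induction L as [|L IH].
  - simpl. unfold CInt. rewrite !RInt_point. easy.
  - cbn [csum]. rewrite <- IH, CInt_Chasles by easy. rewrite S_INR. easy.
Qed.

(** On the [k]-th unit interval [s^2 >= k^2 >= k], so the Gaussian decays at least geometrically and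
    the Lipschitz constants are summable over [k]. *)
Lemma gauss_lipschitz z k x : 0 < Re z -> INR k <= x <= INR k + 1 ->
  Cmod (gauss z x - gauss z (INR k + 1 / 2)) <=
  4 * PI ^ 2 / Cmod z * ((INR k + 1) * exp (- (PI ^ 2 * Re (/ z))) ^ k) * Rabs (x - (INR k + 1 / 2)).
Proof.
  intros Hz Hx. assert (Hk := pos_INR k).
  assert (Hz0 := C_nz_of_Re_pos z Hz). assert (HC : 0 < Cmod z) by (apply Cmod_gt_0; easy).
  assert (Hr := Re_inv_pos z Hz).
  set (B := 2 * PI ^ 2 / Cmod z * ((INR k + 1) * exp (- (PI ^ 2 * Re (/ z))) ^ k)).
  assert (HB : forall s, INR k <= s <= INR k + 1 ->
     Cmod (- (RtoC (2 * PI ^ 2) / z) * RtoC s * gauss z s)%C <= B).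
  { intros s Hs. rewrite !Cmod_mult, Cmod_opp, Cmod_div, !Cmod_R, Cmod_gauss by easy.
    assert (0 < 2 * PI ^ 2) by (generalize PI_RGT_0; nra).
    rewrite (Rabs_right (2 * PI ^ 2)), (Rabs_right s) by lra.
    unfold B. rewrite Rmult_assoc. apply Rmult_le_compat_l.
    - apply Rmult_le_pos; [lra|left; apply Rinv_0_lt_compat; easy].
    - apply Rmult_le_compat; [lra|left; apply exp_pos|lra|].
      rewrite exp_pow_INR.
      assert (- (PI ^ 2 * Re (/ z) * s ^ 2) <= INR k * - (PI ^ 2 * Re (/ z))) as [K|K].
      { assert (0 < PI ^ 2 * Re (/ z)) by (apply Rmult_lt_0_compat; [apply pow_lt, PI_RGT_0|easy]).
        assert (INR k <= s ^ 2); [|nra].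
        generalize (INR_le_sqr k). nra. }
      + left; apply exp_increasing; exact K.
      + rewrite K; lra. }
  replace (4 * PI ^ 2 / Cmod z * ((INR k + 1) * exp (- (PI ^ 2 * Re (/ z))) ^ k)) with (2 * B)
    by (unfold B; field; lra).
  destruct (Rle_dec x (INR k + 1 / 2)) as [Hle|Hgt].
  - rewrite Cmod_minus_sym, Rabs_left1 by lra.
    replace (- (x - (INR k + 1 / 2))) with (INR k + 1 / 2 - x) by ring.
    apply (Cder_bound _ _ _ _ B Hle (Cder_gauss z)). intros s Hs. apply HB. lra.
  - assert (Hge : INR k + 1 / 2 <= x) by lra. rewrite Rabs_right by lra.
    apply (Cder_bound _ _ _ _ B Hge (Cder_gauss z)). intros s Hs. apply HB. lra.
Qed.

Lemma lim_seq_rsum0 (u : nat -> nat -> R) n :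
  (forall i, (i < n)%nat -> is_lim_seq (u i) 0) -> is_lim_seq (fun L => rsum (fun i => u i L) n) 0.
Proof.
  induction n as [|n IH]; simpl; intros H; [apply is_lim_seq_const|].
  apply lim_seq_plus0; auto with arith.
Qed.

Lemma rsum_arith_geom_bound (rho : R) : 0 < rho < 1 -> exists B, 0 <= B /\
  forall n, rsum (fun k => (INR k + 1) * rho ^ k) n <= B.
Proof.
  intros Hr. set (V := 1 + / (1 - rho)).
  assert (H0 : 0 < / (1 - rho)) by (apply Rinv_0_lt_compat; lra).
  assert (HV : 0 < V) by (unfold V; lra).
  assert (He : exp (/ V) <= 1 + (1 - rho)) by (apply exp_inv_le_of_gap; lra).
  exists (V ^ 1 / (1 - rho) + V ^ 0 / (1 - rho)). split.
  - unfold Rdiv. simpl. apply Rplus_le_le_0_compat; apply Rmult_le_pos; lra.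
  - intros n. rewrite (rsum_ext _ (fun k => power_coef 1 k * rho ^ k + power_coef 0 k * rho ^ k)).
    + rewrite rsum_plus. apply Rplus_le_compat; apply real_power_sum_bound; easy.
    + intros k _. unfold power_coef. simpl. field.
Qed.

Lemma Cmod_minus_one_pow l : Cmod ((- (1)) ^ l)%C = 1.
Proof. rewrite Cmod_pow, Cmod_m1, pow1. easy. Qed.

Lemma theta_term_cexp z l :
  theta_term (cexp (- z)) l = ((- (1)) ^ l * cexp (- (RtoC (INR l ^ 2) * z)))%C.
Proof.
  unfold theta_term. rewrite cexp_pow, mult_INR. do 2 f_equal.
  simpl. rewrite Rmult_1_r. ring.
Qed.

(** Both terms approximate the integral of the Gaussian times the Fejer kernel over [[0, L]].
    Expanding the kernel in cosines gives the Cesaro mean of theta times the Gaussian integral, up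
    to an error that vanishes with growing [L] for fixed [N]; on each unit interval the kernel picks
    out the midpoint value, with errors summable over [k]. [K] depends on [z] alone, so [N] can be
    chosen before [L]. *)
Lemma theta_transform z : 0 < Re z -> exists K, 0 <= K /\
  forall N, (0 < N)%nat -> forall eps, 0 < eps -> exists L0, forall L, (L0 <= L)%nat ->
  Cmod (theta_cesaro (cexp (- z)) N * CInt (gauss z) 0 (INR L)
        - csum (fun k => gauss z (INR k + 1 / 2)) L)%C <= eps + K * / sqrt (INR N).
Proof.
  intros Hz. assert (Hz0 := C_nz_of_Re_pos z Hz). assert (HC : 0 < Cmod z) by (apply Cmod_gt_0; easy).
  assert (Hr := Re_inv_pos z Hz). generalize PI_RGT_0; intros HPI.
  assert (Ha : 0 < PI ^ 2 * Re (/ z)) by (apply Rmult_lt_0_compat; [apply pow_lt|]; easy).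
  set (rho := exp (- (PI ^ 2 * Re (/ z)))).
  assert (Hrho : 0 < rho < 1).
  { unfold rho; split; [apply exp_pos|]. rewrite <- exp_0. apply exp_increasing. lra. }
  destruct (rsum_arith_geom_bound rho Hrho) as [B [HB0 HB]].
  assert (Hc : 0 <= 4 * PI ^ 2 / Cmod z).
  { apply Rmult_le_pos; [|left; apply Rinv_0_lt_compat; easy]. generalize (pow_lt PI 2 HPI); lra. }
  exists (4 * PI ^ 2 / Cmod z * B). split; [apply Rmult_le_pos; easy|].
  intros N HN eps Heps.
  assert (HN0 : 0 < INR N) by (apply lt_0_INR; easy).
  assert (HNC : RtoC (INR N) <> 0) by (intros H; apply RtoC_inj in H; lra).
  set (delta := fun l L : nat => 2 * (exp (INR l ^ 2 * Re z) * (Cmod z / PI)) * INR l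
      * exp (- (PI ^ 2 * Re (/ z) * INR L ^ 2))).
  assert (Hdelta : forall l, is_lim_seq (delta l) 0).
  { intros l. apply lim_seq_scal0. apply lim_exp_quadratic_decay. easy. }
  set (D := fun L => / INR N * rsum (fun j => 2 * rsum (fun l => delta l L) (S j)) N).
  assert (HD : is_lim_seq D 0).
  { apply lim_seq_scal0. apply (lim_seq_rsum0 (fun j L => 2 * rsum (fun l => delta l L) (S j))).
    intros j _. apply lim_seq_scal0. apply lim_seq_rsum0. auto. }
  apply is_lim_seq_spec in HD. destruct (HD (mkposreal eps Heps)) as [L0 HL0]. simpl in HL0.
  exists L0. intros L HL. specialize (HL0 L HL).
  set (X := CInt (fun s => gauss z s * RtoC (fejer N (s - (INR 0 + 1 / 2))))%C 0 (INR L)).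
  assert (H1 : Cmod (X - theta_cesaro (cexp (- z)) N * CInt (gauss z) 0 (INR L))%C <= D L).
  { unfold X. rewrite CInt_gauss_fejer by easy. unfold theta_cesaro, theta_partial, D.
    rewrite gauss_cos_0.
    set (J := CInt (gauss z) 0 (INR L)).
    match goal with |- Cmod ?x <= _ => replace x with
      (/ RtoC (INR N) * csum (fun j => 2 * csum (fun l =>
          (- (1)) ^ l * (gauss_cos z (INR L) (INR l) - cexp (- (RtoC (INR l ^ 2) * z)) * J)) (S j)) N)%C end.
    - rewrite Cmod_mult, Cmod_inv, Cmod_R, Rabs_right by (easy || lra).
      apply Rmult_le_compat_l; [left; apply Rinv_0_lt_compat; easy|].
      apply Cmod_csum_le. intros j _. rewrite Cmod_mult, Cmod_R, Rabs_right by lra.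
      apply Rmult_le_compat_l; [lra|]. apply Cmod_csum_le. intros l _.
      rewrite Cmod_mult, Cmod_minus_one_pow, Rmult_1_l.
      apply gauss_cos_transform; [easy|apply pos_INR].
    - transitivity (/ RtoC (INR N) * (csum (fun j => 2 * csum (fun l => (- (1)) ^ l * gauss_cos z (INR L) (INR l)) (S j) - J)
        N - J * csum (fun j => 2 * csum (theta_term (cexp (- z))) (S j) - 1) N))%C; [|ring].
      f_equal. rewrite <- csum_scal, <- csum_minus. apply csum_ext. intros j _.
      rewrite (csum_ext _ (fun l => (- (1)) ^ l * gauss_cos z (INR L) (INR l)
         - J * theta_term (cexp (- z)) l)%C (S j)).
      + rewrite csum_minus, csum_scal. ring.
      + intros l _. rewrite theta_term_cexp. ring. }
  assert (CF : forall c, Ccont (fun s => gauss z s * RtoC (fejer N (s - c)))%C).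
  { intros c. apply Ccont_mult; [apply Ccont_gauss|]. apply Ccont_RtoC. intros; apply continuous_fejer. }
  assert (H2 : Cmod (X - csum (fun k => gauss z (INR k + 1 / 2)) L)%C <= 4 * PI ^ 2 / Cmod z * B * / sqrt (INR N)).
  { unfold X. rewrite CInt_pieces by apply CF. rewrite <- csum_minus.
    assert (Hs : 0 < / sqrt (INR N)) by (apply Rinv_0_lt_compat, sqrt_lt_R0; easy).
    eapply Rle_trans.
    - apply Cmod_csum_le with (v := fun k => / sqrt (INR N) * (4 * PI ^ 2 / Cmod z * ((INR k + 1) * rho ^ k))).
      intros k _. rewrite Rmult_comm.
      rewrite (CInt_ext _ (fun s => gauss z s * RtoC (fejer N (s - (INR k + 1 / 2))))%C)
        by (intros s; rewrite !fejer_shift; easy).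
      set (c := INR k + 1 / 2).
      replace (INR k) with (c - 1 / 2) at 1 by (unfold c; ring).
      replace (INR k + 1) with (c + 1 / 2) at 1 by (unfold c; field).
      apply fejer_approximation; [easy|apply Ccont_gauss| |].
      + apply Rmult_le_pos; [easy|]. apply Rmult_le_pos; [generalize (pos_INR k); lra|].
        apply pow_le; lra.
      + intros x Hx. apply gauss_lipschitz; [easy|]. unfold c in Hx; lra.
    - rewrite rsum_scal, rsum_scal. specialize (HB L).
      apply Rle_trans with (/ sqrt (INR N) * (4 * PI ^ 2 / Cmod z * B)); [|right; ring].
      apply Rmult_le_compat_l; [lra|]. apply Rmult_le_compat_l; easy. }
  match goal with |- Cmod ?x <= _ => replace x with
     ((X - csum (fun k => gauss z (INR k + 1 / 2)%R) L) -
      (X - theta_cesaro (cexp (- z)) N * CInt (gauss z) 0 (INR L)))%C by ring end.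
  unfold Cminus at 1. eapply Rle_trans; [apply Cmod_triangle|]. rewrite Cmod_opp.
  apply Rabs_lt_between in HL0. lra.
Qed.

(** * Generating function of overpartitions *)

(** The condition that [ovp_ok] imposes on the list after a part [K], isolated so that tails can be
    enumerated separately. *)
Definition may_follow (K : nat) (l : list (nat * bool)) : bool :=
  match l with
  | [] => true
  | (a, b) :: _ => (a <=? K)%nat && (negb (a =? K)%nat || negb b)
  end.

Definition head_at_most (K : nat) (l : list (nat * bool)) : bool :=
  match l with [] => true | (a, _) :: _ => (a <=? K)%nat end.

Fixpoint ovp_tail_enum (prev : nat -> list (list (nat * bool))) (K fuel n : nat) :=
  prev n ++
  match fuel with
  | O => []
  | S f => if (K <=? n)%nat then map (cons (K, false)) (ovp_tail_enum prev K f (n - K)) else []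
  end.

(* [ovp_enum K n] lists the overpartitions of [n] with parts at most [K];
   [ovp_tail_enum (ovp_enum k) (S k) n n] those that may moreover follow a part [S k]. *)
Fixpoint ovp_enum (K n : nat) : list (list (nat * bool)) :=
  match K with
  | O => if (n =? 0)%nat then [[]] else []
  | S k => ovp_enum k n ++
      if (S k <=? n)%nat then
        map (cons (S k, false)) (ovp_tail_enum (ovp_enum k) (S k) n (n - S k)) ++
        map (cons (S k, true)) (ovp_tail_enum (ovp_enum k) (S k) n (n - S k))
      else []
  end.

Lemma ovp_ok_cons a c rest :
  ovp_ok ((a, c) :: rest) = (0 <? a)%nat && may_follow a rest && ovp_ok rest.
Proof. destruct rest as [|[a' b'] rest]; easy. Qed.

Lemma ovp_sum_cons a c rest : ovp_sum ((a, c) :: rest) = (a + ovp_sum rest)%nat.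
Proof. easy. Qed.

Lemma may_follow_S k l : may_follow (S k) l = true <->
  head_at_most k l = true \/ exists rest, l = (S k, false) :: rest.
Proof.
  destruct l as [|[a b] rest]; simpl.
  - split; auto.
  - rewrite andb_true_iff, orb_true_iff, !negb_true_iff, !Nat.leb_le, Nat.eqb_neq.
    split.
    + intros [H1 [H2|H2]]; [left; lia|].
      destruct (Nat.eq_dec a (S k)) as [->|Hne]; [right; subst b; eauto|left; lia].
    + intros [H|[r H]]; [lia|]. injection H; intros; subst. split; [lia|auto].
Qed.

Lemma head_at_most_S k l : head_at_most (S k) l = true <->
  head_at_most k l = true \/ exists c rest, l = (S k, c) :: rest.
Proof.
  destruct l as [|[a b] rest]; simpl; [split; auto|].
  rewrite !Nat.leb_le. split.
  - intros H. destruct (Nat.eq_dec a (S k)) as [->|Hne]; [right; eauto|left; lia].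
  - intros [H|[c [r H]]]; [lia|]. injection H; intros; subst; lia.
Qed.

Lemma in_map_cons {X} (a : X) s l : In l (map (cons a) s) <-> exists r, l = a :: r /\ In r s.
Proof.
  rewrite in_map_iff. split; intros [r [H1 H2]]; exists r; subst; auto.
Qed.

Lemma in_ovp_tail_enum k :
  (forall n l, In l (ovp_enum k n) <-> ovp_ok l = true /\ ovp_sum l = n /\ head_at_most k l = true) ->
  forall fuel n l, (n <= fuel)%nat ->
  (In l (ovp_tail_enum (ovp_enum k) (S k) fuel n) <->
   ovp_ok l = true /\ ovp_sum l = n /\ may_follow (S k) l = true).
Proof.
  intros Hk. induction fuel as [|f IH]; intros n l Hn; cbn [ovp_tail_enum].
  - rewrite app_nil_r, Hk, may_follow_S. split; [tauto|].
    intros [H1 [H2 [H3|[r ->]]]]; [tauto|]. rewrite ovp_sum_cons in H2. lia.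
  - rewrite in_app_iff, Hk, may_follow_S.
    destruct (Nat.leb_spec (S k) n) as [Hle|Hlt].
    + rewrite in_map_cons. split.
      * intros [H|[r [-> Hr]]]; [tauto|]. apply IH in Hr; [|lia].
        rewrite ovp_ok_cons, ovp_sum_cons. destruct Hr as [H1 [H2 H3]].
        rewrite H1, H3. repeat split; [lia|right; eauto].
      * intros [H1 [H2 [H3|[r ->]]]]; [tauto|]. right. exists r; split; auto.
        rewrite ovp_ok_cons, !andb_true_iff in H1. rewrite ovp_sum_cons in H2.
        apply IH; [lia|]. repeat split; [tauto|lia|tauto].
    + split; [intros [H|[]]; tauto|].
      intros [H1 [H2 [H3|[r ->]]]]; [tauto|]. rewrite ovp_sum_cons in H2. lia.
Qed.

Lemma in_ovp_enum K : forall n l,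
  In l (ovp_enum K n) <-> ovp_ok l = true /\ ovp_sum l = n /\ head_at_most K l = true.
Proof.
  induction K as [|k IH]; intros n l; cbn [ovp_enum].
  - split.
    + destruct (Nat.eqb_spec n 0); [intros [<-|[]]; subst; auto|intros []].
    + intros [H1 [H2 H3]]. destruct l as [|[a c] r].
      * simpl in H2. subst n. simpl. auto.
      * rewrite ovp_ok_cons, !andb_true_iff, Nat.ltb_lt in H1. simpl in H3.
        apply Nat.leb_le in H3. lia.
  - rewrite in_app_iff, IH, head_at_most_S.
    destruct (Nat.leb_spec (S k) n) as [Hle|Hlt].
    + rewrite in_app_iff, !in_map_cons.
      assert (Ht := in_ovp_tail_enum k IH n (n - S k)).
      split.
      * intros [H|[[r [-> Hr]]|[r [-> Hr]]]]; [tauto| |];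
        (apply Ht in Hr; [|lia]; rewrite ovp_ok_cons, ovp_sum_cons;
         destruct Hr as [H1 [H2 H3]]; rewrite H1, H3; repeat split; [lia|right; eauto]).
      * intros [H1 [H2 [H3|[c [r ->]]]]]; [tauto|]. right.
        rewrite ovp_ok_cons, !andb_true_iff in H1. rewrite ovp_sum_cons in H2.
        assert (In r (ovp_tail_enum (ovp_enum k) (S k) n (n - S k))).
        { apply Ht; [lia|]. repeat split; [tauto|lia|tauto]. }
        destruct c; [right|left]; eauto.
    + split; [intros [H|[]]; tauto|].
      intros [H1 [H2 [H3|[c [r ->]]]]]; [tauto|]. rewrite ovp_sum_cons in H2. lia.
Qed.

Lemma NoDup_map_cons {X} (a : X) s : NoDup s -> NoDup (map (cons a) s).
Proof.
  intros H. induction H as [|x s Hx Hs IH]; simpl; constructor; auto.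
  intros Hin. apply in_map_cons in Hin. destruct Hin as [r [E Hr]].
  injection E; intros; subst; easy.
Qed.

Lemma NoDup_app_disjoint {X} (s t : list X) :
  NoDup s -> NoDup t -> (forall x, In x s -> In x t -> False) -> NoDup (s ++ t).
Proof.
  induction s as [|a s IH]; intros Hs Ht Hd; simpl; [easy|].
  inversion Hs; subst. constructor.
  - rewrite in_app_iff. intros [H|H]; [easy|]. apply (Hd a); simpl; auto.
  - apply IH; auto. intros x Hx. apply Hd; simpl; auto.
Qed.

Lemma NoDup_ovp_tail_enum k : (forall n, NoDup (ovp_enum k n)) ->
  forall fuel n, NoDup (ovp_tail_enum (ovp_enum k) (S k) fuel n).
Proof.
  intros Hk. induction fuel as [|f IH]; intros n; cbn [ovp_tail_enum].
  - rewrite app_nil_r; auto.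
  - apply NoDup_app_disjoint; auto.
    + destruct (S k <=? n)%nat; [apply NoDup_map_cons; auto|constructor].
    + intros x Hx Hx2. apply in_ovp_enum in Hx. destruct (S k <=? n)%nat; [|easy].
      apply in_map_cons in Hx2. destruct Hx2 as [r [-> _]]. destruct Hx as [_ [_ H]].
      change ((S k <=? k)%nat = true) in H. apply Nat.leb_le in H. lia.
Qed.

Lemma NoDup_ovp_enum K : forall n, NoDup (ovp_enum K n).
Proof.
  induction K as [|k IH]; intros n; cbn [ovp_enum].
  - destruct (n =? 0)%nat; repeat constructor; auto.
  - apply NoDup_app_disjoint; auto.
    + destruct (S k <=? n)%nat; [|constructor].
      apply NoDup_app_disjoint; try (apply NoDup_map_cons, NoDup_ovp_tail_enum; auto).
      intros x Hx Hy. apply in_map_cons in Hx, Hy.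
      destruct Hx as [r [-> _]], Hy as [r' [E _]]. discriminate.
    + intros x Hx Hx2. apply in_ovp_enum in Hx. destruct (S k <=? n)%nat; [|easy].
      destruct Hx as [_ [_ H]].
      apply in_app_iff in Hx2. destruct Hx2 as [Hx2|Hx2]; apply in_map_cons in Hx2;
      destruct Hx2 as [r [-> _]]; change ((S k <=? k)%nat = true) in H; apply Nat.leb_le in H; lia.
Qed.

(** * Agreement with the enumeration that defines [pbar] *)

Lemma in_words {X} (A : list X) k : forall l,
  In l (words k A) <-> (length l <= k)%nat /\ (forall x, In x l -> In x A).
Proof.
  induction k as [|k IH]; intros l; simpl.
  - split.
    + intros [<-|[]]; simpl; split; [lia|tauto].
    + intros [H _]. destruct l; [auto|simpl in H; lia].
  - rewrite in_flat_map. split.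
    + intros [<-|[a [Ha Hl]]]; [simpl; split; [lia|tauto]|].
      apply in_map_cons in Hl. destruct Hl as [r [-> Hr]]. apply IH in Hr.
      simpl. split; [lia|]. intros x [<-|Hx]; [easy|]. apply Hr; easy.
    + intros [H1 H2]. destruct l as [|a r]; [auto|]. right.
      exists a. split; [apply H2; simpl; auto|]. apply in_map_cons. exists r; split; [easy|].
      apply IH. simpl in H1. split; [lia|]. intros; apply H2; simpl; auto.
Qed.

Lemma NoDup_words {X} (A : list X) k : NoDup A -> NoDup (words k A).
Proof.
  intros HA. induction k as [|k IH]; simpl; [repeat constructor; auto|].
  constructor.
  - rewrite in_flat_map. intros [a [_ H]]. apply in_map_cons in H.
    destruct H as [r [E _]]; discriminate.
  - clear -HA IH. generalize (words k A) IH. intros W HW. clear IH.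
    induction HA as [|a A Ha HA IHA]; simpl; [constructor|].
    apply NoDup_app_disjoint; [apply NoDup_map_cons; easy|easy|].
    intros x Hx Hy. apply in_map_cons in Hx. apply in_flat_map in Hy.
    destruct Hx as [r [-> _]], Hy as [b [Hb Hy]]. apply in_map_cons in Hy.
    destruct Hy as [r' [E _]]. injection E; intros; subst; easy.
Qed.

Lemma NoDup_alphabet n : NoDup (list_prod (seq 1 n) [true; false]).
Proof.
  generalize (seq 1 n) (seq_NoDup n 1). intros s Hs.
  induction Hs as [|a s Ha Hs IH]; simpl; [constructor|].
  assert (Hn : forall b, ~ In (a, b) (list_prod s [true; false])).
  { intros b H. apply in_prod_iff in H. tauto. }
  constructor; [intros [H|H]; [discriminate|apply (Hn true); easy]|].
  constructor; [apply Hn|easy].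
Qed.

Lemma ovp_ok_parts l : ovp_ok l = true ->
  (length l <= ovp_sum l)%nat /\ (forall x, In x l -> (1 <= fst x <= ovp_sum l)%nat).
Proof.
  induction l as [|[a c] r IH]; [simpl; split; [lia|tauto]|].
  rewrite ovp_ok_cons, !andb_true_iff, Nat.ltb_lt, ovp_sum_cons. intros [[H1 _] H2].
  destruct (IH H2) as [H3 H4]. split; [simpl; lia|].
  intros x [<-|Hx]; [simpl; lia|]. specialize (H4 x Hx). lia.
Qed.

Lemma head_at_most_sum l n : ovp_ok l = true -> ovp_sum l = n -> head_at_most n l = true.
Proof.
  intros H1 H2. destruct l as [|[a c] r]; [easy|]. simpl. apply Nat.leb_le.
  rewrite ovp_sum_cons in H2. lia.
Qed.

Definition pbar_parts (K n : nat) : nat := length (ovp_enum K n).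

(** Two duplicate-free lists with the same members have the same length; a part of an overpartition
    of [n] never exceeds [n], so the bound on the head is automatic. *)
Lemma pbar_pbar_parts n : pbar n = pbar_parts n n.
Proof.
  unfold pbar, pbar_parts, overpartitions.
  assert (Hin : forall l, In l (filter (is_overpartition n) (words n (list_prod (seq 1 n) [true; false])))
    <-> In l (ovp_enum n n)).
  { intros l. rewrite filter_In, in_words, in_ovp_enum. unfold is_overpartition.
    rewrite andb_true_iff, Nat.eqb_eq. split.
    - intros [_ [H1 H2]]. repeat split; auto. apply head_at_most_sum; auto.
    - intros [H1 [H2 _]]. repeat split; auto; destruct (ovp_ok_parts l H1) as [H3 H4]; [lia|].
      intros [a c] Hx. specialize (H4 _ Hx). simpl in H4. apply in_prod_iff.
      rewrite in_seq. split; [lia|]. destruct c; simpl; auto. }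
  apply Nat.le_antisymm; apply NoDup_incl_length.
  - apply NoDup_filter, NoDup_words, NoDup_alphabet.
  - intros l. apply Hin.
  - apply NoDup_ovp_enum.
  - intros l. apply Hin.
Qed.

Lemma ovp_tail_enum_fuel prev k f : forall f' n, (n <= f)%nat -> (n <= f')%nat ->
  ovp_tail_enum prev (S k) f n = ovp_tail_enum prev (S k) f' n.
Proof.
  induction f as [|f IH]; intros f' n H H'.
  - destruct f' as [|f']; [easy|]. cbn [ovp_tail_enum].
    destruct (Nat.leb_spec (S k) n); [lia|easy].
  - destruct f' as [|f']; cbn [ovp_tail_enum]; destruct (Nat.leb_spec (S k) n); try lia; try easy.
    rewrite (IH f'); [easy|lia|lia].
Qed.

Lemma pbar_parts_0 n : pbar_parts 0 n = if (n =? 0)%nat then 1%nat else 0%nat.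
Proof. unfold pbar_parts. simpl. destruct (n =? 0)%nat; easy. Qed.

(** The coefficient form of [A_(k+1) (1 - q^(k+1)) = A_k (1 + q^(k+1))]. Let [b] count the tails
    allowed after a part [S k]. A first part [S k], overlined or not, gives
    [A_(k+1)(n) = A_k(n) + 2 b(n - S k)], and [b(m) = A_k(m) + b(m - S k)]; eliminating [b] leaves
    the recurrence. *)
Lemma pbar_parts_S k n : pbar_parts (S k) n =
  (pbar_parts k n + if (S k <=? n)%nat then pbar_parts (S k) (n - S k) + pbar_parts k (n - S k) else 0)%nat.
Proof.
  set (b := fun m => length (ovp_tail_enum (ovp_enum k) (S k) m m)).
  assert (Hb : forall m, b m = (pbar_parts k m + if (S k <=? m)%nat then b (m - S k)%nat else 0)%nat).
  { intros m. unfold b at 1. destruct m as [|m]; cbn [ovp_tail_enum].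
    - rewrite app_nil_r. destruct (Nat.leb_spec (S k) 0); [lia|]. unfold pbar_parts. lia.
    - rewrite length_app. unfold pbar_parts. f_equal.
      destruct (Nat.leb_spec (S k) (S m)); [|easy]. rewrite length_map. unfold b. f_equal.
      apply ovp_tail_enum_fuel; lia. }
  assert (Ha : forall m, pbar_parts (S k) m =
     (pbar_parts k m + if (S k <=? m)%nat then 2 * b (m - S k)%nat else 0)%nat).
  { intros m. unfold pbar_parts. cbn [ovp_enum]. rewrite length_app. f_equal.
    destruct (Nat.leb_spec (S k) m); [|easy].
    rewrite length_app, !length_map. unfold b.
    rewrite (ovp_tail_enum_fuel _ k m (m - S k) (m - S k)) by lia. lia. }
  rewrite Ha. destruct (Nat.leb_spec (S k) n); [|easy].
  rewrite (Ha (n - S k)%nat), (Hb (n - S k)%nat).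
  destruct (S k <=? n - S k)%nat; lia.
Qed.

Lemma pbar_parts_stable K n : (n <= K)%nat -> pbar_parts K n = pbar n.
Proof.
  rewrite pbar_pbar_parts. induction 1 as [|K HK IH]; [easy|].
  rewrite pbar_parts_S. destruct (Nat.leb_spec (S K) n); lia.
Qed.

Lemma pbar_parts_monotone K K' n : (K <= K')%nat -> (pbar_parts K n <= pbar_parts K' n)%nat.
Proof. induction 1; [easy|]. rewrite pbar_parts_S. lia. Qed.

Lemma pbar_parts_le K n : (pbar_parts K n <= pbar n)%nat.
Proof.
  rewrite <- (pbar_parts_stable (Nat.max K n) n) by lia. apply pbar_parts_monotone; lia.
Qed.

(** * The product expansion of the generating function *)

Fixpoint ovp_prod (N : nat) (q : C) : C :=
  match N with
  | O => 1
  | S k => (ovp_prod k q * ((1 + q ^ S k) / (1 - q ^ S k)))%C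
  end.

Fixpoint ovp_prod_R (N : nat) (x : R) : R :=
  match N with
  | O => 1
  | S k => ovp_prod_R k x * ((1 + x ^ S k) / (1 - x ^ S k))
  end.

Lemma pow_S_lt_1 x k : 0 <= x < 1 -> 0 <= x ^ S k <= x /\ x ^ S k < 1.
Proof.
  intros H. assert (0 <= x ^ k <= 1).
  { split; [apply pow_le; lra|]. rewrite <- (pow1 k). apply pow_incr; lra. }
  simpl. split; [split|]; nra.
Qed.

Lemma one_minus_pow_nz q k : Cmod q < 1 -> (1 - q ^ S k <> 0)%C.
Proof.
  intros H E. assert (H1 : Cmod (q ^ S k) = 1).
  { replace (q ^ S k)%C with (1 - (1 - q ^ S k))%C by ring. rewrite E.
    replace (1 - 0)%C with (RtoC 1) by ring. apply Cmod_1. }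
  rewrite Cmod_pow in H1.
  destruct (pow_S_lt_1 (Cmod q) k); [|lra]. split; [apply Cmod_ge_0|easy].
Qed.

Lemma one_plus_pow_nz q k : Cmod q < 1 -> (1 + q ^ S k <> 0)%C.
Proof.
  intros H E. assert (H1 : Cmod (q ^ S k) = 1).
  { replace (q ^ S k)%C with (- (1 - (1 + q ^ S k)))%C by ring. rewrite E.
    replace (- (1 - 0))%C with (- (1))%C by ring. apply Cmod_m1. }
  rewrite Cmod_pow in H1.
  destruct (pow_S_lt_1 (Cmod q) k); [|lra]. split; [apply Cmod_ge_0|easy].
Qed.

Lemma one_plus_pow_lower q k : Cmod q < 1 -> 1 - Cmod q <= Cmod (1 + q ^ S k).
Proof.
  intros H. destruct (pow_S_lt_1 (Cmod q) k) as [H1 _]; [split; [apply Cmod_ge_0|easy]|].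
  assert (H2 := Cmod_le_plus_diff 1 (1 + q ^ S k)).
  replace (1 - (1 + q ^ S k))%C with (- q ^ S k)%C in H2 by ring.
  rewrite Cmod_1, Cmod_opp, Cmod_pow in H2. lra.
Qed.

Lemma ovp_prod_R_pos x N : 0 <= x < 1 -> 1 <= ovp_prod_R N x.
Proof.
  intros Hx; induction N as [|k IH]; cbn [ovp_prod_R]; [lra|].
  destruct (pow_S_lt_1 x k Hx) as [H1 H2].
  assert (1 <= (1 + x ^ S k) / (1 - x ^ S k)).
  { apply Rmult_le_reg_r with (1 - x ^ S k); [lra|]. unfold Rdiv.
    rewrite Rmult_assoc, Rinv_l by lra. lra. }
  nra.
Qed.

Lemma rsum_geom_le x n : 0 <= x < 1 -> rsum (fun k => x ^ k) n <= / (1 - x).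
Proof.
  intros Hx. assert (H : rsum (fun k => x ^ k) n = (1 - x ^ n) / (1 - x)).
  { induction n as [|n IH]; simpl; [field; lra|]. rewrite IH. field. lra. }
  rewrite H. unfold Rdiv. rewrite <- (Rmult_1_l (/ (1 - x))) at 2.
  apply Rmult_le_compat_r; [left; apply Rinv_0_lt_compat; lra|].
  assert (0 <= x ^ n) by (apply pow_le; lra). lra.
Qed.

Lemma ovp_prod_R_bounded x : 0 <= x < 1 -> exists B, forall N, ovp_prod_R N x <= B.
Proof.
  intros Hx. exists (exp (2 / (1 - x) * / (1 - x))).
  assert (H0 : 0 < / (1 - x)) by (apply Rinv_0_lt_compat; lra).
  assert (H : forall N, ovp_prod_R N x <= exp (2 / (1 - x) * rsum (fun k => x ^ S k) N)).
  { induction N as [|k IH]; cbn [ovp_prod_R rsum].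
    - rewrite Rmult_0_r, exp_0. lra.
    - rewrite Rmult_plus_distr_l, exp_plus.
      destruct (pow_S_lt_1 x k Hx) as [H1 H2].
      assert (Hp := ovp_prod_R_pos x k Hx).
      assert (H3 : 0 <= (1 + x ^ S k) / (1 - x ^ S k) <= exp (2 / (1 - x) * x ^ S k)).
      { split; [apply Rmult_le_pos; [lra|left; apply Rinv_0_lt_compat; lra]|].
        eapply Rle_trans; [|apply exp_ineq1_le].
        replace ((1 + x ^ S k) / (1 - x ^ S k)) with (1 + 2 * x ^ S k * / (1 - x ^ S k)) by (field; lra).
        apply Rplus_le_compat_l. replace (2 / (1 - x) * x ^ S k) with (2 * x ^ S k * / (1 - x)) by (field; lra).
        apply Rmult_le_compat_l; [lra|]. apply Rinv_le_contravar; lra. }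
      apply Rmult_le_compat; lra. }
  intros N. eapply Rle_trans; [apply H|].
  assert (2 / (1 - x) * rsum (fun k => x ^ S k) N <= 2 / (1 - x) * / (1 - x)) as [K|K].
  { apply Rmult_le_compat_l; [unfold Rdiv; lra|].
    eapply Rle_trans; [|apply (rsum_geom_le x (S N) Hx)]. rewrite rsum_split_first. simpl. lra. }
  - left; apply exp_increasing; exact K.
  - rewrite K; lra.
Qed.

Lemma Cmod_ovp_prod_le q N : Cmod q < 1 -> Cmod (ovp_prod N q) <= ovp_prod_R N (Cmod q).
Proof.
  intros Hq. assert (Hq0 := Cmod_ge_0 q). induction N as [|k IH]; cbn [ovp_prod ovp_prod_R].
  - rewrite Cmod_1; lra.
  - rewrite Cmod_mult, Cmod_div by (apply one_minus_pow_nz; easy).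
    destruct (pow_S_lt_1 (Cmod q) k) as [H1 H2]; [lra|].
    apply Rmult_le_compat; [apply Cmod_ge_0| |easy|].
    + apply Rmult_le_pos; [apply Cmod_ge_0|]. left. apply Rinv_0_lt_compat, Cmod_gt_0, one_minus_pow_nz; easy.
    + assert (Ha : Cmod (1 + q ^ S k) <= 1 + Cmod q ^ S k).
      { rewrite <- Cmod_pow. rewrite <- Cmod_1 at 2. apply Cmod_triangle. }
      assert (Hb : 1 - Cmod q ^ S k <= Cmod (1 - q ^ S k)).
      { assert (H3 := Cmod_le_plus_diff 1 (1 - q ^ S k)).
        replace (1 - (1 - q ^ S k))%C with (q ^ S k)%C in H3 by ring.
        rewrite Cmod_1, Cmod_pow in H3. lra. }
      apply Rmult_le_compat; [apply Cmod_ge_0|left; apply Rinv_0_lt_compat; lra|easy|].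
      apply Rinv_le_contravar; lra.
Qed.

Lemma rsum_delay (a : nat -> R) x d M :
  rsum (fun m => (if (d <=? m)%nat then a (m - d)%nat else 0) * x ^ m) M =
  x ^ d * rsum (fun m => a m * x ^ m) (M - d).
Proof.
  induction M as [|M IH]; [simpl; ring|]. cbn [rsum]. rewrite IH.
  destruct (Nat.leb_spec d M) as [H|H].
  - replace (S M - d)%nat with (S (M - d)) by lia. cbn [rsum].
    replace (x ^ M) with (x ^ d * x ^ (M - d)) by (rewrite <- pow_add; f_equal; lia). ring.
  - replace (S M - d)%nat with O by lia. replace (M - d)%nat with O by lia. simpl. ring.
Qed.

Lemma csum_delay (a : nat -> C) x d M :
  csum (fun m => (if (d <=? m)%nat then a (m - d)%nat else 0) * x ^ m)%C M =
  (x ^ d * csum (fun m => a m * x ^ m)%C (M - d))%C.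
Proof.
  induction M as [|M IH]; [simpl; ring|]. cbn [csum]. rewrite IH.
  destruct (Nat.leb_spec d M) as [H|H].
  - replace (S M - d)%nat with (S (M - d)) by lia. cbn [csum].
    replace (x ^ M)%C with (x ^ d * x ^ (M - d))%C by (rewrite <- Cpow_add_r; f_equal; lia). ring.
  - replace (S M - d)%nat with O by lia. replace (M - d)%nat with O by lia. simpl. ring.
Qed.

Lemma INR_pbar_parts_S k m : INR (pbar_parts (S k) m) = INR (pbar_parts k m) +
  (if (S k <=? m)%nat then INR (pbar_parts (S k) (m - S k)) + INR (pbar_parts k (m - S k)) else 0).
Proof.
  rewrite pbar_parts_S. destruct (S k <=? m)%nat; rewrite !plus_INR; simpl; lra.
Qed.

(** The recurrence bounds a partial sum by itself with the factor [x ^ S k < 1], plus known terms;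
    solving this inequality gives the next factor of the product. *)
Lemma pbar_parts_rsum_le x K : 0 <= x < 1 -> forall M,
  rsum (fun m => INR (pbar_parts K m) * x ^ m) M <= ovp_prod_R K x.
Proof.
  intros Hx. induction K as [|k IH]; intros M.
  - cbn [ovp_prod_R]. destruct M as [|M]; [simpl; lra|].
    rewrite rsum_split_first.
    rewrite (rsum_ext _ (fun _ => 0 * 0)), rsum_scal.
    + rewrite pbar_parts_0. simpl. lra.
    + intros i _. rewrite pbar_parts_0. simpl. ring.
  - set (X := fun K M => rsum (fun m => INR (pbar_parts K m) * x ^ m) M) in *.
    destruct (pow_S_lt_1 x k Hx) as [H1 H2].
    assert (Hmono : forall K n m, (n <= m)%nat -> X K n <= X K m).
    { intros K n m Hnm. apply rsum_le_length; [|easy]. intros i.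
      apply Rmult_le_pos; [apply pos_INR|apply pow_le; lra]. }
    assert (Hrec : X (S k) M = X k M + x ^ S k * (X (S k) (M - S k)%nat + X k (M - S k)%nat)).
    { unfold X. rewrite <- rsum_plus.
      rewrite (rsum_ext (fun i => INR (pbar_parts (S k) i) * x ^ i + INR (pbar_parts k i) * x ^ i)
         (fun i => (INR (pbar_parts (S k) i) + INR (pbar_parts k i)) * x ^ i)) by (intros; ring).
      rewrite <- (rsum_delay (fun i => INR (pbar_parts (S k) i) + INR (pbar_parts k i))).
      rewrite <- rsum_plus. apply rsum_ext. intros i _. rewrite INR_pbar_parts_S. ring. }
    assert (Hle : X (S k) M <= X k M + x ^ S k * (X (S k) M + X k M)).
    { rewrite Hrec at 1. apply Rplus_le_compat_l, Rmult_le_compat_l; [lra|].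
      apply Rplus_le_compat; apply Hmono; lia. }
    assert (HXk := IH M). change (X k M <= ovp_prod_R k x) in HXk.
    change (X (S k) M <= ovp_prod_R (S k) x). cbn [ovp_prod_R].
    apply Rmult_le_reg_r with (1 - x ^ S k); [lra|].
    replace (ovp_prod_R k x * ((1 + x ^ S k) / (1 - x ^ S k)) * (1 - x ^ S k)) with
      (ovp_prod_R k x * (1 + x ^ S k)) by (field; lra).
    nra.
Qed.

Lemma pbar_parts_series q K : Cmod q < 1 ->
  Clim (csum (fun m => RtoC (INR (pbar_parts K m)) * q ^ m)%C) (ovp_prod K q).
Proof.
  intros Hq. assert (Hq0 := Cmod_ge_0 q).
  assert (Hex : forall K, exists l, Clim (csum (fun m => RtoC (INR (pbar_parts K m)) * q ^ m)%C) l).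
  { intros k. apply csum_dominated_cv with (v := fun m => INR (pbar_parts k m) * Cmod q ^ m)
      (B := ovp_prod_R k (Cmod q)).
    - intros i. rewrite Cmod_mult, Cmod_R, Cmod_pow, Rabs_right; [lra|apply Rle_ge, pos_INR].
    - apply pbar_parts_rsum_le; lra. }
  induction K as [|k IH].
  - apply Clim_of_zero_diff with (fun _ => RtoC 1); [apply Clim_const|].
    apply lim_seq_dominated_eventually with (fun _ => 0) 1%nat; [|apply is_lim_seq_const].
    intros n Hn. destruct n as [|n]; [lia|]. rewrite csum_split_first.
    rewrite (csum_ext _ (fun _ => 0 * 0)%C), csum_scal.
    + rewrite pbar_parts_0. simpl.
      match goal with |- 0 <= Cmod ?u <= 0 => replace u with (RtoC 0) by ring end. rewrite Cmod_0; lra.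
    + intros i _. rewrite pbar_parts_0. simpl. ring.
  - destruct (Hex (S k)) as [l Hl].
    assert (Hnz := one_minus_pow_nz q k Hq).
    replace (ovp_prod (S k) q) with l; [easy|].
    assert (E : l = (ovp_prod k q + q ^ S k * (l + ovp_prod k q))%C).
    { apply (Clim_unique (fun M => csum (fun m => RtoC (INR (pbar_parts (S k) m)) * q ^ m)%C (M + S k))).
      - apply Clim_shift; easy.
      - apply Clim_ext with (fun M => csum (fun m => RtoC (INR (pbar_parts k m)) * q ^ m) (M + S k) +
           q ^ S k * (csum (fun m => RtoC (INR (pbar_parts (S k) m)) * q ^ m) M +
             csum (fun m => RtoC (INR (pbar_parts k m)) * q ^ m) M))%C.
        + intros M. rewrite <- csum_plus.
          rewrite (csum_ext (fun i => RtoC (INR (pbar_parts (S k) i)) * q ^ i + RtoC (INR (pbar_parts k i)) * q ^ i)%C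
            (fun i => RtoC (INR (pbar_parts (S k) i) + INR (pbar_parts k i)) * q ^ i)%C)
            by (intros; rewrite RtoC_plus; ring).
          replace M with (M + S k - S k)%nat at 2 by lia.
          rewrite <- (csum_delay (fun i => RtoC (INR (pbar_parts (S k) i) + INR (pbar_parts k i)))).
          rewrite <- csum_plus. apply csum_ext. intros i _. rewrite (INR_pbar_parts_S k i).
          destruct (S k <=? i)%nat; rewrite ?RtoC_plus; ring.
        + apply Clim_plus; [apply Clim_shift; easy|]. apply Clim_scal, Clim_plus; easy. }
    cbn [ovp_prod].
    assert (E2 : (l * (1 - q ^ S k) = ovp_prod k q * (1 + q ^ S k))%C).
    { transitivity (l - q ^ S k * l)%C; [ring|]. rewrite E at 1. ring. }
    transitivity (l * (1 - q ^ S k) / (1 - q ^ S k))%C; [field; easy|]. rewrite E2. field. easy.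
Qed.

Lemma pbar_rsum_bounded x : 0 <= x < 1 ->
  exists B, forall M, rsum (fun m => INR (pbar m) * x ^ m) M <= B.
Proof.
  intros Hx. destruct (ovp_prod_R_bounded x Hx) as [B HB]. exists B. intros M.
  eapply Rle_trans; [|apply (HB M)]. eapply Rle_trans; [|apply (pbar_parts_rsum_le x M Hx M)].
  apply rsum_le. intros i Hi. rewrite pbar_parts_stable by lia. lra.
Qed.

(** [pbar_parts n] and [pbar] agree up to [n], and both series are dominated by that of [pbar] at
    [|q|]. So the [n]-th partial product and the [n]-th partial sum differ by at most a tail. *)
Lemma pbar_series_product q : Cmod q < 1 -> exists P,
  Clim (csum (fun m => RtoC (INR (pbar m)) * q ^ m)%C) P /\ Clim (fun N => ovp_prod N q) P.
Proof.
  intros Hq. assert (Hq0 := Cmod_ge_0 q).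
  set (v := fun m => INR (pbar m) * Cmod q ^ m).
  assert (Hv : forall i, 0 <= v i).
  { intros i. apply Rmult_le_pos; [apply pos_INR|apply pow_le; easy]. }
  destruct (pbar_rsum_bounded (Cmod q)) as [B HB]; [lra|].
  destruct (rsum_bounded_cv v B Hv HB) as [s [Hs _]].
  assert (Hle : forall m i, Cmod (RtoC (INR (pbar_parts m i)) * q ^ i)%C <= v i).
  { intros m i. rewrite Cmod_mult, Cmod_R, Cmod_pow, Rabs_right by (apply Rle_ge, pos_INR).
    apply Rmult_le_compat_r; [apply pow_le; easy|]. apply le_INR, pbar_parts_le. }
  assert (Hle' : forall i, Cmod (RtoC (INR (pbar i)) * q ^ i)%C <= v i).
  { intros i. rewrite <- (pbar_parts_stable i i) by lia. apply Hle. }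
  destruct (csum_dominated_cv _ v B Hle' HB) as [P HP].
  exists P. split; [easy|].
  apply Clim_of_zero_diff with (csum (fun m => RtoC (INR (pbar m)) * q ^ m)%C); [easy|].
  apply lim_seq_dominated with (fun n => s - rsum v n).
  - intros n. split; [apply Cmod_ge_0|].
    rewrite (csum_ext _ (fun m => RtoC (INR (pbar_parts n m)) * q ^ m)%C)
      by (intros; rewrite pbar_parts_stable by lia; easy).
    apply Cmod_csum_tail_le; [apply Hle|easy|apply pbar_parts_series; easy].
  - replace (Finite 0) with (Finite (s - s)) by (f_equal; ring).
    apply is_lim_seq_minus'; [apply is_lim_seq_const|easy].
Qed.

(** * Gauss's identity *)

Definition gauss_remainder_coef (q : C) (m : nat) : C :=
  ((- (1)) ^ S m * (ovp_prod (S m) q / (1 + q ^ S m)))%C.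

Lemma ovp_prod_div_one_plus q m : Cmod q < 1 ->
  (ovp_prod (S m) q / (1 + q ^ S m) = ovp_prod m q / (1 - q ^ S m))%C.
Proof.
  intros Hq. cbn [ovp_prod]. field. split; [apply one_minus_pow_nz|apply one_plus_pow_nz]; easy.
Qed.

(** Each summand equals [(-1)^(m+1) w^(m+1) (P_m + w P_(m+1))] with [P = ovp_prod], so the sum
    telescopes. At [w = q^(N+1)] this is the induction step of the identity below. *)
Lemma gauss_telescoping q (w : C) j : Cmod q < 1 ->
  (csum (fun m => w ^ S m * gauss_remainder_coef q m * ((1 + w) - (1 - w) * q ^ S m)) j
   = - w - (- (1)) ^ S j * w ^ S j * ovp_prod j q)%C.
Proof.
  intros Hq. induction j as [|j IH].
  - simpl. ring.
  - cbn [csum]. rewrite IH. unfold gauss_remainder_coef. rewrite ovp_prod_div_one_plus by easy.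
    cbn [ovp_prod].
    assert (H1 := one_minus_pow_nz q j Hq).
    set (X := (q ^ S j)%C) in *.
    rewrite !(Cpow_S _ (S j)). set (s := ((- (1)) ^ S j)%C). set (W := (w ^ S j)%C).
    set (p := ovp_prod j q). field. exact H1.
Qed.

(* A finite form of Gauss's identity [theta(-q) = prod (1 - q^k) / (1 + q^k)]. *)
Lemma gauss_identity_finite q N : Cmod q < 1 ->
  (theta_partial q N * ovp_prod N q
   = 1 + 2 * csum (fun m => (q ^ S N) ^ S m * gauss_remainder_coef q m) N)%C.
Proof.
  intros Hq. unfold theta_partial. induction N as [|N IH].
  - simpl. unfold theta_term. simpl. ring.
  - assert (H1 := one_minus_pow_nz q N Hq). assert (H2 := one_plus_pow_nz q N Hq).
    set (w := (q ^ S N)%C) in *.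
    change (csum (theta_term q) (S (S N))) with (csum (theta_term q) (S N) + theta_term q (S N))%C.
    assert (Ht : theta_term q (S N) = ((- (1)) ^ S N * w ^ S N)%C).
    { unfold theta_term, w. rewrite Cpow_mult_r. easy. }
    assert (Hsum : (csum (fun m => (q ^ S (S N)) ^ S m * gauss_remainder_coef q m) (S N)
       = csum (fun m => w ^ S m * gauss_remainder_coef q m * q ^ S m) (S N))%C).
    { apply csum_ext. intros m _. unfold w. rewrite <- !Cpow_mult_r.
      replace (S (S N) * S m)%nat with (S N * S m + S m)%nat by lia.
      rewrite Cpow_add_r. ring. }
    rewrite Hsum. cbn [csum].
    assert (Htel := gauss_telescoping q w N Hq).
    rewrite (csum_ext _ (fun m => (1 + w) * (w ^ S m * gauss_remainder_coef q m)
        + - (1 - w) * (w ^ S m * gauss_remainder_coef q m * q ^ S m))%C N) in Htel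
      by (intros; ring).
    rewrite csum_plus, !csum_scal in Htel.
    set (A := csum (fun m => w ^ S m * gauss_remainder_coef q m)%C N) in *.
    set (B := csum (fun m => w ^ S m * gauss_remainder_coef q m * q ^ S m)%C N) in *.
    assert (Hlast : gauss_remainder_coef q N = ((- (1)) ^ S N * (ovp_prod N q / (1 - w)))%C).
    { unfold gauss_remainder_coef. rewrite ovp_prod_div_one_plus by easy. easy. }
    rewrite Hlast, Ht. cbn [ovp_prod]. fold w.
    set (T := csum (theta_term q) N) in *. set (t := theta_term q N) in *.
    set (p := ovp_prod N q) in *. set (s := ((- (1)) ^ S N)%C) in *. set (W := (w ^ S N)%C) in *.
    change (csum (theta_term q) (S N)) with (T + t)%C in IH.
    assert (HB : B = (((1 + w) * A + w + s * W * p) / (1 - w))%C).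
    { transitivity (((1 + w) * A - ((1 + w) * A + - (1 - w) * B)) / (1 - w))%C; [field; easy|].
      rewrite Htel. field. easy. }
    rewrite HB.
    transitivity (((2 * (T + t) - 1) * p * (1 + w) + 2 * s * W * p * (1 + w)) / (1 - w))%C; [field; easy|].
    rewrite IH. fold w W. field. easy.
Qed.

Lemma lim_geom x : 0 <= x < 1 -> is_lim_seq (fun n => x ^ n) 0.
Proof. intros Hx. apply is_lim_seq_geom. rewrite Rabs_right; lra. Qed.

(** Every term of the remainder carries a power of [q^(N+1)], so the remainder is [O(|q|^N)]. *)
Lemma theta_times_product q : Cmod q < 1 ->
  Clim (fun N => theta_partial q N * ovp_prod N q)%C 1.
Proof.
  intros Hq. assert (Hq0 := Cmod_ge_0 q).
  destruct (ovp_prod_R_bounded (Cmod q)) as [B HB]; [lra|].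
  assert (HB1 : 1 <= B).
  { eapply Rle_trans; [apply (ovp_prod_R_pos (Cmod q) 0); lra|apply HB]. }
  assert (H0 : 0 < / (1 - Cmod q)) by (apply Rinv_0_lt_compat; lra).
  unfold Clim.
  apply lim_seq_dominated with (fun N => 2 * (B * / (1 - Cmod q)) * / (1 - Cmod q) * Cmod q ^ N).
  2: { apply lim_seq_scal0, lim_geom; lra. }
  intros N; split; [apply Cmod_ge_0|].
  rewrite gauss_identity_finite by easy.
  match goal with |- Cmod ?u <= _ => replace u with
    (2 * csum (fun m => (q ^ S N) ^ S m * gauss_remainder_coef q m)%C N)%C by ring end.
  rewrite Cmod_mult, Cmod_R, Rabs_right by lra.
  rewrite !Rmult_assoc. apply Rmult_le_compat_l; [lra|].
  eapply Rle_trans.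
  - apply Cmod_csum_le with (v := fun m => B * / (1 - Cmod q) * Cmod q ^ N * Cmod q ^ m).
    intros m _. unfold gauss_remainder_coef.
    rewrite !Cmod_mult, Cmod_minus_one_pow, Cmod_div, !Cmod_pow by (apply one_plus_pow_nz; easy).
    assert (Ha : Cmod (ovp_prod (S m) q) / Cmod (1 + q ^ S m) <= B * / (1 - Cmod q)).
    { apply Rmult_le_compat; [apply Cmod_ge_0|left; apply Rinv_0_lt_compat, Cmod_gt_0, one_plus_pow_nz; easy| |].
      - eapply Rle_trans; [apply Cmod_ovp_prod_le; easy|apply HB].
      - apply Rinv_le_contravar; [lra|apply one_plus_pow_lower; easy]. }
    assert (Ha0 : 0 <= Cmod (ovp_prod (S m) q) / Cmod (1 + q ^ S m)).
    { apply Rmult_le_pos; [apply Cmod_ge_0|left; apply Rinv_0_lt_compat, Cmod_gt_0, one_plus_pow_nz; easy]. }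
    assert (Hb : (Cmod q ^ S N) ^ S m <= Cmod q ^ N * Cmod q ^ m).
    { rewrite <- pow_mult, <- pow_add.
      replace (S N * S m)%nat with (N + m + (1 + N * m))%nat by lia.
      rewrite (pow_add _ (N + m)).
      assert (0 <= Cmod q ^ (N + m)) by (apply pow_le; easy).
      assert (Cmod q ^ (1 + N * m) <= 1).
      { rewrite <- (pow1 (1 + N * m)). apply pow_incr; lra. }
      nra. }
    assert (Hc : 0 <= (Cmod q ^ S N) ^ S m) by (apply pow_le, pow_le; easy).
    rewrite Rmult_1_l.
    apply Rle_trans with ((Cmod q ^ N * Cmod q ^ m) * (B * / (1 - Cmod q))); [|right; ring].
    apply Rmult_le_compat; easy.
  - rewrite rsum_scal.
    assert (Hg := rsum_geom_le (Cmod q) N ltac:(lra)).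
    assert (0 <= B * / (1 - Cmod q) * Cmod q ^ N).
    { apply Rmult_le_pos; [apply Rmult_le_pos; lra|apply pow_le; easy]. }
    apply Rle_trans with (B * / (1 - Cmod q) * Cmod q ^ N * / (1 - Cmod q)); [|right; ring].
    apply Rmult_le_compat_l; easy.
Qed.

Lemma Cmod_theta_term_le q l : Cmod q <= 1 -> Cmod (theta_term q l) <= Cmod q ^ l.
Proof.
  intros Hq. unfold theta_term. rewrite Cmod_mult, Cmod_minus_one_pow, Cmod_pow, Rmult_1_l.
  replace (l * l)%nat with (l + (l * l - l))%nat by nia. rewrite pow_add.
  assert (0 <= Cmod q ^ l) by apply pow_le, Cmod_ge_0.
  assert (Cmod q ^ (l * l - l) <= 1).
  { rewrite <- (pow1 (l * l - l)). apply pow_incr. split; [apply Cmod_ge_0|easy]. }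
  nra.
Qed.

Lemma lim_inv_INR : is_lim_seq (fun N => / INR N) 0.
Proof.
  assert (H := is_lim_seq_inv INR p_infty is_lim_seq_INR). simpl in H. apply H. discriminate.
Qed.

(** The explicit geometric rate serves twice: it makes the Cesaro means converge, and later it
    forces the recurrence for [pbar]. *)
Lemma theta_partial_limit q P : Cmod q < 1 -> Clim (fun N => ovp_prod N q) P ->
  exists T, (T * P = 1)%C /\
  forall j, Cmod (theta_partial q j - T) <= 2 / (1 - Cmod q) * Cmod q ^ j.
Proof.
  intros Hq HP. assert (Hq0 := Cmod_ge_0 q).
  set (v := fun l => Cmod q ^ l).
  assert (Hv : is_lim_seq (rsum v) (/ (1 - Cmod q))).
  { apply rsum_lim_iff_series. unfold v. apply is_series_geom. rewrite Rabs_right; lra. }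
  destruct (csum_dominated_cv (theta_term q) v (/ (1 - Cmod q))) as [A HA].
  { intros i. apply Cmod_theta_term_le; lra. }
  { intros n. apply rsum_geom_le; lra. }
  set (T := (2 * A - 1)%C).
  assert (Htail : forall j, Cmod (theta_partial q j - T) <= 2 / (1 - Cmod q) * Cmod q ^ j).
  { intros j. unfold theta_partial, T.
    match goal with |- Cmod ?u <= _ => replace u with (2 * (csum (theta_term q) (S j) - A))%C by ring end.
    rewrite Cmod_mult, Cmod_R, Rabs_right, Cmod_minus_sym by lra.
    assert (H := Cmod_csum_tail_le (theta_term q) v A (/ (1 - Cmod q)) (S j)
       ltac:(intros i; apply Cmod_theta_term_le; lra) Hv HA).
    assert (Hr : forall n, rsum v n = (1 - Cmod q ^ n) / (1 - Cmod q)).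
    { induction n as [|n IH]; unfold v in *; simpl; [field; lra|]. rewrite IH. field. lra. }
    rewrite Hr in H.
    replace (/ (1 - Cmod q) - (1 - Cmod q ^ S j) / (1 - Cmod q)) with (Cmod q ^ S j * / (1 - Cmod q)) in H
      by (field; lra).
    assert (H0 : 0 < / (1 - Cmod q)) by (apply Rinv_0_lt_compat; lra).
    assert (Cmod q ^ S j <= Cmod q ^ j) by (simpl; assert (0 <= Cmod q ^ j) by (apply pow_le; easy); nra).
    unfold Rdiv. nra. }
  assert (HT : Clim (theta_partial q) T).
  { apply lim_seq_dominated with (fun j => 2 / (1 - Cmod q) * Cmod q ^ j).
    - intros n; split; [apply Cmod_ge_0|apply Htail].
    - apply lim_seq_scal0, lim_geom; lra. }
  assert (HTP : (T * P = 1)%C).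
  { apply (Clim_unique _ _ _ (Clim_mult _ _ _ _ HT HP) (theta_times_product q Hq)). }
  exists T. split; easy.
Qed.

Lemma theta_cesaro_times_product q P : Cmod q < 1 -> Clim (fun N => ovp_prod N q) P ->
  Clim (fun N => theta_cesaro q N * P)%C 1.
Proof.
  intros Hq HP. assert (Hq0 := Cmod_ge_0 q).
  destruct (theta_partial_limit q P Hq HP) as [T [HTP Htail]].
  rewrite <- HTP. apply Clim_mult; [|apply Clim_const].
  apply lim_seq_dominated_eventually with
    (fun N => 2 / (1 - Cmod q) * / (1 - Cmod q) * / INR N) 1%nat.
  2: { apply lim_seq_scal0, lim_inv_INR. }
  intros N HN. split; [apply Cmod_ge_0|].
  assert (HN0 : 0 < INR N) by (apply lt_0_INR; lia).
  assert (HNC : RtoC (INR N) <> 0) by (intros E; apply RtoC_inj in E; lra).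
  assert (E : (theta_cesaro q N - T)%C = (/ RtoC (INR N) * csum (fun j => theta_partial q j - T) N)%C).
  { unfold theta_cesaro. rewrite csum_minus.
    assert (Hc : csum (fun _ => T) N = (RtoC (INR N) * T)%C).
    { clear. induction N as [|N IH]; [simpl; ring|]. cbn [csum]. rewrite IH, S_INR, RtoC_plus. ring. }
    rewrite Hc. field. easy. }
  rewrite E, Cmod_mult, Cmod_inv, Cmod_R, Rabs_right by (easy || lra).
  rewrite Rmult_comm. apply Rmult_le_compat_r; [left; apply Rinv_0_lt_compat; easy|].
  eapply Rle_trans; [apply Cmod_csum_le; intros; apply Htail|].
  rewrite rsum_scal. apply Rmult_le_compat_l.
  - apply Rmult_le_pos; [lra|left; apply Rinv_0_lt_compat; lra].
  - apply rsum_geom_le; lra.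
Qed.

(** * Minor arcs *)

(** [y] stands for [x^2]. The difference of the two sides is [1 - c] times a quadratic in [y]; its
    sign is delicate only for [c < - 1 / sqrt 2], where the square is completed at
    [y = 2 c^2 - 1]. *)
Lemma artanh_derivative_ineq (c y : R) : -1 <= c <= 1 -> 0 <= y < 1 ->
  c * (4 * c ^ 2 - 3 - y) * (1 - y) <= (1 + y) ^ 2 - 4 * c ^ 2 * y.
Proof.
  intros Hc Hy.
  assert (H : 0 <= (1 + 2 * c) ^ 2 + y * (2 - 4 * c ^ 2) + y ^ 2).
  { destruct (Rle_dec (4 * c ^ 2) 2) as [H1|H1].
    { assert (0 <= y * (2 - 4 * c ^ 2)) by (apply Rmult_le_pos; lra).
      generalize (pow2_ge_0 (1 + 2 * c)) (pow2_ge_0 y). lra. }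
    destruct (Rle_dec 0 c) as [H2|H2].
    { assert (0 <= c ^ 2 * (1 - y)) by nra. nra. }
    assert (H3 : 0 <= (2 * c) * (2 * c + 2) * (4 + 2 * (2 * c) - 4 * c ^ 2)).
    { assert (H4 : (2 * c) * (2 * c + 2) <= 0) by nra.
      assert (H5 : 4 + 2 * (2 * c) - 4 * c ^ 2 <= 0) by nra. nra. }
    replace ((1 + 2 * c) ^ 2 + y * (2 - 4 * c ^ 2) + y ^ 2) with
      ((y + 1 - 2 * c ^ 2) ^ 2 + / 4 * ((2 * c) * (2 * c + 2) * (4 + 2 * (2 * c) - 4 * c ^ 2))) by field.
    generalize (pow2_ge_0 (y + 1 - 2 * c ^ 2)). lra. }
  assert (E : (1 + y) ^ 2 - 4 * c ^ 2 * y - c * (4 * c ^ 2 - 3 - y) * (1 - y) =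
    (1 - c) * ((1 + 2 * c) ^ 2 + y * (2 - 4 * c ^ 2) + y ^ 2)) by ring.
  assert (0 <= (1 - c) * ((1 + 2 * c) ^ 2 + y * (2 - 4 * c ^ 2) + y ^ 2)) by (apply Rmult_le_pos; lra).
  lra.
Qed.

(* For [w = x (c + i s)], both sides vanish at [x = 0] and the derivative in [x] of the left
   side is the real part of [2 (c + i s) w^2 / (1 - w^2)], of modulus at most [2 x^2 / (1 - x^2)]. *)
Lemma artanh_real_part_bound (c x : R) : -1 <= c <= 1 -> 0 <= x < 1 ->
  / 2 * ln (1 + 2 * c * x + x ^ 2) - / 2 * ln (1 - 2 * c * x + x ^ 2) - 2 * c * x
  <= ln (1 + x) - ln (1 - x) - 2 * x.
Proof.
  intros Hc Hx.
  set (phi := fun x => / 2 * ln (1 + 2 * c * x + x ^ 2) - / 2 * ln (1 - 2 * c * x + x ^ 2) - 2 * c * x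
    - (ln (1 + x) - ln (1 - x) - 2 * x)).
  assert (Hpos : forall y, 0 <= y < 1 -> 0 < 1 + 2 * c * y + y ^ 2 /\ 0 < 1 - 2 * c * y + y ^ 2).
  { intros y Hy. assert (0 < (1 - y) ^ 2) by (apply pow_lt; lra). split; nra. }
  assert (Hd : forall y, 0 <= y < 1 -> is_derive phi y
     ((c + y) / (1 + 2 * c * y + y ^ 2) - (y - c) / (1 - 2 * c * y + y ^ 2) - 2 * c
       - (/ (1 + y) + / (1 - y) - 2))).
  { intros y Hy. destruct (Hpos y Hy) as [H1 H2]. unfold phi. auto_derive.
    - replace (1 + 2 * c * y + y * (y * 1)) with (1 + 2 * c * y + y ^ 2) by ring.
      replace (1 + - (2 * c * y) + y * (y * 1)) with (1 - 2 * c * y + y ^ 2) by ring.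
      repeat split; lra.
    - field. repeat split; lra. }
  assert (Hd0 : forall y, 0 <= y < 1 ->
     (c + y) / (1 + 2 * c * y + y ^ 2) - (y - c) / (1 - 2 * c * y + y ^ 2) - 2 * c
       - (/ (1 + y) + / (1 - y) - 2) <= 0).
  { intros y Hy. destruct (Hpos y Hy) as [H1 H2].
    assert (Hden : 0 < (1 + y ^ 2) ^ 2 - 4 * c ^ 2 * y ^ 2).
    { replace ((1 + y ^ 2) ^ 2 - 4 * c ^ 2 * y ^ 2) with ((1 + 2 * c * y + y ^ 2) * (1 - 2 * c * y + y ^ 2)) by ring.
      apply Rmult_lt_0_compat; easy. }
    assert (Hy2 : 0 <= y ^ 2 < 1) by nra.
    assert (H := artanh_derivative_ineq c (y ^ 2) Hc Hy2).
    assert (E : (c + y) / (1 + 2 * c * y + y ^ 2) - (y - c) / (1 - 2 * c * y + y ^ 2) - 2 * c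
       - (/ (1 + y) + / (1 - y) - 2) =
       2 * y ^ 2 * (c * (4 * c ^ 2 - 3 - y ^ 2) * (1 - y ^ 2) - ((1 + y ^ 2) ^ 2 - 4 * c ^ 2 * y ^ 2))
        * / (((1 + y ^ 2) ^ 2 - 4 * c ^ 2 * y ^ 2) * (1 - y ^ 2))).
    { field. repeat split; nra. }
    rewrite E.
    assert (0 < / (((1 + y ^ 2) ^ 2 - 4 * c ^ 2 * y ^ 2) * (1 - y ^ 2))).
    { apply Rinv_0_lt_compat, Rmult_lt_0_compat; lra. }
    assert (2 * y ^ 2 * (c * (4 * c ^ 2 - 3 - y ^ 2) * (1 - y ^ 2) - ((1 + y ^ 2) ^ 2 - 4 * c ^ 2 * y ^ 2)) <= 0) by nra.
    nra. }
  assert (H0 : phi 0 = 0).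
  { unfold phi. replace (1 + 2 * c * 0 + 0 ^ 2) with 1 by ring. replace (1 - 2 * c * 0 + 0 ^ 2) with 1 by ring.
    replace (1 + 0) with 1 by ring. replace (1 - 0) with 1 by ring. rewrite ln_1. ring. }
  destruct (MVT_gen phi 0 x (fun y => (c + y) / (1 + 2 * c * y + y ^ 2) - (y - c) / (1 - 2 * c * y + y ^ 2) - 2 * c
       - (/ (1 + y) + / (1 - y) - 2))) as [y [Hy Heq]]; rewrite ?Rmin_left, ?Rmax_right in * by lra.
  - intros y Hy. apply Hd. lra.
  - intros y Hy. apply continuity_pt_filterlim, (ex_derive_continuous phi). eexists; apply Hd; lra.
  - assert (Hn := Hd0 y ltac:(lra)). unfold phi at 1 in Heq. rewrite H0 in Heq. nra.
Qed.

Lemma Cmod_sqrt_form (a : C) : 0 < Re a ^ 2 + Im a ^ 2 ->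
  Cmod a = exp (/ 2 * ln (Re a ^ 2 + Im a ^ 2)).
Proof.
  intros H. unfold Cmod. fold (Re a) (Im a). rewrite <- Rpower_sqrt by easy. easy.
Qed.

(** The modulus of [(1 + w) / (1 - w)] is [exp (2 Re artanh w)]. Of [artanh w = w + w^3 / 3 + ...]
    the linear term is kept exactly and yields the exponential gain; the rest is replaced by its
    value at [|w|]. *)
Lemma ovp_factor_bound (w : C) : Cmod w < 1 ->
  Cmod (1 + w) / Cmod (1 - w) <= (1 + Cmod w) / (1 - Cmod w) * exp (- 2 * (Cmod w - Re w)).
Proof.
  intros Hw. assert (H0 := Cmod_ge_0 w). set (x := Cmod w) in *.
  assert (Hre := re_le_Cmod w). fold x in Hre.
  assert (Hx2 : x ^ 2 = Re w ^ 2 + Im w ^ 2) by apply Cmod2_alt.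
  assert (Hc : exists c, -1 <= c <= 1 /\ Re w = c * x).
  { destruct (Req_dec x 0) as [E|E].
    - exists 0. split; [lra|]. rewrite E in *.
      assert (Rabs (Re w) = 0) by (generalize (Rabs_pos (Re w)); lra).
      rewrite Rmult_0_l. destruct (Req_dec (Re w) 0) as [K|K]; [easy|]. apply Rabs_no_R0 in K. lra.
    - exists (Re w / x). split; [|field; easy].
      assert (Hxp : 0 < x) by lra. apply Rabs_le_between in Hre.
      split; apply Rmult_le_reg_r with x; auto; unfold Rdiv; rewrite Rmult_assoc, Rinv_l by lra; lra. }
  destruct Hc as [c [Hc Hrc]].
  assert (Hp : Re (1 + w)%C ^ 2 + Im (1 + w)%C ^ 2 = 1 + 2 * c * x + x ^ 2).
  { replace (Re (1 + w)%C) with (1 + Re w) by (unfold Re; simpl; ring).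
    replace (Im (1 + w)%C) with (Im w) by (unfold Im; simpl; ring).
    rewrite Hx2. rewrite Hrc. ring. }
  assert (Hm : Re (1 - w)%C ^ 2 + Im (1 - w)%C ^ 2 = 1 - 2 * c * x + x ^ 2).
  { replace (Re (1 - w)%C) with (1 - Re w) by (unfold Re; simpl; ring).
    replace (Im (1 - w)%C) with (- Im w) by (unfold Im; simpl; ring).
    rewrite Hx2. rewrite Hrc. ring. }
  assert (Hpos : 0 < 1 + 2 * c * x + x ^ 2 /\ 0 < 1 - 2 * c * x + x ^ 2).
  { assert (0 < (1 - x) ^ 2) by (apply pow_lt; lra). split; nra. }
  rewrite !Cmod_sqrt_form by lra. rewrite Hp, Hm.
  assert (H := artanh_real_part_bound c x Hc ltac:(lra)).
  unfold Rdiv. rewrite <- exp_Ropp, <- exp_plus.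
  replace (1 + x) with (exp (ln (1 + x))) at 1 by (apply exp_ln; lra).
  replace (1 - x) with (exp (ln (1 - x))) at 1 by (apply exp_ln; lra).
  rewrite <- exp_Ropp, <- !exp_plus, Hrc.
  match goal with |- exp ?a <= exp ?b => assert (a <= b) as [K|K] by lra end.
  - left; apply exp_increasing; exact K.
  - rewrite K; lra.
Qed.

(** The gains of the factors add up to a difference of geometric sums at [|q|] and at [q], which has
    a closed form in the limit. *)
Lemma ovp_prod_minor_bound q N : Cmod q < 1 ->
  Cmod (ovp_prod N q) <= ovp_prod_R N (Cmod q) *
    exp (- 2 * (rsum (fun k => Cmod q ^ S k) N - Re (csum (fun k => q ^ S k)%C N))).
Proof.
  intros Hq. assert (Hq0 := Cmod_ge_0 q). induction N as [|k IH].
  - simpl. rewrite Cmod_1. replace (- 2 * (0 - 0)) with 0 by ring. rewrite exp_0. lra.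
  - cbn [ovp_prod ovp_prod_R rsum csum].
    replace (- 2 * (rsum (fun k => Cmod q ^ S k) k + Cmod q ^ S k - Re (csum (fun k => q ^ S k)%C k + q ^ S k)%C))
      with ((- 2 * (rsum (fun k => Cmod q ^ S k) k - Re (csum (fun k => q ^ S k)%C k))) +
       (- 2 * (Cmod q ^ S k - Re (q ^ S k)%C))) by (unfold Re; simpl; ring).
    rewrite exp_plus, Cmod_mult, Cmod_div by (apply one_minus_pow_nz; easy).
    set (e1 := exp (- 2 * (rsum _ _ - _))) in *.
    assert (Hf := ovp_factor_bound (q ^ S k)%C). rewrite Cmod_pow in Hf.
    destruct (pow_S_lt_1 (Cmod q) k) as [H1 H2]; [lra|]. specialize (Hf H2).
    set (e2 := exp (- 2 * (Cmod q ^ S k - Re (q ^ S k)%C))) in *.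
    replace (ovp_prod_R k (Cmod q) * ((1 + Cmod q ^ S k) / (1 - Cmod q ^ S k)) * (e1 * e2)) with
     ((ovp_prod_R k (Cmod q) * e1) * ((1 + Cmod q ^ S k) / (1 - Cmod q ^ S k) * e2)) by ring.
    apply Rmult_le_compat; [apply Cmod_ge_0| |easy|easy].
    apply Rmult_le_pos; [apply Cmod_ge_0|left; apply Rinv_0_lt_compat, Cmod_gt_0, one_minus_pow_nz; easy].
Qed.

Lemma ovp_prod_RtoC x N : 0 <= x < 1 -> ovp_prod N (RtoC x) = RtoC (ovp_prod_R N x).
Proof.
  intros Hx. induction N as [|k IH]; cbn [ovp_prod ovp_prod_R]; [easy|].
  destruct (pow_S_lt_1 x k Hx) as [H1 H2].
  rewrite IH, RtoC_mult, RtoC_div, RtoC_plus, RtoC_minus, RtoC_pow by lra. easy.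
Qed.

Lemma csum_geom_shift q N : Cmod q < 1 ->
  csum (fun k => q ^ S k)%C N = (q / (1 - q) - q ^ S N / (1 - q))%C.
Proof.
  intros Hq. assert (H := one_minus_pow_nz q 0 Hq). rewrite Cpow_1_r in H.
  induction N as [|N IH]; [simpl; field; easy|]. cbn [csum]. rewrite IH, (Cpow_S q (S N)). field. easy.
Qed.

Lemma Clim_pow0 q : Cmod q < 1 -> Clim (fun n => q ^ n)%C 0.
Proof.
  intros Hq. unfold Clim. apply is_lim_seq_ext with (fun n => Cmod q ^ n).
  - intros n. rewrite <- Cmod_pow. f_equal. ring.
  - apply lim_geom. split; [apply Cmod_ge_0|easy].
Qed.

Lemma is_lim_seq_Cmod (u : nat -> C) l : Clim u l -> is_lim_seq (fun n => Cmod (u n)) (Cmod l).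
Proof.
  intros H. apply (is_lim_seq_le_le (fun n => Cmod l - Cmod (u n - l)) _ (fun n => Cmod l + Cmod (u n - l))).
  - intros n. generalize (Cmod_le_plus_diff (u n) l) (Cmod_le_plus_diff l (u n)).
    rewrite (Cmod_minus_sym l (u n)). lra.
  - replace (Finite (Cmod l)) with (Finite (Cmod l - 0)) by (f_equal; ring).
    apply is_lim_seq_minus'; [apply is_lim_seq_const|easy].
  - replace (Finite (Cmod l)) with (Finite (Cmod l + 0)) by (f_equal; ring).
    apply is_lim_seq_plus'; [apply is_lim_seq_const|easy].
Qed.

Lemma is_lim_seq_Re (u : nat -> C) l : Clim u l -> is_lim_seq (fun n => Re (u n)) (Re l).
Proof.
  intros H. apply (is_lim_seq_le_le (fun n => Re l - Cmod (u n - l)) _ (fun n => Re l + Cmod (u n - l))).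
  - intros n. generalize (re_le_Cmod (u n - l)).
    replace (Re (u n - l)%C) with (Re (u n) - Re l) by (unfold Re; simpl; ring).
    intros K. apply Rabs_le_between in K. lra.
  - replace (Finite (Re l)) with (Finite (Re l - 0)) by (f_equal; ring).
    apply is_lim_seq_minus'; [apply is_lim_seq_const|easy].
  - replace (Finite (Re l)) with (Finite (Re l + 0)) by (f_equal; ring).
    apply is_lim_seq_plus'; [apply is_lim_seq_const|easy].
Qed.

Lemma ovp_prod_limit_minor_bound q P P0 : Cmod q < 1 ->
  Clim (fun N => ovp_prod N q) P -> Clim (fun N => ovp_prod N (RtoC (Cmod q))) P0 ->
  Cmod P <= Cmod P0 * exp (- 2 * (Cmod q / (1 - Cmod q) - Re (q / (1 - q))%C)).
Proof.
  intros Hq HP HP0. assert (Hq0 := Cmod_ge_0 q).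
  assert (H1 := one_minus_pow_nz q 0 Hq). rewrite Cpow_1_r in H1.
  set (g := fun N => - 2 * (rsum (fun k => Cmod q ^ S k) N - Re (csum (fun k => q ^ S k)%C N))).
  assert (Hg : is_lim_seq g (- 2 * (Cmod q / (1 - Cmod q) - Re (q / (1 - q))%C))).
  { apply (is_lim_seq_scal_l _ (- 2) (Cmod q / (1 - Cmod q) - Re (q / (1 - q))%C)).
    apply is_lim_seq_minus'.
    - assert (E : forall N, rsum (fun k => Cmod q ^ S k) N = Cmod q * ((1 - Cmod q ^ N) * / (1 - Cmod q))).
      { induction N as [|N IH]; simpl in *; [field; lra|]. rewrite IH. field. lra. }
      apply is_lim_seq_ext with (fun N => Cmod q * ((1 - Cmod q ^ N) * / (1 - Cmod q))); [intros; rewrite E; easy|].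
      replace (Cmod q / (1 - Cmod q)) with (Cmod q * ((1 - 0) * / (1 - Cmod q))) by (field; lra).
      apply is_lim_seq_mult'; [apply is_lim_seq_const|]. apply is_lim_seq_mult'; [|apply is_lim_seq_const].
      apply is_lim_seq_minus'; [apply is_lim_seq_const|apply lim_geom; lra].
    - apply is_lim_seq_Re.
      apply Clim_ext with (fun N => q / (1 - q) - q / (1 - q) * q ^ N)%C.
      + intros N. rewrite csum_geom_shift by easy. rewrite Cpow_S. field. easy.
      + assert (K : Clim (fun N => q / (1 - q) - q / (1 - q) * q ^ N)%C (q / (1 - q) - q / (1 - q) * 0)%C).
        { apply Clim_minus; [apply Clim_const|]. apply Clim_scal, Clim_pow0; easy. }
        replace (q / (1 - q) - q / (1 - q) * 0)%C with (q / (1 - q))%C in K by ring. exact K. }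
  assert (He : is_lim_seq (fun N => exp (g N)) (exp (- 2 * (Cmod q / (1 - Cmod q) - Re (q / (1 - q))%C)))).
  { apply (is_lim_seq_continuous exp); [|easy]. apply derivable_continuous_pt, derivable_pt_exp. }
  apply (is_lim_seq_le (fun N => Cmod (ovp_prod N q)) (fun N => Cmod (ovp_prod N (RtoC (Cmod q))) * exp (g N))
    (Cmod P) (Cmod P0 * exp (- 2 * (Cmod q / (1 - Cmod q) - Re (q / (1 - q))%C)))).
  - intros N. rewrite ovp_prod_RtoC by lra. rewrite Cmod_R, Rabs_right.
    + apply ovp_prod_minor_bound; easy.
    + generalize (ovp_prod_R_pos (Cmod q) N). lra.
  - apply is_lim_seq_Cmod; easy.
  - apply is_lim_seq_mult'; [apply is_lim_seq_Cmod; easy|easy].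
Qed.

Lemma exp_le_compat x y : x <= y -> exp x <= exp y.
Proof. intros [H|H]; [left; apply exp_increasing; easy|rewrite H; lra]. Qed.

(** * Major arc *)

Lemma RInt_exp_decay b L : 0 < b -> 1 / 2 <= L ->
  RInt (fun s => exp (- (b * (s - 1 / 2)))) (1 / 2) L <= / b.
Proof.
  intros Hb HL.
  assert (E : RInt (fun s => exp (- (b * (s - 1 / 2)))) (1 / 2) L =
     - exp (- (b * (L - 1 / 2))) / b - - exp (- (b * (1 / 2 - 1 / 2))) / b).
  { apply is_RInt_unique.
    apply (is_RInt_derive (fun s => - exp (- (b * (s - 1 / 2))) / b)).
    - intros x _. auto_derive; auto. unfold Rminus, Rdiv. field. lra.
    - intros x _. apply (ex_derive_continuous (fun s => exp (- (b * (s - 1 / 2))))). auto_derive. easy. }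
  rewrite E. replace (- (b * (1 / 2 - 1 / 2))) with 0 by ring. rewrite exp_0.
  assert (0 < exp (- (b * (L - 1 / 2))) * / b).
  { apply Rmult_lt_0_compat; [apply exp_pos|apply Rinv_0_lt_compat; easy]. }
  unfold Rdiv. lra.
Qed.

(** For [s >= 1/2], [s^2 >= 1/4 + (s - 1/2)]. With [b = pi^2 Re (1 / z)], the factor [e^(-b/4)]
    cancels the growth of [e^(pi^2 / (4 z))], so this part of the integral contributes only
    [1 / b]. *)
Lemma gauss_tail_bound z L : 0 < Re z -> 1 / 2 <= L ->
  Cmod (CInt (gauss z) (1 / 2) L) <= exp (- (PI ^ 2 * Re (/ z) / 4)) / (PI ^ 2 * Re (/ z)).
Proof.
  intros Hz HL. assert (Hr := Re_inv_pos z Hz).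
  set (b := PI ^ 2 * Re (/ z)).
  assert (Hb : 0 < b) by (apply Rmult_lt_0_compat; [apply pow_lt, PI_RGT_0|easy]).
  assert (Hcont : forall x, continuous (fun s => exp (- (b * (s - 1 / 2)))) x).
  { intros x. apply (ex_derive_continuous (fun s => exp (- (b * (s - 1 / 2))))). auto_derive. easy. }
  eapply Rle_trans.
  - apply Cmod_CInt_le with (g := fun s => exp (- (b / 4)) * exp (- (b * (s - 1 / 2)))).
    + easy.
    + apply Ccont_gauss.
    + intros x. apply (continuous_scal_r (V := R_NormedModule) (exp (- (b / 4)))
        (fun s => exp (- (b * (s - 1 / 2))))). apply Hcont.
    + intros s Hs. rewrite Cmod_gauss, <- exp_plus. apply exp_le_compat. fold b.
      assert (0 <= b * (s - 1 / 2) ^ 2) by (apply Rmult_le_pos; [lra|apply pow2_ge_0]). nra.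
  - rewrite RInt_scal_R by easy. unfold Rdiv at 2.
    apply Rmult_le_compat_l; [left; apply exp_pos|]. apply RInt_exp_decay; easy.
Qed.

Lemma gauss_head_bound z : 0 < Re z -> Cmod (CInt (gauss z) 0 (1 / 2)) <= 1 / 2.
Proof.
  intros Hz. assert (Hr := Re_inv_pos z Hz).
  eapply Rle_trans.
  - apply Cmod_CInt_le with (g := fun _ => 1); [lra|apply Ccont_gauss|intros; apply continuous_const|].
    intros s Hs. rewrite Cmod_gauss, <- exp_0. apply exp_le_compat.
    assert (0 <= PI ^ 2 * Re (/ z) * s ^ 2); [|lra].
    apply Rmult_le_pos; [|apply pow2_ge_0]. apply Rmult_le_pos; [apply pow2_ge_0|lra].
  - rewrite RInt_const. unfold scal; simpl; unfold mult; simpl. lra.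
Qed.

Lemma lim_inv_sqrt_INR : is_lim_seq (fun N => / sqrt (INR N)) 0.
Proof.
  apply is_lim_seq_ext with (fun N => sqrt (/ INR N)).
  - intros n. rewrite <- sqrt_inv. easy.
  - rewrite <- sqrt_0. apply (is_lim_seq_continuous sqrt); [|apply lim_inv_INR].
    apply continuity_pt_filterlim, continuous_sqrt.
Qed.

Definition gauss_half_sum (z : C) (L : nat) : C := csum (fun k => gauss z (INR k + 1 / 2)) L.

Lemma gauss_integral_split z L : (1 <= L)%nat ->
  CInt (gauss z) 0 (INR L) = (CInt (gauss z) 0 (1 / 2) + CInt (gauss z) (1 / 2) (INR L))%C.
Proof. intros H. rewrite CInt_Chasles; [easy|apply Ccont_gauss]. Qed.

Lemma gauss_integral_bound z L : 0 < Re z -> (1 <= L)%nat ->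
  Cmod (CInt (gauss z) 0 (INR L)) <= 1 / 2 + / (PI ^ 2 * Re (/ z)).
Proof.
  intros Hz HL. assert (Hr := Re_inv_pos z Hz).
  assert (Hb : 0 < PI ^ 2 * Re (/ z)) by (apply Rmult_lt_0_compat; [apply pow_lt, PI_RGT_0|easy]).
  assert (HL1 : 1 <= INR L) by (apply (le_INR 1); easy).
  rewrite gauss_integral_split by easy. eapply Rle_trans; [apply Cmod_triangle|].
  apply Rplus_le_compat; [apply gauss_head_bound; easy|].
  eapply Rle_trans; [apply gauss_tail_bound; [easy|lra]|].
  rewrite <- (Rmult_1_l (/ (PI ^ 2 * Re (/ z)))). unfold Rdiv at 1.
  apply Rmult_le_compat_r; [left; apply Rinv_0_lt_compat; easy|].
  rewrite <- exp_0. apply exp_le_compat. lra.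
Qed.

(** The theta transformation multiplied by [P = 1 / theta]. First [N] is fixed so that the Cesaro
    mean times [P] is close to 1 and the term in [1 / sqrt N] is small; then [L] is taken large. *)
Lemma modular_limit z P : 0 < Re z -> Clim (fun N => ovp_prod N (cexp (- z))) P ->
  forall eps, 0 < eps -> exists L, (1 <= L)%nat /\
  Cmod (P * gauss_half_sum z L - CInt (gauss z) 0 (INR L))%C <= eps.
Proof.
  intros Hz HP eps Heps. assert (Hr := Re_inv_pos z Hz).
  assert (Hq : Cmod (cexp (- z)) < 1).
  { rewrite Cmod_cexp, <- exp_0. apply exp_increasing. unfold Re in *; simpl; lra. }
  destruct (theta_transform z Hz) as [K [HK Htheta]].
  set (Jm := 1 / 2 + / (PI ^ 2 * Re (/ z))).
  assert (HCP := theta_cesaro_times_product _ _ Hq HP). unfold Clim in HCP.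
  assert (Hlim : is_lim_seq (fun N => (Cmod P * K) * / sqrt (INR N) +
     Jm * Cmod (theta_cesaro (cexp (- z)) N * P - 1)%C) 0).
  { apply lim_seq_plus0; apply lim_seq_scal0; [apply lim_inv_sqrt_INR|easy]. }
  apply is_lim_seq_spec in Hlim.
  destruct (Hlim (mkposreal (eps / 2) ltac:(lra))) as [N0 HN0]. simpl in HN0.
  set (N := S N0). specialize (HN0 N ltac:(unfold N; lia)).
  apply Rabs_lt_between in HN0.
  assert (HP0 := Cmod_ge_0 P).
  destruct (Htheta N ltac:(unfold N; lia) (eps / 2 / (Cmod P + 1))) as [L0 HL0].
  { apply Rdiv_lt_0_compat; lra. }
  exists (S L0). split; [lia|]. specialize (HL0 (S L0) ltac:(lia)).
  set (T := gauss_half_sum z (S L0)). set (J := CInt (gauss z) 0 (INR (S L0))) in *.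
  assert (HJ : Cmod J <= Jm) by (apply gauss_integral_bound; [easy|lia]).
  set (CN := theta_cesaro (cexp (- z)) N) in *.
  change (Cmod (CN * J - T) <= eps / 2 / (Cmod P + 1) + K * / sqrt (INR N)) in HL0.
  replace (P * T - J)%C with ((CN * P - 1) * J - P * (CN * J - T))%C by ring.
  unfold Cminus at 1. eapply Rle_trans; [apply Cmod_triangle|].
  rewrite Cmod_opp, !Cmod_mult.
  assert (H1 : Cmod (CN * P - 1) * Cmod J <= Jm * Cmod (CN * P - 1)).
  { rewrite Rmult_comm. apply Rmult_le_compat_r; [apply Cmod_ge_0|easy]. }
  assert (H2 : Cmod P * Cmod (CN * J - T) <= Cmod P * (eps / 2 / (Cmod P + 1) + K * / sqrt (INR N))).
  { apply Rmult_le_compat_l; easy. }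
  assert (H3 : Cmod P * (eps / 2 / (Cmod P + 1)) <= eps / 2).
  { replace (Cmod P * (eps / 2 / (Cmod P + 1))) with (eps / 2 * (Cmod P / (Cmod P + 1))) by (field; lra).
    rewrite <- (Rmult_1_r (eps / 2)) at 2. apply Rmult_le_compat_l; [lra|].
    apply Rmult_le_reg_r with (Cmod P + 1); [lra|]. unfold Rdiv. rewrite Rmult_assoc, Rinv_l by lra. lra. }
  lra.
Qed.

(** The Gaussian integral is cut at the first sampling point [1/2], where the combined exponent
    changes sign. *)
Definition main_term (z : C) : C := (cexp (RtoC (PI ^ 2 / 4) / z) * CInt (gauss z) 0 (1 / 2))%C.

Lemma Re_RtoC_div a (z : C) : Re (RtoC a / z)%C = a * Re (/ z).
Proof. unfold Cdiv. apply Re_RtoC_mult. Qed.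

Lemma cexp_gauss_half z : (cexp (RtoC (PI ^ 2 / 4) / z) * gauss z (1 / 2) = 1)%C.
Proof.
  unfold gauss. rewrite <- cexp_plus, <- cexp_0. f_equal.
  replace (RtoC (PI ^ 2 / 4)) with (RtoC (PI ^ 2) * RtoC ((1 / 2) ^ 2))%C
    by (rewrite <- RtoC_mult; f_equal; field).
  unfold Cdiv. ring.
Qed.

(** Relative to the first term, the [k]-th has modulus [e^(- b k (k + 1)) <= e^(- 2 b k)], a
    geometric series. The hypothesis on [Re (/ z)] gives [b >= 4.8] and a ratio at most [1/2]. *)
Lemma gauss_half_sum_leading z L : 0 < Re z -> 1 / 2 <= Re (/ z) -> (1 <= L)%nat ->
  Cmod (cexp (RtoC (PI ^ 2 / 4) / z) * gauss_half_sum z L - 1)%C <= 2 * exp (- (2 * PI ^ 2 * Re (/ z))).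
Proof.
  intros Hz Hr HL. destruct L as [|L]; [lia|].
  unfold gauss_half_sum. rewrite csum_split_first. simpl (INR 0).
  replace (0 + 1 / 2) with (1 / 2) by ring.
  rewrite Cmult_plus_distr_l, cexp_gauss_half.
  match goal with |- Cmod ?u <= _ => replace u with
    (cexp (RtoC (PI ^ 2 / 4) / z) * csum (fun i => gauss z (INR (S i) + 1 / 2)%R) L)%C by ring end.
  set (b := PI ^ 2 * Re (/ z)).
  assert (Hb : 4.8 <= b).
  { unfold b. generalize PI_bounds_coarse. intros HP. assert (9.6 <= PI ^ 2) by nra. nra. }
  set (x := exp (- (2 * b))).
  assert (Hx : 0 < x <= 1 / 2).
  { unfold x. split; [apply exp_pos|]. rewrite exp_Ropp. apply Rle_trans with (/ 2); [|lra].
    apply Rinv_le_contravar; [lra|]. generalize (exp_ineq1_le (2 * b)). lra. }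
  rewrite <- csum_scal. eapply Rle_trans.
  - apply Cmod_csum_le with (v := fun i => x * x ^ i). intros i _.
    rewrite Cmod_mult, Cmod_cexp, Re_RtoC_div, Cmod_gauss, <- exp_plus. unfold x at 1 2.
    rewrite exp_pow_INR, <- exp_plus. apply exp_le_compat. fold b. rewrite S_INR.
    replace (PI ^ 2 / 4 * Re (/ z)) with (b / 4) by (unfold b; field).
    assert (Hi := pos_INR i). assert (0 <= b * INR i) by nra. assert (0 <= b * INR i ^ 2) by nra. nra.
  - rewrite rsum_scal.
    assert (Hg := rsum_geom_le x L ltac:(lra)).
    assert (/ (1 - x) <= 2).
    { apply Rle_trans with (/ (1 / 2)); [apply Rinv_le_contravar; lra|lra]. }
    replace (2 * PI ^ 2 * Re (/ z)) with (2 * b) by (unfold b; ring). fold x.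
    change (rsum (fun k => x ^ k) L) with (rsum (pow x) L) in Hg.
    apply Rle_trans with (x * 2); [apply Rmult_le_compat_l; lra|lra].
Qed.

(** Let [w = e^(pi^2 / (4 z))], [T] the sum over half-integers, [J] the Gaussian integral. Since
    [P T] is nearly [J], [P (1 + eta)] is nearly [w J], with [eta] of order [e^(-2 b)]. As [P] is
    only of order [e^(b/4)], [P eta] is bounded, and so is the part of [w J] beyond [s = 1/2]. The
    three errors are at most 1, 2 and 0.21. *)
Lemma main_arc_approximation z P : 0 < Re z -> 1 / 2 <= Re (/ z) ->
  Clim (fun N => ovp_prod N (cexp (- z))) P -> Cmod (P - main_term z) <= 5.
Proof.
  intros Hz Hr HP.
  set (b := PI ^ 2 * Re (/ z)).
  assert (Hb : 4.8 <= b).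
  { unfold b. generalize PI_bounds_coarse. intros HPI. assert (9.6 <= PI ^ 2) by nra. nra. }
  set (w := cexp (RtoC (PI ^ 2 / 4) / z)).
  assert (Hw : Cmod w = exp (b / 4)).
  { unfold w. rewrite Cmod_cexp, Re_RtoC_div. f_equal. unfold b. field. }
  assert (Hw0 := exp_pos (b / 4)).
  (* This tolerance leaves an error of at most 1 after multiplication by [w], whose modulus is
     [e^(b/4)]. *)
  destruct (modular_limit z P Hz HP (/ exp (b / 4))) as [L [HL Heps]].
  { apply Rinv_0_lt_compat; easy. }
  assert (HL1 : 1 <= INR L) by (apply (le_INR 1); easy).
  assert (Heta := gauss_half_sum_leading z L Hz Hr HL). fold w in Heta.
  assert (HJ := gauss_integral_bound z L Hz HL). fold b in HJ.
  assert (Htail := gauss_tail_bound z (INR L) Hz ltac:(lra)). fold b in Htail.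
  assert (Hsplit := gauss_integral_split z L HL).
  unfold main_term. fold w.
  set (T := gauss_half_sum z L) in *. set (J := CInt (gauss z) 0 (INR L)) in *.
  set (J0 := CInt (gauss z) 0 (1 / 2)) in *. set (J1 := CInt (gauss z) (1 / 2) (INR L)) in *.
  set (eta := (w * T - 1)%C) in *.
  replace (2 * PI ^ 2 * Re (/ z)) with (2 * b) in Heta by (unfold b; ring).
  assert (Hib : / b <= / 4.8) by (apply Rinv_le_contravar; lra).
  assert (HA : Cmod (w * (P * T - J))%C <= 1).
  { rewrite Cmod_mult, Hw. apply Rle_trans with (exp (b / 4) * / exp (b / 4)).
    - apply Rmult_le_compat_l; lra.
    - rewrite Rinv_r; lra. }
  assert (HB : Cmod (w * J1)%C <= 0.21).
  { rewrite Cmod_mult, Hw. apply Rle_trans with (exp (b / 4) * (exp (- (b / 4)) / b)).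
    - apply Rmult_le_compat_l; lra.
    - unfold Rdiv. rewrite <- Rmult_assoc, <- exp_plus.
      replace (b * / 4 + - (b * / 4)) with 0 by ring. rewrite exp_0. lra. }
  assert (Hexp : exp (b / 4) * exp (- (2 * b)) <= 1 / 9).
  { rewrite <- exp_plus. apply Rle_trans with (exp (- (8))); [apply exp_le_compat; lra|].
    rewrite exp_Ropp. apply Rle_trans with (/ 9); [|lra].
    apply Rinv_le_contravar; [lra|]. generalize (exp_ineq1_le 8). lra. }
  assert (He1 : 1 <= exp (b / 4)) by (rewrite <- exp_0; apply exp_le_compat; lra).
  assert (Hx0 := exp_pos (- (2 * b))).
  assert (Heta1 : Cmod eta <= 2 / 9) by nra.
  assert (Heta2 : exp (b / 4) * Cmod eta <= 2 / 9) by nra.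
  (* A crude bound on [P] suffices to control [P eta]; 0.71 exceeds [1/2 + 1 / 4.8], the bound for
     [J]. *)
  assert (HP1 : Cmod P <= 2 * (exp (b / 4) * 0.71 + 1)).
  { assert (H1 : Cmod (P * (1 + eta)) <= exp (b / 4) * 0.71 + 1).
    { replace (P * (1 + eta))%C with (w * J + w * (P * T - J))%C by (unfold eta; ring).
      eapply Rle_trans; [apply Cmod_triangle|]. apply Rplus_le_compat; [|easy].
      rewrite Cmod_mult, Hw. apply Rmult_le_compat_l; lra. }
    assert (H2 : 1 / 2 <= Cmod (1 + eta)).
    { assert (H := Cmod_le_plus_diff 1 (1 + eta)).
      replace (1 - (1 + eta))%C with (- eta)%C in H by ring. rewrite Cmod_1, Cmod_opp in H. lra. }
    rewrite Cmod_mult in H1. generalize (Cmod_ge_0 P). nra. }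
  assert (HC : Cmod (P * eta) <= 2).
  { rewrite Cmod_mult. generalize (Cmod_ge_0 eta) (Cmod_ge_0 P). nra. }
  replace (P - w * J0)%C with (w * (P * T - J) + (w * J1 - P * eta))%C.
  - eapply Rle_trans; [apply Cmod_triangle|].
    assert (Cmod (w * J1 - P * eta) <= Cmod (w * J1) + Cmod (P * eta)).
    { unfold Cminus. eapply Rle_trans; [apply Cmod_triangle|]. rewrite Cmod_opp. lra. }
    lra.
  - rewrite Hsplit. unfold eta. ring.
Qed.

Lemma Cmod_main_term_le z : 0 < Re z -> Cmod (main_term z) <= exp (PI ^ 2 / 4 * Re (/ z)) / 2.
Proof.
  intros Hz. unfold main_term. rewrite Cmod_mult, Cmod_cexp, Re_RtoC_div.
  generalize (gauss_head_bound z Hz) (exp_pos (PI ^ 2 / 4 * Re (/ z))). nra.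
Qed.

(** * Expansion of the main term *)

Definition cexp_partial (w : C) (K : nat) (s : R) : C :=
  csum (fun k => w ^ k * RtoC (s ^ k / INR (fact k)))%C K.

Lemma Cder_cexp_partial (w : C) K : Cder (cexp_partial w (S K)) (fun s => w * cexp_partial w K s)%C.
Proof.
  induction K as [|K IH].
  - eapply Cder_ext; [|apply (Cder_const (0 + 1 * RtoC (1 / 1))%C)].
    intros x. unfold cexp_partial. simpl. ring.
  - change (cexp_partial w (S (S K))) with
      (fun s => (cexp_partial w (S K) s + w ^ S K * RtoC (s ^ S K / INR (fact (S K))))%C).
    eapply Cder_ext.
    2: { apply Cder_plus; [exact IH|]. apply Cder_scal.
         apply (Cder_RtoC _ _ (is_derive_pow_fact K)). }
    intros x. cbv beta. change (cexp_partial w (S K) x) with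
      (cexp_partial w K x + w ^ K * RtoC (x ^ K / INR (fact K)))%C.
    rewrite Cpow_S. ring.
Qed.

Lemma Re_ge_opp_Cmod (w : C) : - Cmod w <= Re w.
Proof. generalize (re_le_Cmod w). intros H. apply Rabs_le_between in H. lra. Qed.

(** The derivative of [e^(-w s)] times the Taylor polynomial of [e^(w s)] reduces to a single term,
    to which the mean value bound on [[0, 1]] applies. *)
Lemma cexp_taylor_remainder (w : C) K :
  Cmod (cexp w - csum (fun k => w ^ k * / INR (fact k))%C (S K))
  <= 2 * (Cmod w ^ S K / INR (fact K)) * exp (2 * Cmod w).
Proof.
  assert (Hd : Cder (fun s => cexp (- w * RtoC s) * cexp_partial w (S K) s)%C
    (fun s => - w * (w ^ K * RtoC (s ^ K / INR (fact K)) * cexp (- w * RtoC s)))%C).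
  { eapply Cder_ext.
    2: { apply Cder_mult; [apply Cder_cexp_lin|apply Cder_cexp_partial]. }
    intros s. cbv beta. change (cexp_partial w (S K) s) with
      (cexp_partial w K s + w ^ K * RtoC (s ^ K / INR (fact K)))%C. ring. }
  assert (Hw := Cmod_ge_0 w).
  assert (H := Cder_bound _ _ 0 1 (Cmod w ^ S K / INR (fact K) * exp (Cmod w)) ltac:(lra) Hd).
  cbv beta in H.
  assert (H0 : cexp_partial w (S K) 0 = 1).
  { unfold cexp_partial. rewrite csum_split_first.
    rewrite (csum_ext _ (fun _ => 0 * 0)%C), csum_scal.
    - simpl. replace (1 / 1) with 1 by field. ring.
    - intros i _. replace (0 ^ S i / INR (fact (S i))) with 0; [ring|].
      rewrite pow_i by lia. unfold Rdiv; ring. }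
  assert (H1 : cexp_partial w (S K) 1 = csum (fun k => w ^ k * / INR (fact k))%C (S K)).
  { unfold cexp_partial. apply csum_ext. intros i _. rewrite pow1. unfold Rdiv.
    rewrite Rmult_1_l, RtoC_inv by apply INR_fact_neq_0. easy. }
  rewrite H0, H1 in H.
  replace (- w * 0)%C with (RtoC 0) in H by ring. rewrite cexp_0 in H.
  replace (- w * 1)%C with (- w)%C in H by ring.
  set (S0 := csum (fun k => w ^ k * / INR (fact k))%C (S K)) in *.
  replace (cexp w - S0)%C with (- (cexp w * (cexp (- w) * S0 - 1 * 1)))%C.
  2: { transitivity (cexp w - (cexp w * cexp (- w)) * S0)%C; [ring|]. rewrite cexp_opp. ring. }
  rewrite Cmod_opp, Cmod_mult, Cmod_cexp.
  assert (Hc : exp (Re w) <= exp (Cmod w)).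
  { apply exp_le_compat. eapply Rle_trans; [apply Rle_abs|apply re_le_Cmod]. }
  assert (Hf : 0 <= Cmod w ^ S K / INR (fact K)).
  { apply Rmult_le_pos; [apply pow_le; easy|left; apply fact_inv_pos]. }
  apply Rle_trans with (exp (Cmod w) * (2 * (Cmod w ^ S K / INR (fact K) * exp (Cmod w)) * (1 - 0))).
  - apply Rmult_le_compat; [left; apply exp_pos|apply Cmod_ge_0|easy|].
    apply H. intros s Hs. rewrite !Cmod_mult, Cmod_opp, Cmod_cexp, Cmod_pow, Cmod_R.
    rewrite Rabs_right.
    2: { apply Rle_ge, Rmult_le_pos; [apply pow_le; lra|left; apply fact_inv_pos]. }
    assert (He : exp (Re (- w * RtoC s)%C) <= exp (Cmod w)).
    { apply exp_le_compat. replace (Re (- w * RtoC s)%C) with (s * - Re w) by (unfold Re; simpl; ring).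
      generalize (Re_ge_opp_Cmod w). nra. }
    assert (Hs1 : s ^ K / INR (fact K) <= / INR (fact K)).
    { unfold Rdiv. rewrite <- (Rmult_1_l (/ INR (fact K))) at 2.
      apply Rmult_le_compat_r; [left; apply fact_inv_pos|].
      rewrite <- (pow1 K). apply pow_incr; easy. }
    assert (Hs0 : 0 <= s ^ K / INR (fact K)).
    { apply Rmult_le_pos; [apply pow_le; lra|left; apply fact_inv_pos]. }
    assert (Hp : 0 <= Cmod w ^ K) by (apply pow_le; easy).
    replace (Cmod w ^ S K / INR (fact K) * exp (Cmod w)) with
      (Cmod w * ((Cmod w ^ K * / INR (fact K)) * exp (Cmod w))) by (simpl; field; apply INR_fact_neq_0).
    apply Rmult_le_compat_l; [easy|].
    apply Rmult_le_compat; [apply Rmult_le_pos; easy|left; apply exp_pos| |easy].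
    apply Rmult_le_compat_l; easy.
  - replace (2 * Cmod w) with (Cmod w + Cmod w) by ring. rewrite exp_plus. right; ring.
Qed.

Definition beta_weight (s : R) : R := PI ^ 2 * (1 / 4 - s ^ 2).

(** The coefficient of [1 / z^k] in the main term, a Beta integral. The power series in [n] that
    results is that of the modified Bessel function of order [3/2], which is elementary. *)
Definition bessel_coef (k : nat) : R := PI ^ (2 * k) * INR (fact k) / (2 * INR (fact (2 * k + 1))).

Lemma continuous_quarter_pow k x : continuous (fun s => (1 / 4 - s ^ 2) ^ k) x.
Proof. apply (ex_derive_continuous (fun s => (1 / 4 - s ^ 2) ^ k)). auto_derive. easy. Qed.

(** Integrating the derivative of [s (1/4 - s^2)^(k+1)], a function vanishing at both ends, gives
    [(2 k + 3) I_(k+1) = (k + 1) / 2 * I_k]. *)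
Lemma RInt_quarter_pow k :
  RInt (fun s => (1 / 4 - s ^ 2) ^ k) 0 (1 / 2) = INR (fact k) ^ 2 / (2 * INR (fact (2 * k + 1))).
Proof.
  induction k as [|k IH].
  - rewrite (RInt_ext _ (fun _ => 1)) by (intros; easy).
    rewrite RInt_const. unfold scal; simpl; unfold mult; simpl. lra.
  - assert (E : RInt (fun s => (2 * INR (S k) + 1) * (1 / 4 - s ^ 2) ^ S k + (- (INR (S k) / 2)) * (1 / 4 - s ^ 2) ^ k) 0 (1 / 2)
       = (1 / 2) * (1 / 4 - (1 / 2) ^ 2) ^ S k - 0 * (1 / 4 - 0 ^ 2) ^ S k).
    { apply is_RInt_unique.
      apply (is_RInt_derive (fun s => s * (1 / 4 - s ^ 2) ^ S k)).
      - intros x _.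
        assert (Ed : is_derive (fun s => s * (1 / 4 - s ^ 2) ^ S k) x
            (1 * (1 / 4 - x ^ 2) ^ S k + x * (INR (S k) * (- (2 * x)) * (1 / 4 - x ^ 2) ^ k))).
        { eapply is_derive_mult_R; [apply (is_derive_id (K := R_AbsRing))| |reflexivity].
          apply (is_derive_pow (fun s => 1 / 4 - s ^ 2) (S k) x (- (2 * x))).
          auto_derive; auto; ring. }
        replace ((2 * INR (S k) + 1) * (1 / 4 - x ^ 2) ^ S k + - (INR (S k) / 2) * (1 / 4 - x ^ 2) ^ k) with
          (1 * (1 / 4 - x ^ 2) ^ S k + x * (INR (S k) * (- (2 * x)) * (1 / 4 - x ^ 2) ^ k)); [exact Ed|].
        generalize (INR (S k)). intros m. change ((1 / 4 - x ^ 2) ^ S k) with ((1 / 4 - x ^ 2) * (1 / 4 - x ^ 2) ^ k). field.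
      - intros x _. apply (continuous_plus (V := R_NormedModule)
         (fun s => (2 * INR (S k) + 1) * (1 / 4 - s ^ 2) ^ S k) (fun s => - (INR (S k) / 2) * (1 / 4 - s ^ 2) ^ k)).
        + apply (continuous_scal_r (V := R_NormedModule) _ (fun s => (1 / 4 - s ^ 2) ^ S k)), continuous_quarter_pow.
        + apply (continuous_scal_r (V := R_NormedModule) _ (fun s => (1 / 4 - s ^ 2) ^ k)), continuous_quarter_pow. }
    rewrite RInt_lin2, IH in E by (intros; apply continuous_quarter_pow).
    replace (1 / 4 - (1 / 2) ^ 2) with 0 in E by field.
    rewrite pow_i in E by lia.
    set (I := RInt (fun s => (1 / 4 - s ^ 2) ^ S k) 0 (1 / 2)) in *.
    assert (Hm := pos_INR k).
    replace (2 * S k + 1)%nat with (S (S (2 * k + 1))) by lia.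
    change (fact (S (S (2 * k + 1)))) with ((S (S (2 * k + 1))) * ((S (2 * k + 1)) * fact (2 * k + 1)))%nat.
    change (fact (S k)) with ((S k) * fact k)%nat.
    rewrite !mult_INR.
    replace (INR (S (S (2 * k + 1)))) with (2 * INR k + 3) by (rewrite !S_INR, plus_INR, mult_INR; simpl; ring).
    replace (INR (S (2 * k + 1))) with (2 * INR k + 2) by (rewrite !S_INR, plus_INR, mult_INR; simpl; ring).
    rewrite S_INR in *.
    apply Rmult_eq_reg_l with (2 * (INR k + 1) + 1); [|lra].
    assert (E2 : (2 * (INR k + 1) + 1) * I = (INR k + 1) / 2 * (INR (fact k) ^ 2 / (2 * INR (fact (2 * k + 1))))) by lra.
    rewrite E2. field. repeat split; try lra; apply INR_fact_neq_0.
Qed.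

Lemma continuous_beta_pow k x : continuous (fun s => beta_weight s ^ k / INR (fact k)) x.
Proof.
  apply (ex_derive_continuous (fun s => beta_weight s ^ k / INR (fact k))). unfold beta_weight. auto_derive. easy.
Qed.

Lemma RInt_beta_weight k : RInt (fun s => beta_weight s ^ k / INR (fact k)) 0 (1 / 2) = bessel_coef k.
Proof.
  rewrite (RInt_ext _ (fun s => PI ^ (2 * k) / INR (fact k) * (1 / 4 - s ^ 2) ^ k)).
  - rewrite RInt_scal_R by apply continuous_quarter_pow. rewrite RInt_quarter_pow.
    unfold bessel_coef. match goal with |- ?a = ?b => change (@eq R a b) end.
    field. split; apply INR_fact_neq_0.
  - intros x _. unfold beta_weight. rewrite Rpow_mult_distr, <- pow_mult.
    match goal with |- ?a = ?b => change (@eq R a b) end. field. apply INR_fact_neq_0.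
Qed.

Lemma beta_weight_bounds s : 0 <= s <= 1 / 2 -> 0 <= beta_weight s <= PI ^ 2 / 4.
Proof.
  intros Hs. unfold beta_weight. assert (0 <= PI ^ 2) by apply pow2_ge_0.
  assert (0 <= 1 / 4 - s ^ 2 <= 1 / 4) by nra. nra.
Qed.

Lemma bessel_coef_pos k : 0 < bessel_coef k.
Proof.
  unfold bessel_coef. apply Rdiv_lt_0_compat.
  - apply Rmult_lt_0_compat; [apply pow_lt, PI_RGT_0|apply INR_fact_lt_0].
  - generalize (INR_fact_lt_0 (2 * k + 1)). lra.
Qed.

(** Under the integral stands a partial sum of [exp (V * beta)], with [0 <= beta <= pi^2 / 4] on an
    interval of length [1/2]. *)
Lemma bessel_coef_sum_le V K : 0 <= V ->
  rsum (fun k => bessel_coef k * V ^ k) K <= exp (PI ^ 2 / 4 * V) / 2.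
Proof.
  intros HV.
  assert (Hc : forall k x, continuous (fun s => V ^ k * (beta_weight s ^ k / INR (fact k))) x).
  { intros k x. apply (continuous_scal_r (V := R_NormedModule) _ (fun s => beta_weight s ^ k / INR (fact k))).
    apply continuous_beta_pow. }
  rewrite (rsum_ext _ (fun k => RInt (fun s => V ^ k * (beta_weight s ^ k / INR (fact k))) 0 (1 / 2))).
  2: { intros k _. rewrite RInt_scal_R, RInt_beta_weight by (intros; apply continuous_beta_pow). apply Rmult_comm. }
  rewrite <- (RInt_rsum (fun k s => V ^ k * (beta_weight s ^ k / INR (fact k)))) by easy.
  replace (exp (PI ^ 2 / 4 * V) / 2) with (RInt (fun _ => exp (PI ^ 2 / 4 * V)) 0 (1 / 2)).
  2: { rewrite RInt_const. unfold scal; simpl; unfold mult; simpl. field. }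
  apply RInt_le; [lra| | |].
  - apply continuous_ex_RInt. intros x. apply continuous_rsum with (u := fun k s => V ^ k * (beta_weight s ^ k / INR (fact k))). auto.
  - apply continuous_ex_RInt. intros; apply continuous_const.
  - intros s Hs. destruct (beta_weight_bounds s) as [H1 H2]; [lra|].
    rewrite (rsum_ext _ (fun k => (beta_weight s * V) ^ k / INR (fact k))).
    + eapply Rle_trans; [apply exp_partial_sum_le; nra|]. apply exp_le_compat. nra.
    + intros k _. rewrite Rpow_mult_distr. field. apply INR_fact_neq_0.
Qed.

Lemma main_term_integral (z : C) : main_term z = CInt (fun s => cexp (RtoC (beta_weight s) / z))%C 0 (1 / 2).
Proof.
  unfold main_term. rewrite <- CInt_scal by apply Ccont_gauss. apply CInt_ext. intros s.
  unfold gauss. rewrite <- cexp_plus. f_equal. unfold beta_weight, Cdiv.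
  replace (PI ^ 2 * (1 / 4 - s ^ 2)) with (PI ^ 2 / 4 - PI ^ 2 * s ^ 2) by field.
  rewrite RtoC_minus, !RtoC_mult. ring.
Qed.

(** A Taylor remainder of [e^w] for [|w| <= x]; what matters is that it increases in [x] and
    vanishes as [K] grows. *)
Definition bessel_remainder (x : R) (K : nat) : R :=
  2 * (x ^ S K / INR (fact K)) * exp (2 * x).

Lemma main_term_expansion (z : C) K : z <> 0 ->
  Cmod (main_term z - csum (fun k => bessel_coef k * / z ^ k)%C (S K))
  <= bessel_remainder (PI ^ 2 / 4 * / Cmod z) K.
Proof.
  intros Hz. assert (HC : 0 < Cmod z) by (apply Cmod_gt_0; easy).
  assert (HiC : 0 < / Cmod z) by (apply Rinv_0_lt_compat; easy).
  assert (Cb : forall x, continuous beta_weight x).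
  { intros x. apply (ex_derive_continuous beta_weight). unfold beta_weight. auto_derive. easy. }
  assert (C0 : forall k, Ccont (fun s => RtoC (beta_weight s ^ k / INR (fact k)))).
  { intros k. apply Ccont_RtoC, continuous_beta_pow. }
  assert (C1 : forall k, Ccont (fun s => / z ^ k * RtoC (beta_weight s ^ k / INR (fact k)))%C).
  { intros k. apply Ccont_mult; [apply Ccont_const|apply C0]. }
  set (S0 := fun s => csum (fun k => / z ^ k * RtoC (beta_weight s ^ k / INR (fact k)))%C (S K)).
  assert (C2 : Ccont S0) by (apply (Ccont_csum (fun k s => / z ^ k * RtoC (beta_weight s ^ k / INR (fact k)))%C); easy).
  assert (C3 : Ccont (fun s => cexp (RtoC (beta_weight s) / z)%C)).
  { apply Ccont_cexp. unfold Cdiv. apply Ccont_mult; [apply Ccont_RtoC; easy|apply Ccont_const]. }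
  assert (C4 : Ccont (fun s => - (1) * S0 s)%C) by (apply Ccont_mult; [apply Ccont_const|easy]).
  rewrite main_term_integral.
  replace (csum (fun k => bessel_coef k * / z ^ k)%C (S K)) with (CInt S0 0 (1 / 2)).
  2: { unfold S0. rewrite (CInt_csum (fun k s => / z ^ k * RtoC (beta_weight s ^ k / INR (fact k)))%C) by easy.
       apply csum_ext. intros k _.
       rewrite (CInt_scal _ (fun s => RtoC (beta_weight s ^ k / INR (fact k)))) by easy.
       rewrite CInt_RtoC, RInt_beta_weight by (intros; apply continuous_beta_pow). ring. }
  replace (CInt (fun s => cexp (RtoC (beta_weight s) / z)%C) 0 (1 / 2) - CInt S0 0 (1 / 2))%C
    with (CInt (fun s => cexp (RtoC (beta_weight s) / z) + - (1) * S0 s)%C 0 (1 / 2)).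
  2: { rewrite (CInt_plus (fun s => cexp (RtoC (beta_weight s) / z)%C) (fun s => - (1) * S0 s)%C) by easy.
       rewrite (CInt_scal (- (1)) S0) by easy. ring. }
  set (M := bessel_remainder (PI ^ 2 / 4 * / Cmod z) K).
  assert (HPI : 0 <= PI ^ 2 / 4) by (generalize (pow2_ge_0 PI); lra).
  assert (HM : 0 <= M).
  { unfold M, bessel_remainder. apply Rmult_le_pos; [|left; apply exp_pos].
    apply Rmult_le_pos; [lra|]. apply Rmult_le_pos; [|left; apply fact_inv_pos].
    apply pow_le. apply Rmult_le_pos; lra. }
  apply Rle_trans with (RInt (fun _ => M) 0 (1 / 2)).
  - apply Cmod_CInt_le; [lra| |intros; apply continuous_const|].
    + apply (Ccont_plus (fun s => cexp (RtoC (beta_weight s) / z)%C) (fun s => - (1) * S0 s)%C); easy.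
    + intros s Hs. destruct (beta_weight_bounds s Hs) as [H1 H2].
      set (w := (RtoC (beta_weight s) / z)%C).
      assert (HS : S0 s = csum (fun k => w ^ k * / INR (fact k))%C (S K)).
      { apply csum_ext. intros k _. unfold w, Cdiv. rewrite Cpow_mult_l, Cpow_inv by easy.
        rewrite RtoC_div, RtoC_pow by apply INR_fact_neq_0. unfold Cdiv. ring. }
      rewrite HS.
      replace (cexp w + - (1) * csum (fun k => w ^ k * / INR (fact k))%C (S K))%C with
        (cexp w - csum (fun k => w ^ k * / INR (fact k))%C (S K))%C by ring.
      eapply Rle_trans; [apply cexp_taylor_remainder|].
      assert (Hw : 0 <= Cmod w <= PI ^ 2 / 4 * / Cmod z).
      { split; [apply Cmod_ge_0|]. unfold w. rewrite Cmod_div, Cmod_R, Rabs_right by (easy || lra).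
        unfold Rdiv at 1. apply Rmult_le_compat_r; lra. }
      unfold M, bessel_remainder.
      apply Rmult_le_compat; [|left; apply exp_pos| |apply exp_le_compat; lra].
      * apply Rmult_le_pos; [lra|]. apply Rmult_le_pos; [apply pow_le; lra|left; apply fact_inv_pos].
      * apply Rmult_le_compat_l; [lra|]. apply Rmult_le_compat_r; [left; apply fact_inv_pos|].
        apply pow_incr; easy.
  - rewrite RInt_const. unfold scal; simpl; unfold mult; simpl. lra.
Qed.

Lemma lim_bessel_remainder x : 0 <= x -> is_lim_seq (bessel_remainder x) 0.
Proof.
  intros Hx.
  assert (H : is_lim_seq (fun k => x ^ k / INR (fact k)) 0).
  { assert (Hs := exp_series_lim x). apply rsum_lim_iff_series in Hs.
    apply ex_series_lim_0. eexists; apply Hs. }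
  apply is_lim_seq_ext with (fun K => 2 * x * exp (2 * x) * (x ^ K / INR (fact K))).
  - intros n. unfold bessel_remainder. simpl. field. apply INR_fact_neq_0.
  - apply lim_seq_scal0; easy.
Qed.

Lemma bessel_remainder_mono x y K : 0 <= x <= y -> bessel_remainder x K <= bessel_remainder y K.
Proof.
  intros H. unfold bessel_remainder.
  apply Rmult_le_compat; [|left; apply exp_pos| |apply exp_le_compat; lra].
  - apply Rmult_le_pos; [lra|]. apply Rmult_le_pos; [apply pow_le; lra|left; apply fact_inv_pos].
  - apply Rmult_le_compat_l; [lra|]. apply Rmult_le_compat_r; [left; apply fact_inv_pos|].
    apply pow_incr; easy.
Qed.

(** Only finitely many powers of [1 / z] are matched: the estimates on the circle hold for every
    [K], and [K] tends to infinity in the final inequality for one coefficient. *)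
Definition bessel_partial (K n : nat) : R := rsum (fun m => bessel_coef (S m) * power_coef m n) K.

Lemma bessel_partial_lim n : (0 < n)%nat ->
  is_lim_seq (fun K => bessel_partial K n) ((cosh (mu n) - sinh (mu n) / mu n) / (4 * INR n)).
Proof.
  intros Hn. assert (HnR : 0 < INR n) by (apply lt_0_INR; easy).
  set (x := mu n).
  assert (Hx2 : x ^ 2 = PI ^ 2 * INR n).
  { unfold x, mu. rewrite Rpow_mult_distr, pow2_sqrt by lra. easy. }
  assert (Hx : 0 < x).
  { unfold x, mu. apply Rmult_lt_0_compat; [apply PI_RGT_0|apply sqrt_lt_R0; easy]. }
  set (X := fun K => rsum (fun l => x ^ l / INR (fact l)) (2 * K)).
  set (Y := fun K => rsum (fun l => (- x) ^ l / INR (fact l)) (2 * K)).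
  assert (HX : is_lim_seq X (exp x)).
  { apply (is_lim_seq_subseq _ _ (fun K => (2 * K)%nat)); [|apply exp_series_lim].
    apply eventually_subseq. intros; lia. }
  assert (HY : is_lim_seq Y (exp (- x))).
  { apply (is_lim_seq_subseq _ _ (fun K => (2 * K)%nat)); [|apply exp_series_lim].
    apply eventually_subseq. intros; lia. }
  (* [S K] because the coefficients start at index 1: for [K = 0] the terms [1] and [x] of the
     exponential series contribute [1 - 1 = 0]. *)
  assert (E : forall K, bessel_partial K n =
    ((X (S K) + Y (S K)) / 2 - (X (S K) - Y (S K)) / (2 * x)) / (4 * INR n)).
  { intros K. unfold bessel_partial. induction K as [|K IH].
    - unfold X, Y. simpl. field. lra.
    - cbn [rsum]. rewrite IH. unfold X, Y. replace (2 * S (S K))%nat with (S (S (2 * S K))) by lia. cbn [rsum].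
      set (a := rsum _ (2 * S K)). set (b := rsum _ (2 * S K)).
      assert (H1 : (- x) ^ (2 * S K) = x ^ (2 * S K)) by (rewrite !pow_mult; f_equal; ring).
      assert (H2 : (- x) ^ S (2 * S K) = - x * x ^ (2 * S K)) by (change ((- x) ^ S (2 * S K)) with (- x * (- x) ^ (2 * S K)); rewrite H1; easy).
      change (x ^ S (2 * S K)) with (x * x ^ (2 * S K)). rewrite H1, H2.
      assert (H3 : x ^ (2 * S K) = PI ^ (2 * S K) * (INR n * INR n ^ K)).
      { rewrite !pow_mult, Hx2, Rpow_mult_distr. easy. }
      unfold bessel_coef, power_coef. rewrite H3.
      replace (2 * S K + 1)%nat with (S (2 * S K)) by lia.
      change (fact (S (2 * S K))) with (S (2 * S K) * fact (2 * S K))%nat.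
      change (fact (S K)) with (S K * fact K)%nat. rewrite !mult_INR.
      assert (F1 := INR_fact_neq_0 K). assert (F2 := INR_fact_neq_0 (2 * S K)).
      assert (F3 : INR (S (2 * S K)) = 2 * INR (S K) + 1) by (rewrite S_INR, mult_INR; simpl; ring).
      rewrite F3. assert (F4 := pos_INR (S K)). field. repeat split; try easy; lra. }
  apply is_lim_seq_ext with (fun K => ((X (S K) + Y (S K)) / 2 - (X (S K) - Y (S K)) / (2 * x)) / (4 * INR n));
    [intros; rewrite E; easy|].
  apply is_lim_seq_incr_1 in HX, HY.
  unfold cosh, sinh.
  replace (((exp x + exp (- x)) / 2 - (exp x - exp (- x)) / 2 / x) / (4 * INR n)) with
    (((exp x + exp (- x)) / 2 - (exp x - exp (- x)) / (2 * x)) / (4 * INR n)) by (field; lra).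
  unfold Rdiv. apply is_lim_seq_mult'; [|apply is_lim_seq_const].
  apply is_lim_seq_minus'; (apply is_lim_seq_mult'; [|apply is_lim_seq_const]).
  - apply is_lim_seq_plus'; easy.
  - apply is_lim_seq_minus'; easy.
Qed.

(** * Asymptotics of the overpartition function *)

Lemma Cmod_cexp_polar t theta : Cmod (cexp (- (t, theta))) = exp (- t).
Proof. rewrite Cmod_cexp. easy. Qed.

Lemma Cmod_one_minus_cexp_sqr t theta :
  Cmod (1 - cexp (- (t, theta))) ^ 2 = (1 - exp (- t)) ^ 2 + 4 * exp (- t) * sin (theta / 2) ^ 2.
Proof.
  rewrite Cmod2_alt. unfold cexp, Re, Im; simpl.
  rewrite cos_neg, sin_neg.
  assert (Hc : cos theta = 1 - 2 * sin (theta / 2) * sin (theta / 2)).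
  { replace theta with (2 * (theta / 2)) at 1 by field. apply cos_2a_sin. }
  assert (H := sin2_cos2 theta). unfold Rsqr in H.
  set (e := exp (- t)) in *. set (s := sin theta) in *.
  assert (Hs : s * s = 1 - cos theta * cos theta) by lra.
  replace ((1 + - (e * cos theta)) * ((1 + - (e * cos theta)) * 1) + (0 + - (e * - s)) * ((0 + - (e * - s)) * 1))
    with (1 - 2 * e * cos theta + e * e * (cos theta * cos theta + s * s)) by ring.
  rewrite Hs, Hc. ring.
Qed.

Lemma Re_geom_cexp (q : C) : q <> 1 ->
  Re (q / (1 - q))%C = (1 - Cmod q ^ 2) / (2 * Cmod (1 - q) ^ 2) - 1 / 2.
Proof.
  intros Hq.
  assert (H1 : (1 - q)%C <> 0).
  { intros E. apply Hq. replace q with (1 - (1 - q))%C by ring. rewrite E. ring. }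
  assert (H2 : 0 < Cmod (1 - q) ^ 2) by (apply pow_lt, Cmod_gt_0; easy).
  rewrite !Cmod2_alt in *. destruct q as [a b]. unfold Re, Im in *; simpl in *.
  field. lra.
Qed.

Lemma exp_neg_quadratic_le t : 0 <= t -> exp (- t) <= 1 - t + t ^ 2 / 2.
Proof.
  intros Ht. assert (H := exp_partial_sum_le t 3 Ht). simpl in H.
  rewrite exp_Ropp.
  apply Rmult_le_reg_l with (exp t); [apply exp_pos|]. rewrite Rinv_r by (generalize (exp_pos t); lra).
  assert (1 + t + t ^ 2 / 2 <= exp t) by lra.
  assert (0 <= 1 - t + t ^ 2 / 2) by nra.
  apply Rle_trans with ((1 + t + t ^ 2 / 2) * (1 - t + t ^ 2 / 2)); [nra|].
  apply Rmult_le_compat_r; easy.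
Qed.

(** The cut at [6 t] with [t <= 1/24] suits both arcs: inside, [|z|^2 <= 37 t^2] gives [|z| <= 0.4]
    and [Re (1 / z) >= 1/2]; outside, [|1 - q| >= 3.4 t], which brings the exponent [pi^2 / (4 t)]
    down by the factor 0.3. *)
Lemma minor_arc_gap t theta : 0 < t <= 1 / 24 -> 6 * t <= Rabs theta -> Rabs theta <= PI ->
  12.1 * t ^ 2 <= Cmod (1 - cexp (- (t, theta))) ^ 2.
Proof.
  intros Ht H1 H2. rewrite Cmod_one_minus_cexp_sqr.
  assert (He1 : 1 - t <= exp (- t)) by (generalize (exp_ineq1_le (- t)); lra).
  assert (He2 : exp (- t) <= 1 - t + t ^ 2 / 2) by (apply exp_neg_quadratic_le; lra).
  assert (Hs : (0.57 * (Rabs theta / 2)) ^ 2 <= sin (theta / 2) ^ 2).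
  { assert (Hpos : forall y, 0 <= y <= PI -> (0.57 * (y / 2)) ^ 2 <= sin (y / 2) ^ 2).
    { intros y Hy. apply pow_incr. split; [lra|]. apply sin_ge_linear. lra. }
    unfold Rabs in *; destruct (Rcase_abs theta).
    - replace (sin (theta / 2) ^ 2) with (sin (- theta / 2) ^ 2).
      + apply Hpos. lra.
      + replace (- theta / 2) with (- (theta / 2)) by field. rewrite sin_neg. ring.
    - apply Hpos. lra. }
  assert (Hs2 : 2.9 * t ^ 2 <= sin (theta / 2) ^ 2).
  { eapply Rle_trans; [|exact Hs]. assert (0 <= Rabs theta - 6 * t) by lra. nra. }
  assert (Ha : 0.97 * t <= 1 - exp (- t)) by nra.
  assert (Hb : 23 / 24 <= exp (- t)) by lra.
  assert ((0.97 * t) ^ 2 <= (1 - exp (- t)) ^ 2) by (apply pow_incr; lra).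
  assert (4 * (23 / 24) * (2.9 * t ^ 2) <= 4 * exp (- t) * sin (theta / 2) ^ 2).
  { apply Rmult_le_compat; nra. }
  nra.
Qed.

Lemma Re_inv_polar t theta : Re (/ (t, theta))%C = t / (t ^ 2 + theta ^ 2).
Proof. easy. Qed.

Lemma quarter_pi_sqr_bounds : 2.4 <= PI ^ 2 / 4 <= 2.56.
Proof. generalize PI_bounds_coarse. nra. Qed.

Lemma exp_quarter_pi_sqr : exp (PI ^ 2 / 4) <= 21.
Proof.
  apply Rle_trans with (exp (INR 3 * 1)).
  - apply exp_le_compat. generalize quarter_pi_sqr_bounds. simpl. lra.
  - rewrite <- exp_pow_INR. apply Rle_trans with (2.75 ^ 3); [|lra].
    apply pow_incr. generalize exp_1_lt (exp_pos 1). lra.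
Qed.

(** The main term is at most half of the right side; the other half, at least 29, absorbs the error
    5. *)
Lemma ovp_real_product_bound t P0 : 0 < t <= 1 / 24 ->
  Clim (fun N => ovp_prod N (RtoC (exp (- t)))) P0 -> Cmod P0 <= exp (PI ^ 2 / 4 * / t).
Proof.
  intros Ht HP.
  assert (E : cexp (- RtoC t) = RtoC (exp (- t))).
  { rewrite <- RtoC_opp. apply cexp_RtoC. }
  rewrite <- E in HP.
  assert (Hr : Re (/ RtoC t)%C = / t) by (rewrite <- RtoC_inv by lra; easy).
  assert (Hit : 24 <= / t).
  { replace 24 with (/ (1 / 24)) by field. apply Rinv_le_contravar; lra. }
  assert (H := main_arc_approximation (RtoC t) P0 ltac:(simpl; lra) ltac:(lra) HP).
  assert (H2 := Cmod_main_term_le (RtoC t) ltac:(simpl; lra)). rewrite Hr in H2.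
  assert (H3 := Cmod_le_plus_diff P0 (main_term (RtoC t))).
  assert (H4 := exp_ineq1_le (PI ^ 2 / 4 * / t)).
  assert (57 <= PI ^ 2 / 4 * / t) by (generalize quarter_pi_sqr_bounds; nra).
  lra.
Qed.

(** The exponent loses [2 (|q| / (1 - |q|) - Re (q / (1 - q)))], where the first quotient is at
    least [1 / t - 1] and the real part at most [1 / (12.1 t)]. As [2 (1 - 1 / 12.1) > 0.7 * 2.56],
    at most 0.3 of [pi^2 / (4 t)] is left, plus 2. *)
Lemma minor_arc_product_bound t theta P : 0 < t <= 1 / 24 -> 6 * t <= Rabs theta -> Rabs theta <= PI ->
  Clim (fun N => ovp_prod N (cexp (- (t, theta)))) P ->
  Cmod P <= exp (0.3 * (PI ^ 2 / 4 * / t) + 2).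
Proof.
  intros Ht H1 H2 HP.
  set (q := cexp (- (t, theta))) in *.
  assert (Hmod : Cmod q = exp (- t)) by apply Cmod_cexp_polar.
  assert (Hq : Cmod q < 1).
  { rewrite Hmod, <- exp_0. apply exp_increasing; lra. }
  assert (Hgap := minor_arc_gap t theta Ht H1 H2). fold q in Hgap.
  destruct (pbar_series_product (RtoC (Cmod q))) as [P0 [_ HP0]].
  { rewrite Cmod_R, Rabs_right; [easy|apply Rle_ge, Cmod_ge_0]. }
  assert (HB := ovp_prod_limit_minor_bound q P P0 Hq HP HP0).
  rewrite Hmod in HP0. assert (HP0b := ovp_real_product_bound t P0 Ht HP0).
  assert (Hit : 24 <= / t).
  { replace 24 with (/ (1 / 24)) by field. apply Rinv_le_contravar; lra. }
  assert (Hq1 : q <> 1).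
  { intros E. rewrite E, Cmod_1 in Hq. lra. }
  rewrite Re_geom_cexp in HB by easy. rewrite Hmod in HB.
  assert (Ha : / t - 1 <= exp (- t) / (1 - exp (- t))).
  { assert (He : 1 - t <= exp (- t)) by (generalize (exp_ineq1_le (- t)); lra).
    assert (He1 : exp (- t) < 1) by lra.
    apply Rmult_le_reg_r with (1 - exp (- t)); [lra|].
    unfold Rdiv. rewrite Rmult_assoc, Rinv_l by lra.
    apply Rmult_le_reg_l with t; [lra|].
    replace (t * ((/ t - 1) * (1 - exp (- t)))) with ((1 - t) * (1 - exp (- t))) by (field; lra).
    nra. }
  assert (Hb : (1 - exp (- t) ^ 2) / (2 * Cmod (1 - q) ^ 2) <= / 12.1 * / t).
  { assert (He : 1 - exp (- t) ^ 2 <= 2 * t).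
    { assert (1 - t <= exp (- t)) by (generalize (exp_ineq1_le (- t)); lra). nra. }
    assert (Hd : 0 < 12.1 * t ^ 2) by nra.
    assert (Hd0 : Cmod (1 - q) <> 0) by (intros E; rewrite E, pow_i in Hgap by lia; lra).
    apply Rle_trans with (2 * t / (2 * Cmod (1 - q) ^ 2)).
    - unfold Rdiv. apply Rmult_le_compat_r; [left; apply Rinv_0_lt_compat; lra|easy].
    - replace (2 * t / (2 * Cmod (1 - q) ^ 2)) with (t * / (Cmod (1 - q) ^ 2)) by (field; easy).
      apply Rle_trans with (t * / (12.1 * t ^ 2)).
      + apply Rmult_le_compat_l; [lra|]. apply Rinv_le_contravar; easy.
      + right. field. lra. }
  eapply Rle_trans; [apply HB|].
  apply Rle_trans with (exp (PI ^ 2 / 4 * / t) * exp (- 2 * (/ t - 1 - / 12.1 * / t))).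
  - apply Rmult_le_compat; [apply Cmod_ge_0|left; apply exp_pos|easy|].
    apply exp_le_compat. lra.
  - rewrite <- exp_plus. apply exp_le_compat.
    generalize quarter_pi_sqr_bounds. intros HPI.
    assert (0 <= (2.56 - PI ^ 2 / 4) * / t) by (apply Rmult_le_pos; lra). lra.
Qed.

(** With [V = 1 + / d], each [|L m|] is at most [V^m / d <= V^(m+1)], so positivity of the
    coefficients reduces the claim to the sum at [V]. *)
Lemma bessel_power_sums_bound q L K : is_power_series_sums q L -> Cmod q <= 1 -> 0 < Cmod (1 - q) ->
  Cmod (csum (fun m => bessel_coef (S m) * L m)%C K) <= exp (PI ^ 2 / 4 * (1 + / Cmod (1 - q))) / 2.
Proof.
  intros HL Hq Hd. set (d := Cmod (1 - q)) in *. set (V := 1 + / d).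
  assert (H0 : 0 < / d) by (apply Rinv_0_lt_compat; easy).
  assert (HV : 1 < V) by (unfold V; lra).
  eapply Rle_trans; [|apply (bessel_coef_sum_le V (S K)); lra].
  rewrite rsum_split_first.
  apply Rle_trans with (rsum (fun i => bessel_coef (S i) * V ^ S i) K).
  - apply Cmod_csum_le. intros m _. rewrite Cmod_mult, Cmod_R, Rabs_right by (generalize (bessel_coef_pos (S m)); lra).
    apply Rmult_le_compat_l; [left; apply bessel_coef_pos|].
    eapply Rle_trans; [apply (power_series_sums_bound q L V m); auto; [lra|apply exp_inv_le_of_gap; easy]|].
    fold d. assert (0 <= V ^ m) by (apply pow_le; lra). simpl. unfold Rdiv.
    rewrite (Rmult_comm V). apply Rmult_le_compat_l; [easy|unfold V; lra].
  - assert (0 < bessel_coef 0 * V ^ 0); [|lra].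
    apply Rmult_lt_0_compat; [apply bessel_coef_pos|simpl; lra].
Qed.

(** Each power sum is within 20 of [1 / z^(m+1)], which costs [20 * 21 / 2 = 210]; [P] is within 5
    of the main term; the constant [c_0 = 1/2], which has no counterpart among the power sums, is
    the rest. *)
Lemma major_arc_difference t theta P L K : 0 < t <= 1 / 24 -> Rabs theta <= 6 * t ->
  Clim (fun N => ovp_prod N (cexp (- (t, theta)))) P -> is_power_series_sums (cexp (- (t, theta))) L ->
  Cmod (P - csum (fun m => bessel_coef (S m) * L m) K)%C <= 216 + bessel_remainder (PI ^ 2 / 4 * / t) K.
Proof.
  intros Ht Htheta HP HL. set (z := (t, theta) : C) in *.
  assert (Hth2 : theta ^ 2 <= 36 * t ^ 2).
  { rewrite <- (pow2_abs theta). generalize (Rabs_pos theta). nra. }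
  assert (Hz : z <> 0) by (apply C_nz_of_Re_pos; simpl; lra).
  assert (Hz2 : Cmod z ^ 2 = t ^ 2 + theta ^ 2) by apply Cmod2_alt.
  assert (Hzpos : 0 < Cmod z) by (apply Cmod_gt_0; easy).
  assert (Hz4 : Cmod z <= 0.4).
  { destruct (Rle_dec (Cmod z) 0.4) as [H|H]; [easy|]. exfalso. nra. }
  assert (Hzt : t <= Cmod z).
  { destruct (Rle_dec t (Cmod z)) as [H|H]; [easy|]. exfalso.
    apply Rnot_le_lt in H. assert (K1 : 0 < (t - Cmod z) * (t + Cmod z)) by (apply Rmult_lt_0_compat; lra).
    replace ((t - Cmod z) * (t + Cmod z)) with (t ^ 2 - Cmod z ^ 2) in K1 by ring.
    generalize (pow2_ge_0 theta). lra. }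
  assert (Hre : 1 / 2 <= Re (/ z)%C).
  { unfold z. rewrite Re_inv_polar. assert (Hd : 0 < t ^ 2 + theta ^ 2) by (generalize (pow2_ge_0 theta); nra).
    apply Rmult_le_reg_r with (t ^ 2 + theta ^ 2); [easy|]. unfold Rdiv at 2.
    rewrite Rmult_assoc, Rinv_l by lra. nra. }
  assert (H1 := main_arc_approximation z P ltac:(simpl; lra) Hre HP).
  assert (H2 := main_term_expansion z K Hz).
  rewrite csum_split_first in H2.
  assert (H3 : bessel_remainder (PI ^ 2 / 4 * / Cmod z) K <= bessel_remainder (PI ^ 2 / 4 * / t) K).
  { apply bessel_remainder_mono. generalize quarter_pi_sqr_bounds; intros HPI.
    assert (0 < / Cmod z) by (apply Rinv_0_lt_compat; easy).
    assert (/ Cmod z <= / t) by (apply Rinv_le_contravar; lra). nra. }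
  assert (H4 : Cmod (csum (fun m => bessel_coef (S m) * (L m - / z ^ S m))%C K) <= 210).
  { eapply Rle_trans.
    - apply Cmod_csum_le with (v := fun m => 20 * (bessel_coef (S m) * 1 ^ S m)).
      intros m _. rewrite Cmod_mult, Cmod_R, Rabs_right by (generalize (bessel_coef_pos (S m)); lra).
      rewrite pow1, Rmult_1_r, Rmult_comm. apply Rmult_le_compat_r; [left; apply bessel_coef_pos|].
      apply power_sums_minus_pole_bound; auto. simpl; lra.
    - rewrite rsum_scal.
      assert (H := bessel_coef_sum_le 1 (S K) ltac:(lra)). rewrite rsum_split_first in H.
      assert (0 < bessel_coef 0 * 1 ^ 0) by (rewrite Rmult_1_r; apply bessel_coef_pos).
      replace (PI ^ 2 / 4 * 1) with (PI ^ 2 / 4) in H by ring. generalize exp_quarter_pi_sqr. lra. }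
  set (A := csum (fun i => bessel_coef (S i) * / z ^ S i)%C K) in *.
  set (B := csum (fun m => bessel_coef (S m) * (L m - / z ^ S m))%C K) in *.
  assert (HB : (csum (fun m => bessel_coef (S m) * L m) K = A + B)%C).
  { unfold A, B. rewrite <- csum_plus. apply csum_ext. intros; ring. }
  rewrite HB.
  set (c0 := (bessel_coef 0 * / z ^ 0)%C) in *.
  assert (Hc0 : Cmod c0 = 1 / 2).
  { unfold c0. replace (bessel_coef 0) with (1 / 2) by (unfold bessel_coef; simpl; field).
    simpl. replace (RtoC (1 / 2) * / 1)%C with (RtoC (1 / 2)) by (field; apply RtoC_neq; lra).
    rewrite Cmod_R, Rabs_right; lra. }
  replace (P - (A + B))%C with ((P - main_term z) + ((main_term z - (c0 + A)) + (c0 - B)))%C by ring.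
  eapply Rle_trans; [apply Cmod_triangle|].
  assert (Cmod ((main_term z - (c0 + A)) + (c0 - B)) <= bessel_remainder (PI ^ 2 / 4 * / Cmod z) K + 210.5).
  { eapply Rle_trans; [apply Cmod_triangle|]. apply Rplus_le_compat; [easy|].
    unfold Cminus. eapply Rle_trans; [apply Cmod_triangle|]. rewrite Cmod_opp. lra. }
  lra.
Qed.

(** The two parts cost [e^2 < 7.6] for the product and [21 / 2] for the power sums; the latter use
    [|1 - q| >= 3.4 t] and [1 / 3.4 < 0.3]. *)
Lemma minor_arc_difference t theta P L K : 0 < t <= 1 / 24 -> 6 * t <= Rabs theta -> Rabs theta <= PI ->
  Clim (fun N => ovp_prod N (cexp (- (t, theta)))) P -> is_power_series_sums (cexp (- (t, theta))) L ->
  Cmod (P - csum (fun m => bessel_coef (S m) * L m) K)%C <= 19 * exp (0.3 * (PI ^ 2 / 4 * / t)).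
Proof.
  intros Ht H1 H2 HP HL.
  assert (HPb := minor_arc_product_bound t theta P Ht H1 H2 HP).
  assert (Hgap := minor_arc_gap t theta Ht H1 H2).
  set (q := cexp (- (t, theta))) in *.
  assert (Hmod : Cmod q <= 1).
  { unfold q. rewrite Cmod_cexp_polar, <- exp_0. apply exp_le_compat; lra. }
  set (d := Cmod (1 - q)) in *.
  assert (Hd : 3.4 * t <= d).
  { assert (0 <= d) by apply Cmod_ge_0.
    destruct (Rle_dec (3.4 * t) d) as [Hle|Hle]; [easy|]. exfalso. nra. }
  assert (HS := bessel_power_sums_bound q L K HL Hmod ltac:(fold d; lra)). fold d in HS.
  assert (Hid : / d <= / 3.4 * / t).
  { rewrite <- Rinv_mult. apply Rinv_le_contravar; lra. }
  generalize quarter_pi_sqr_bounds. intros HPI.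
  assert (Hit : 0 < / t) by (apply Rinv_0_lt_compat; lra).
  set (E := exp (0.3 * (PI ^ 2 / 4 * / t))) in *.
  assert (HE : 0 < E) by apply exp_pos.
  assert (HS2 : exp (PI ^ 2 / 4 * (1 + / d)) <= 21 * E).
  { apply Rle_trans with (exp (PI ^ 2 / 4) * E).
    - unfold E. rewrite <- exp_plus. apply exp_le_compat.
      assert (PI ^ 2 / 4 * / d <= PI ^ 2 / 4 * (/ 3.4 * / t)) by (apply Rmult_le_compat_l; lra).
      assert (0 <= PI ^ 2 / 4 * / t) by (apply Rmult_le_pos; lra). lra.
    - apply Rmult_le_compat_r; [lra|apply exp_quarter_pi_sqr]. }
  assert (HP2 : exp (0.3 * (PI ^ 2 / 4 * / t) + 2) <= 7.6 * E).
  { rewrite exp_plus. fold E. rewrite Rmult_comm. apply Rmult_le_compat_r; [lra|].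
    replace 2 with (INR 2 * 1) by (simpl; ring). rewrite <- exp_pow_INR.
    apply Rle_trans with (2.75 ^ 2); [|lra].
    apply pow_incr. generalize exp_1_lt (exp_pos 1). lra. }
  unfold Cminus. eapply Rle_trans; [apply Cmod_triangle|]. rewrite Cmod_opp. lra.
Qed.

(** This [t] minimises [n t + pi^2 / (4 t)], and the two summands are then equal. From 1500 on it is
    at most [1/24], as the arc estimates demand. *)
Lemma saddle_point_abscissa n : (1500 <= n)%nat ->
  0 < PI / (2 * sqrt (INR n)) <= 1 / 24 /\ INR n * (PI / (2 * sqrt (INR n))) = mu n / 2 /\
  PI ^ 2 / 4 * / (PI / (2 * sqrt (INR n))) = mu n / 2.
Proof.
  intros Hn. assert (HnR : 1500 <= INR n) by (apply (le_INR 1500) in Hn; simpl in Hn; lra).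
  generalize PI_bounds_coarse; intros HPI.
  assert (Hs : 38.7 <= sqrt (INR n)).
  { apply Rle_trans with (sqrt (38.7 ^ 2)); [rewrite sqrt_pow2; lra|]. apply sqrt_le_1_alt. lra. }
  assert (Hss : sqrt (INR n) * sqrt (INR n) = INR n) by (apply sqrt_sqrt; lra).
  split; [split|split].
  - apply Rdiv_lt_0_compat; lra.
  - apply Rmult_le_reg_r with (2 * sqrt (INR n)); [lra|]. unfold Rdiv at 1.
    rewrite Rmult_assoc, Rinv_l by lra. lra.
  - unfold mu. rewrite <- Hss at 1. field. lra.
  - unfold mu. field. lra.
Qed.

(** [0.65 = 1/2 + 0.3/2]: the first share comes from [e^(n t)], the second from the minor arc. *)
Lemma pbar_asymptotic n : (1500 <= n)%nat ->
  Rabs (INR (pbar n) - (cosh (mu n) - sinh (mu n) / mu n) / (4 * INR n)) <= 20 * exp (0.65 * mu n).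
Proof.
  intros Hn. destruct (saddle_point_abscissa n Hn) as [Ht [Hnt Hat]].
  set (t := PI / (2 * sqrt (INR n))) in *.
  assert (Hrho : 0 < exp (- t) < 1).
  { split; [apply exp_pos|]. rewrite <- exp_0. apply exp_increasing; lra. }
  set (E0 := exp (0.3 * (PI ^ 2 / 4 * / t))).
  (* With [E0 >= 18] the major arc constant 216 also stays below [20 E0]. *)
  assert (HE0 : 18 <= E0).
  { assert (Hit : 24 <= / t).
    { replace 24 with (/ (1 / 24)) by field. apply Rinv_le_contravar; lra. }
    generalize (exp_ineq1_le (0.3 * (PI ^ 2 / 4 * / t))) quarter_pi_sqr_bounds. unfold E0. nra. }
  assert (HK : forall K, Rabs (INR (pbar n) - bessel_partial K n) <=
     (20 * E0 + bessel_remainder (PI ^ 2 / 4 * / t) K) * exp (INR n * t)).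
  { intros K.
    destruct (pbar_rsum_bounded (exp (- t))) as [B1 HB1]; [lra|].
    assert (HB2 : exists B2, forall N, rsum (fun i => bessel_partial K i * exp (- t) ^ i) N <= B2).
    { exists (rsum (fun m => bessel_coef (S m) * ((1 + / (1 - exp (- t))) ^ m / (1 - exp (- t)))) K).
      intros N. unfold bessel_partial.
      rewrite (rsum_ext _ (fun i => rsum (fun m => bessel_coef (S m) * (power_coef m i * exp (- t) ^ i)) K)).
      2: { intros i _. rewrite Rmult_comm, <- rsum_scal. apply rsum_ext; intros; ring. }
      rewrite rsum_exchange. apply rsum_le. intros m _. rewrite rsum_scal.
      apply Rmult_le_compat_l; [left; apply bessel_coef_pos|].
      assert (0 < / (1 - exp (- t))) by (apply Rinv_0_lt_compat; lra).
      apply real_power_sum_bound; [easy|lra|apply exp_inv_le_of_gap; lra]. }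
    destruct HB2 as [B2 HB2].
    assert (Hpos : forall i, 0 <= bessel_partial K i).
    { intros i. apply rsum_nonneg. intros. apply Rmult_le_pos; [left; apply bessel_coef_pos|apply power_coef_nonneg]. }
    apply (coefficient_bound (fun i => INR (pbar i) - bessel_partial K i) t (B1 + B2)).
    - intros N. apply Rle_trans with
       (rsum (fun i => INR (pbar i) * exp (- t) ^ i + bessel_partial K i * exp (- t) ^ i) N).
      + apply rsum_le. intros i _. rewrite <- Rmult_plus_distr_r.
        apply Rmult_le_compat_r; [apply pow_le; lra|].
        unfold Rminus. eapply Rle_trans; [apply Rabs_triang|]. rewrite Rabs_Ropp.
        rewrite !Rabs_right by (apply Rle_ge; [apply pos_INR||apply Hpos]). lra.
      + rewrite rsum_plus. apply Rplus_le_compat; [apply HB1|apply HB2].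
    - intros theta Htheta.
      assert (Habs : Rabs theta <= PI) by (apply Rabs_le; easy).
      set (q := cexp (- (t, theta))).
      assert (Hmod : Cmod q = exp (- t)) by apply Cmod_cexp_polar.
      destruct (power_series_sums_exist q) as [L HL]; [rewrite Hmod; easy|].
      destruct (pbar_series_product q) as [P [HP1 HP2]]; [rewrite Hmod; lra|].
      exists (P - csum (fun m => bessel_coef (S m) * L m) K)%C. split.
      + apply Clim_ext with (fun N => csum (fun m => RtoC (INR (pbar m)) * q ^ m) N -
           csum (fun m => bessel_coef (S m) * power_sum m q N) K)%C.
        * intros N. unfold power_sum.
          rewrite (csum_ext (fun m => bessel_coef (S m) * csum (fun n => power_coef m n * q ^ n) N)%C
            (fun m => csum (fun n => bessel_coef (S m) * (power_coef m n * q ^ n)) N)%C)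
            by (intros; rewrite csum_scal; easy).
          rewrite csum_exchange, <- csum_minus. apply csum_ext. intros i _.
          unfold bessel_partial. rewrite RtoC_minus, <- csum_RtoC.
          rewrite (csum_ext (fun m => bessel_coef (S m) * (power_coef m i * q ^ i))%C
            (fun m => q ^ i * RtoC (bessel_coef (S m) * power_coef m i))%C)
            by (intros; rewrite RtoC_mult; ring).
          rewrite csum_scal. ring.
        * apply Clim_minus; [easy|].
          apply (Clim_csum (fun m N => bessel_coef (S m) * power_sum m q N)%C). intros m _.
          apply Clim_scal, HL.
      + assert (HR : 0 <= bessel_remainder (PI ^ 2 / 4 * / t) K).
        { apply Rle_trans with (bessel_remainder 0 K).
          - unfold bessel_remainder. rewrite pow_i by lia. unfold Rdiv. lra.
          - apply bessel_remainder_mono. split; [lra|].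
            apply Rmult_le_pos; [generalize (pow2_ge_0 PI); lra|left; apply Rinv_0_lt_compat; lra]. }
        destruct (Rle_dec (Rabs theta) (6 * t)) as [Hmaj|Hmin].
        * eapply Rle_trans; [apply (major_arc_difference t theta); auto|]. lra.
        * eapply Rle_trans; [apply (minor_arc_difference t theta); auto; lra|]. fold E0. lra. }
  assert (Hlim1 := bessel_partial_lim n ltac:(lia)).
  set (A := (cosh (mu n) - sinh (mu n) / mu n) / (4 * INR n)) in *.
  assert (Hlim2 : is_lim_seq (fun K => (20 * E0 + bessel_remainder (PI ^ 2 / 4 * / t) K) * exp (INR n * t))
     ((20 * E0 + 0) * exp (INR n * t))).
  { apply is_lim_seq_mult'; [|apply is_lim_seq_const]. apply is_lim_seq_plus'; [apply is_lim_seq_const|].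
    apply lim_bessel_remainder. apply Rmult_le_pos; [generalize (pow2_ge_0 PI); lra|left; apply Rinv_0_lt_compat; lra]. }
  assert (Hlim3 : is_lim_seq (fun K => Rabs (INR (pbar n) - bessel_partial K n)) (Rabs (INR (pbar n) - A))).
  { apply (is_lim_seq_abs _ (INR (pbar n) - A)). apply is_lim_seq_minus'; [apply is_lim_seq_const|easy]. }
  assert (Hle := is_lim_seq_le _ _ (Rabs (INR (pbar n) - A)) ((20 * E0 + 0) * exp (INR n * t)) HK Hlim3 Hlim2).
  simpl in Hle. eapply Rle_trans; [exact Hle|]. right.
  unfold E0. rewrite Hnt, Hat, Rplus_0_r, Rmult_assoc, <- exp_plus. f_equal; f_equal; lra.
Qed.

(** * Recurrence and the range up to 1501 *)

Definition theta_weight (l : nat) : R := (if Nat.eqb l 0 then 1 else 2) * (-1) ^ l.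

(* Coefficient of [q^n] in [(sum_{|l| <= J} (-1)^l q^(l^2)) * sum_m pbar(m) q^m]. *)
Definition theta_pbar_coef (J n : nat) : R :=
  rsum (fun l => theta_weight l * (if (l * l <=? n)%nat then INR (pbar (n - l * l)) else 0)) (S J).

Lemma theta_partial_weights q J :
  theta_partial q J = csum (fun l => theta_weight l * q ^ (l * l))%C (S J).
Proof.
  unfold theta_partial. rewrite !(csum_split_first _ J).
  rewrite (csum_ext (fun i => theta_weight (S i) * q ^ (S i * S i))%C (fun i => 2 * theta_term q (S i))%C).
  - rewrite csum_scal. unfold theta_term at 1, theta_weight. simpl. rewrite Rmult_1_l. ring.
  - intros i _. unfold theta_weight, theta_term. cbn [Nat.eqb].
    rewrite RtoC_mult, RtoC_pow_minus_one. ring.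
Qed.

Lemma theta_pbar_series q P J : Cmod q < 1 ->
  Clim (csum (fun m => RtoC (INR (pbar m)) * q ^ m)%C) P ->
  Clim (csum (fun n => theta_pbar_coef J n * q ^ n)%C) (theta_partial q J * P)%C.
Proof.
  intros Hq HP.
  assert (Hd : forall d, Clim (csum (fun n => (if (d <=? n)%nat then RtoC (INR (pbar (n - d))) else 0) * q ^ n)%C) (q ^ d * P)%C).
  { intros d. apply Clim_of_zero_diff with (fun M => q ^ d * csum (fun m => RtoC (INR (pbar m)) * q ^ m) M)%C.
    - apply Clim_scal; easy.
    - assert (H1 := Clim_minus _ _ _ _ (Clim_scal (q ^ d)%C _ _ HP)
         (Clim_scal (q ^ d)%C _ _ (Clim_shift _ _ d HP))).
      unfold Clim in H1. apply (is_lim_seq_incr_n _ d).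
      eapply is_lim_seq_ext; [|exact H1]. intros n. cbv beta.
      rewrite (csum_delay (fun m => RtoC (INR (pbar m))) q d (n + d)).
      replace (n + d - d)%nat with n by lia. f_equal. ring. }
  rewrite theta_partial_weights.
  apply Clim_ext with (fun M => csum (fun l => theta_weight l *
     csum (fun n => (if (l * l <=? n)%nat then RtoC (INR (pbar (n - l * l))) else 0) * q ^ n) M)%C (S J)).
  - intros M.
    rewrite (csum_ext _ (fun l => csum (fun n => theta_weight l *
       ((if (l * l <=? n)%nat then RtoC (INR (pbar (n - l * l))) else 0) * q ^ n)) M)%C)
      by (intros; rewrite csum_scal; easy).
    rewrite csum_exchange. apply csum_ext. intros n _. unfold theta_pbar_coef.
    rewrite <- csum_RtoC, Cmult_comm, <- csum_scal. apply csum_ext. intros l _.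
    rewrite RtoC_mult. destruct (l * l <=? n)%nat; ring.
  - replace (csum (fun l => theta_weight l * q ^ (l * l)) (S J) * P)%C with
      (csum (fun l => theta_weight l * (q ^ (l * l) * P))%C (S J)).
    + apply (Clim_csum (fun l M => theta_weight l *
     csum (fun n => (if (l * l <=? n)%nat then RtoC (INR (pbar (n - l * l))) else 0) * q ^ n) M)%C).
      intros l _. apply Clim_scal, Hd.
    + rewrite Cmult_comm, <- csum_scal. apply csum_ext. intros; ring.
Qed.

Lemma theta_pbar_coef_stable J J' n : (n <= J)%nat -> (J <= J')%nat ->
  theta_pbar_coef J' n = theta_pbar_coef J n.
Proof.
  intros HJ. induction 1 as [|J' H IH]; [easy|]. rewrite <- IH. unfold theta_pbar_coef.
  change (rsum ?u (S (S J'))) with (rsum u (S J') + u (S J')). cbv beta.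
  destruct (Nat.leb_spec (S J' * S J') n) as [K|K]; [nia|]. ring.
Qed.

(** A partial theta sum times the series of [pbar] differs from 1 by [O(|q|^J)] on a fixed circle.
    The [n]-th coefficient, independent of [J] once [J >= n], is therefore bounded by a quantity
    that tends to 0. *)
Lemma theta_pbar_recurrence n J : (0 < n)%nat -> (n <= J)%nat -> theta_pbar_coef J n = 0.
Proof.
  intros Hn HJ.
  (* Any fixed radius below 1 would serve; [e^-1] corresponds to [t = 1] in [coefficient_bound]. *)
  set (x := exp (- (1))).
  assert (Hx : 0 < x < 1).
  { unfold x. split; [apply exp_pos|]. apply Rlt_le_trans with (exp 0); [apply exp_increasing|rewrite exp_0]; lra. }
  destruct (ovp_prod_R_bounded x ltac:(lra)) as [B HB].
  assert (HB1 : 1 <= B).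
  { eapply Rle_trans; [apply (ovp_prod_R_pos x 0); lra|apply HB]. }
  assert (Hbound : forall J, Rabs (theta_pbar_coef J n) <= 2 / (1 - x) * x ^ J * B * exp (INR n * 1)).
  { intros K.
    (* The coefficients of the constant function 1 are subtracted, since it is the product minus 1
       that is small on the circle. *)
    assert (Hd0 : theta_pbar_coef K n = theta_pbar_coef K n - (if Nat.eqb n 0 then 1 else 0)).
    { destruct n; [lia|]. cbn [Nat.eqb]. ring. }
    rewrite Hd0.
    destruct (pbar_rsum_bounded x ltac:(lra)) as [B0 HB0].
    apply (coefficient_bound (fun n => theta_pbar_coef K n - (if Nat.eqb n 0 then 1 else 0)) 1 (rsum (fun l => 2 * B0) (S K) + 1)).
    - intros N. fold x.
      apply Rle_trans with (rsum (fun i => rsum (fun l => 2 * ((if (l * l <=? i)%nat then INR (pbar (i - l * l)) else 0) * x ^ i)) (S K)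
         + (if Nat.eqb i 0 then 1 else 0) * x ^ i) N).
      + apply rsum_le. intros i _.
        assert (Hxi : 0 <= x ^ i) by (apply pow_le; lra).
        assert (H1 : Rabs (theta_pbar_coef K i) <= rsum (fun l => 2 * (if (l * l <=? i)%nat then INR (pbar (i - l * l)) else 0)) (S K)).
        { unfold theta_pbar_coef. generalize (S K). intros k. induction k as [|k IH]; simpl; [rewrite Rabs_R0; lra|].
          eapply Rle_trans; [apply Rabs_triang|]. apply Rplus_le_compat; [easy|].
          rewrite Rabs_mult. rewrite (Rabs_right (if _ : bool then _ else _)).
          - apply Rmult_le_compat_r; [destruct (k * k <=? i)%nat; [apply pos_INR|lra]|].
            unfold theta_weight. rewrite Rabs_mult, pow_1_abs, Rmult_1_r.
            destruct (Nat.eqb k 0); rewrite Rabs_right; lra.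
          - destruct (k * k <=? i)%nat; [apply Rle_ge, pos_INR|lra]. }
        rewrite (rsum_ext (fun l => 2 * ((if (l * l <=? i)%nat then INR (pbar (i - l * l)) else 0) * x ^ i))
          (fun l => x ^ i * (2 * (if (l * l <=? i)%nat then INR (pbar (i - l * l)) else 0)))) by (intros; ring).
        rewrite rsum_scal.
        assert (H2 : Rabs (theta_pbar_coef K i - (if Nat.eqb i 0 then 1 else 0)) <= Rabs (theta_pbar_coef K i) + (if Nat.eqb i 0 then 1 else 0)).
        { unfold Rminus. eapply Rle_trans; [apply Rabs_triang|]. rewrite Rabs_Ropp.
          destruct (Nat.eqb i 0); [rewrite Rabs_R1|rewrite Rabs_R0]; lra. }
        nra.
      + rewrite rsum_plus, rsum_exchange. apply Rplus_le_compat.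
        * apply rsum_le. intros l _. rewrite rsum_scal. apply Rmult_le_compat_l; [lra|].
          rewrite (rsum_delay (fun m => INR (pbar m)) x (l * l) N).
          assert (H0 : 0 <= rsum (fun m => INR (pbar m) * x ^ m) (N - l * l)).
          { apply rsum_nonneg. intros. apply Rmult_le_pos; [apply pos_INR|apply pow_le; lra]. }
          assert (x ^ (l * l) <= 1) by (rewrite <- (pow1 (l * l)); apply pow_incr; lra).
          generalize (HB0 (N - l * l)%nat). nra.
        * destruct N as [|N]; [simpl; lra|]. rewrite rsum_split_first.
          rewrite (rsum_ext _ (fun _ => 0 * 0)), rsum_scal by (intros; simpl; ring). simpl. lra.
    - intros theta _. set (q := cexp (- (1, theta))).
      assert (Hmod : Cmod q = x) by (unfold q; rewrite Cmod_cexp; easy).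
      destruct (pbar_series_product q) as [P [HP1 HP2]]; [lra|].
      destruct (theta_partial_limit q P ltac:(lra) HP2) as [T [HTP Htail]]. rewrite Hmod in Htail.
      exists (theta_partial q K * P - 1)%C. split.
      + apply Clim_ext with (fun N => csum (fun n => theta_pbar_coef K n * q ^ n) N
          - csum (fun n => (if Nat.eqb n 0 then 1 else 0) * q ^ n) N)%C.
        * intros N. rewrite <- csum_minus. apply csum_ext. intros i _. rewrite RtoC_minus.
          destruct (Nat.eqb i 0); ring.
        * apply Clim_minus; [apply theta_pbar_series; [lra|easy]|].
          apply Clim_of_zero_diff with (fun _ => RtoC 1); [apply Clim_const|].
          apply lim_seq_dominated_eventually with (fun _ => 0) 1%nat; [|apply is_lim_seq_const].
          intros N HN. destruct N as [|N]; [lia|]. rewrite csum_split_first.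
          rewrite (csum_ext _ (fun _ => 0 * 0)%C), csum_scal by (intros; simpl; ring). simpl.
          match goal with |- 0 <= Cmod ?u <= 0 => replace u with (RtoC 0) by ring end. rewrite Cmod_0; lra.
      + replace (theta_partial q K * P - 1)%C with ((theta_partial q K - T) * P)%C by (rewrite <- HTP; ring).
        rewrite Cmod_mult. apply Rmult_le_compat; try apply Cmod_ge_0; [apply Htail|].
        apply (Clim_le _ _ _ HP2). intros N. eapply Rle_trans; [apply Cmod_ovp_prod_le; lra|].
        rewrite Hmod. apply HB. }
  assert (Hlim : is_lim_seq (fun J => 2 / (1 - x) * x ^ J * B * exp (INR n * 1)) 0).
  { apply is_lim_seq_ext with (fun J => 2 / (1 - x) * B * exp (INR n * 1) * x ^ J); [intros; ring|].
    apply lim_seq_scal0, lim_geom; lra. }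
  assert (H0 : Rabs (theta_pbar_coef J n) <= 0).
  { apply (is_lim_seq_le_loc (fun _ => Rabs (theta_pbar_coef J n)) (fun J => 2 / (1 - x) * x ^ J * B * exp (INR n * 1))
      (Rabs (theta_pbar_coef J n)) 0); [|apply is_lim_seq_const|easy].
    exists J. intros K HK. rewrite <- (theta_pbar_coef_stable J K n) by easy. apply Hbound. }
  destruct (Req_dec (theta_pbar_coef J n) 0) as [E|E]; [easy|].
  apply Rabs_no_R0 in E. generalize (Rabs_pos (theta_pbar_coef J n)). lra.
Qed.

Lemma PI_bounds : 3.14159 < PI < 3.1416.
Proof.
  assert (H := PI_2_3_7_ineq 3). cbn -[Rplus Rmult Rinv Ropp] in H.
  unfold tg_alt, PI_2_3_7_tg, Ratan_seq in H. cbn -[Rplus Rmult Rinv Ropp Rdiv INR] in H.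
  simpl INR in H. lra.
Qed.

(* [square_walk f k l] is [l_0 - l_(2k+1) + l_(4k+4) - ...], the offsets being [(k + j)^2 - k^2]. *)
Fixpoint square_walk (f k : nat) (l : list Z) : Z :=
  match f with
  | O => 0
  | S f' => match l with [] => 0 | x :: l' => x - square_walk f' (S k) (skipn (2 * k) l') end
  end%Z.

(** The newest value comes first, so the entry [l^2] steps back is at position [l^2 - 1] of the
    previous table; the factor 2 counts [l] and [- l]. *)
Fixpoint pbar_table (M : nat) : list Z :=
  match M with
  | O => [1]
  | S m => let acc := pbar_table m in (2 * square_walk M 1 acc) :: acc
  end%Z.

(** The walk from [k] starts after [k^2 - 1] entries. Having taken one entry it drops [2 k] more,
    and [k^2 + 2 k = (k+1)^2 - 1]; the exhausted list returns 0, which matches [k^2 > n]. *)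
Lemma square_walk_spec (a : nat -> Z) n acc : length acc = n ->
  (forall i, (i < n)%nat -> nth i acc 0%Z = a (n - 1 - i)%nat) -> forall f k, (0 < k)%nat ->
  IZR (square_walk f k (skipn (k * k - 1) acc)) =
  rsum (fun j => (-1) ^ j * (if ((k + j) * (k + j) <=? n)%nat then IZR (a (n - (k + j) * (k + j))%nat) else 0)) f.
Proof.
  intros Hlen Hnth. induction f as [|f IH]; intros k Hk; [easy|].
  rewrite rsum_split_first. cbn [square_walk]. rewrite Nat.add_0_r.
  destruct (Nat.leb_spec (k * k) n) as [Hle|Hlt].
  - assert (Hsk : skipn (k * k - 1) acc = nth (k * k - 1) acc 0%Z :: skipn (k * k) acc).
    { assert (Hlt : (k * k - 1 < length acc)%nat) by nia.
      clear -Hlt Hk. replace (k * k)%nat with (S (k * k - 1)) at 3 by nia.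
      revert Hlt. generalize (k * k - 1)%nat. induction acc as [|y acc IH]; intros m Hm; [simpl in Hm; lia|].
      destruct m as [|m]; [easy|]. simpl in *. apply IH. lia. }
    rewrite Hsk, skipn_skipn, minus_IZR, Hnth by nia.
    replace (2 * k + k * k)%nat with (S k * S k - 1)%nat by nia.
    rewrite IH by lia.
    replace (n - 1 - (k * k - 1))%nat with (n - k * k)%nat by nia.
    rewrite (rsum_ext (fun i => (-1) ^ S i * (if ((k + S i) * (k + S i) <=? n)%nat then IZR (a (n - (k + S i) * (k + S i))%nat) else 0))
      (fun j => (-1) * ((-1) ^ j * (if ((S k + j) * (S k + j) <=? n)%nat then IZR (a (n - (S k + j) * (S k + j))%nat) else 0)))).
    + rewrite rsum_scal. simpl pow. ring.
    + intros i _. replace (S k + i)%nat with (k + S i)%nat by lia. simpl pow. ring.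
  - rewrite skipn_all2 by nia.
    rewrite (rsum_ext _ (fun _ => 0 * 0)), rsum_scal; [simpl; ring|].
    intros i _. destruct (Nat.leb_spec ((k + S i) * (k + S i)) n); [nia|ring].
Qed.

Lemma pbar_table_spec M : length (pbar_table M) = S M /\
  forall i, (i <= M)%nat -> nth i (pbar_table M) 0%Z = Z.of_nat (pbar (M - i)).
Proof.
  induction M as [|M [Hlen IH]].
  - split; [easy|]. intros i Hi. replace i with O by lia. easy.
  - cbn [pbar_table]. set (acc := pbar_table M) in *. split; [simpl; lia|].
    intros [|i] Hi; cbn [nth]; [|rewrite IH by lia; f_equal; f_equal; lia].
    rewrite Nat.sub_0_r. apply eq_IZR.
    assert (Hw := square_walk_spec (fun m => Z.of_nat (pbar m)) (S M) acc Hlen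
       ltac:(intros j Hj; rewrite IH by lia; do 2 f_equal; lia) (S M) 1 ltac:(lia)).
    simpl (1 * 1 - 1)%nat in Hw. simpl (skipn 0 acc) in Hw.
    assert (Hr := theta_pbar_recurrence (S M) (S M) ltac:(lia) ltac:(lia)).
    unfold theta_pbar_coef in Hr. rewrite rsum_split_first in Hr.
    rewrite mult_IZR, Hw, <- INR_IZR_INZ.
    rewrite (rsum_ext (fun i => theta_weight (S i) * (if (S i * S i <=? S M)%nat then INR (pbar (S M - S i * S i)) else 0))
      (fun j => (-2) * ((-1) ^ j * (if ((1 + j) * (1 + j) <=? S M)%nat then IZR (Z.of_nat (pbar (S M - (1 + j) * (1 + j)))) else 0)))) in Hr.
    + rewrite rsum_scal in Hr. unfold theta_weight in Hr at 1. simpl Nat.eqb in Hr. simpl pow in Hr at 1.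
      change (0 * 0 <=? S M)%nat with true in Hr. cbv iota in Hr. rewrite Nat.sub_0_r in Hr. lra.
    + intros j _. unfold theta_weight. cbn [Nat.eqb].
      replace (1 + j)%nat with (S j) by lia. rewrite <- INR_IZR_INZ. simpl pow. ring.
Qed.

(** * Lower bounds for [Q] and the certified range *)

Lemma Q_alt t : 0 < t < 1 ->
  Q t = 1 - (sqrt (1 - t) / (1 + sqrt (1 - t))) ^ 2.
Proof.
  intros Ht. unfold Q. set (r := sqrt (1 - t)).
  assert (Hr : 0 < r) by (apply sqrt_lt_R0; lra).
  assert (Hr2 : r ^ 2 = 1 - t) by (apply pow2_sqrt; lra).
  assert (H3 : sqrt ((1 - t) ^ 3) = r ^ 3).
  { rewrite <- Hr2. replace ((r ^ 2) ^ 3) with ((r ^ 3) ^ 2) by ring.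
    apply sqrt_pow2. apply pow_le; lra. }
  rewrite H3. replace t with (1 - r ^ 2) by lra.
  assert (r ^ 2 < 1) by lra. field. split; nra.
Qed.

Lemma ratio_sqr_mono r rho : 0 <= r < rho -> (r / (1 + r)) ^ 2 < (rho / (1 + rho)) ^ 2.
Proof.
  intros H.
  assert (H1 : forall x, 0 <= x -> x / (1 + x) = 1 - / (1 + x)) by (intros; field; lra).
  rewrite !H1 by lra.
  assert (/ (1 + rho) < / (1 + r)) by (apply Rinv_lt_contravar; nra).
  assert (/ (1 + r) <= 1) by (rewrite <- Rinv_1; apply Rinv_le_contravar; lra).
  nra.
Qed.

(** [rho] may be rational, which frees the integer check from the square root in [Q]. *)
Lemma Q_lower t rho : 0 < t < 1 -> 0 <= rho -> 1 - t < rho ^ 2 ->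
  1 - (rho / (1 + rho)) ^ 2 < Q t.
Proof.
  intros Ht Hrho H. rewrite Q_alt by easy.
  assert (H2 : sqrt (1 - t) < rho).
  { rewrite <- (sqrt_pow2 rho) by easy. apply sqrt_lt_1_alt. lra. }
  assert (H3 := ratio_sqr_mono (sqrt (1 - t)) rho (conj (sqrt_pos _) H2)). lra.
Qed.

(* Lower bound for [1 - f(n) - 1000 / mu(n-1)^5]. *)
Definition gap (n : nat) : R :=
  PI / 4 * (sqrt (INR n) / INR n ^ 2) - / INR n ^ 2 + 0.23 * (sqrt (INR n) / INR n ^ 3)
  - 1000 / mu (n - 1) ^ 5.

(* [a, b, c] stand for [pbar (n-1), pbar n, pbar (n+1)]; [num / den <= gap n], and
   [rho = w / (K - w)] is an upper bound for [sqrt (1 - u n)] with [(rho / (1 + rho))^2 <= num / den]. *)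
Definition gap_check (n a b c : Z) : bool :=
  (let K := 10 ^ 8 in
   let s := Z.sqrt (n * K ^ 2) in
   let s' := Z.sqrt ((n - 1) * K ^ 2) + 1 in
   let n3 := n ^ 3 in
   let m3 := (n - 1) ^ 3 in
   let num := (785397 * s - 1000000 * K) * n * m3 + 230000 * s * m3 - 3267800 * s' * n3 in
   let den := 1000000 * K * n3 * m3 in
   let w := Z.sqrt (num * K ^ 2 / den) in
   let d := b * b - a * c in
   (0 <? a * c) && (0 <? d) && (0 <? w) && (w <? K) && (w * w * den <=? num * K ^ 2) &&
   (d * ((K - w) * (K - w)) <? w * w * (b * b)))%Z.

Lemma mu_pow5 n : mu n ^ 5 = PI ^ 5 * (INR n ^ 2 * sqrt (INR n)).
Proof.
  unfold mu. rewrite Rpow_mult_distr. f_equal.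
  assert (H : sqrt (INR n) * sqrt (INR n) = INR n) by (apply sqrt_sqrt, pos_INR).
  replace (sqrt (INR n) ^ 5) with ((sqrt (INR n) * sqrt (INR n)) ^ 2 * sqrt (INR n)) by ring.
  rewrite H. ring.
Qed.

Lemma IZR_pow2 z : IZR (z ^ 2) = IZR z ^ 2.
Proof. symmetry. apply (pow_IZR z 2). Qed.

Lemma IZR_pow3 z : IZR (z ^ 3) = IZR z ^ 3.
Proof. symmetry. apply (pow_IZR z 3). Qed.

(** [s / K] is at most [sqrt n] and [s' / K] at least [sqrt (n - 1)]. The constants come from
    [0.785397 < pi / 4] and [3.2678 > 1000 / pi^5], and with [m = n - 1] the power [m^(-5/2)] is
    written [sqrt m / m^3] so that every root stands in a numerator. *)
Lemma gap_lower_bound n (s s' K : Z) : (2 <= n)%nat -> (0 < K)%Z ->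
  (0 <= s)%Z -> (s * s <= Z.of_nat n * K ^ 2)%Z ->
  (0 <= s')%Z -> ((Z.of_nat n - 1) * K ^ 2 <= s' * s')%Z ->
  0.785397 * (IZR s / IZR K / INR n ^ 2) - / INR n ^ 2 + 0.23 * (IZR s / IZR K / INR n ^ 3)
    - 3.2678 * (IZR s' / IZR K / (INR n - 1) ^ 3) <= gap n.
Proof.
  intros Hn HK Hs Hsn Hs' Hsn'.
  assert (HnR : 2 <= INR n) by (apply (le_INR 2) in Hn; simpl in Hn; lra).
  apply IZR_lt in HK. apply IZR_le in Hs, Hs', Hsn, Hsn'.
  rewrite !mult_IZR, IZR_pow2, <- INR_IZR_INZ in Hsn.
  rewrite !mult_IZR, IZR_pow2, minus_IZR, <- INR_IZR_INZ in Hsn'.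
  assert (Hm : INR (n - 1) = INR n - 1) by (rewrite minus_INR by lia; simpl; ring).
  assert (H1 : IZR s / IZR K <= sqrt (INR n)).
  { rewrite <- (sqrt_pow2 (IZR s / IZR K)).
    - apply sqrt_le_1_alt. apply Rmult_le_reg_r with (IZR K ^ 2); [nra|].
      replace ((IZR s / IZR K) ^ 2 * IZR K ^ 2) with (IZR s * IZR s) by (field; lra). lra.
    - apply Rmult_le_pos; [easy|left; apply Rinv_0_lt_compat; easy]. }
  assert (H2 : sqrt (INR n - 1) <= IZR s' / IZR K).
  { rewrite <- (sqrt_pow2 (IZR s' / IZR K)).
    - apply sqrt_le_1_alt. apply Rmult_le_reg_r with (IZR K ^ 2); [nra|].
      replace ((IZR s' / IZR K) ^ 2 * IZR K ^ 2) with (IZR s' * IZR s') by (field; lra). lra.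
    - apply Rmult_le_pos; [easy|left; apply Rinv_0_lt_compat; easy]. }
  unfold gap. rewrite mu_pow5, Hm.
  set (y := sqrt (INR n)) in *. set (v := sqrt (INR n - 1)) in *.
  assert (Hv : 0 < v) by (apply sqrt_lt_R0; lra).
  assert (Hv2 : v * v = INR n - 1) by (apply sqrt_sqrt; lra).
  assert (HP := PI_bounds).
  assert (Hpow : forall k, 0 < / INR n ^ k) by (intros; apply Rinv_0_lt_compat, pow_lt; lra).
  assert (HsK : 0 <= IZR s / IZR K) by (apply Rmult_le_pos; [easy|left; apply Rinv_0_lt_compat; easy]).
  assert (T1 : 0.785397 * (IZR s / IZR K / INR n ^ 2) <= PI / 4 * (y / INR n ^ 2)).
  { apply Rmult_le_compat; try lra.
    - apply Rmult_le_pos; [easy|left; apply Hpow].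
    - apply Rmult_le_compat_r; [left; apply Hpow|easy]. }
  assert (T2 : 0.23 * (IZR s / IZR K / INR n ^ 3) <= 0.23 * (y / INR n ^ 3)).
  { apply Rmult_le_compat_l; [lra|]. apply Rmult_le_compat_r; [left; apply Hpow|easy]. }
  assert (T3 : 1000 / (PI ^ 5 * ((INR n - 1) ^ 2 * v)) <= 3.2678 * (IZR s' / IZR K / (INR n - 1) ^ 3)).
  { assert (HP5 : 306.018 <= PI ^ 5).
    { apply Rle_trans with (3.14159 ^ 5); [lra|]. apply pow_incr; lra. }
    replace (1000 / (PI ^ 5 * ((INR n - 1) ^ 2 * v))) with (1000 / PI ^ 5 * (v / (INR n - 1) ^ 3)).
    - apply Rmult_le_compat.
      + apply Rmult_le_pos; [lra|left; apply Rinv_0_lt_compat; lra].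
      + apply Rmult_le_pos; [lra|left; apply Rinv_0_lt_compat, pow_lt; lra].
      + apply Rmult_le_reg_r with (PI ^ 5); [lra|]. unfold Rdiv. rewrite Rmult_assoc, Rinv_l by lra. lra.
      + apply Rmult_le_compat_r; [left; apply Rinv_0_lt_compat, pow_lt; lra|easy].
    - rewrite <- Hv2. field. split; lra. }
  lra.
Qed.

Lemma gap_check_sound n (a b c : nat) : (2 <= n)%nat ->
  gap_check (Z.of_nat n) (Z.of_nat a) (Z.of_nat b) (Z.of_nat c) = true ->
  1 - gap n < Q (INR a * INR c / INR b ^ 2).
Proof.
  intros Hn. unfold gap_check.
  set (K := (10 ^ 8)%Z). set (s := Z.sqrt (Z.of_nat n * K ^ 2)).
  set (s' := (Z.sqrt ((Z.of_nat n - 1) * K ^ 2) + 1)%Z).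
  cbv zeta.
  set (num := ((785397 * s - 1000000 * K) * Z.of_nat n * (Z.of_nat n - 1) ^ 3 + 230000 * s * (Z.of_nat n - 1) ^ 3
    - 3267800 * s' * Z.of_nat n ^ 3)%Z).
  set (den := (1000000 * K * Z.of_nat n ^ 3 * (Z.of_nat n - 1) ^ 3)%Z).
  (* [w] becomes arbitrary: the Boolean tests alone certify the value proposed by [Z.sqrt]. *)
  generalize (Z.sqrt (num * K ^ 2 / den)). intros w.
  rewrite !andb_true_iff, !Z.ltb_lt, Z.leb_le. intros [[[[[H1 H2] H3] H4] H5] H6].
  assert (HnR : 2 <= INR n) by (apply (le_INR 2) in Hn; simpl in Hn; lra).
  assert (HK : (0 < K)%Z) by easy.
  assert (Hs := Z.sqrt_spec (Z.of_nat n * K ^ 2) ltac:(nia)). fold s in Hs. cbv zeta in Hs.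
  assert (Hs' := Z.sqrt_spec ((Z.of_nat n - 1) * K ^ 2) ltac:(nia)). cbv zeta in Hs'.
  assert (Hg := gap_lower_bound n s s' K Hn HK (Z.sqrt_nonneg _) (proj1 Hs)).
  assert (Hs0 : (0 <= s')%Z) by (unfold s'; generalize (Z.sqrt_nonneg ((Z.of_nat n - 1) * K ^ 2)); lia).
  specialize (Hg Hs0). assert (Hs1 : ((Z.of_nat n - 1) * K ^ 2 <= s' * s')%Z) by (unfold s'; lia).
  specialize (Hg Hs1).
  apply IZR_lt in H1, H2, H3, H4, H6, HK. apply IZR_le in H5.
  rewrite mult_IZR in H1. rewrite minus_IZR, !mult_IZR in H2.
  rewrite !mult_IZR, IZR_pow2 in H5. rewrite !mult_IZR, !minus_IZR, !mult_IZR in H6.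
  rewrite <- !INR_IZR_INZ in *.
  assert (Hden : IZR den = 1000000 * IZR K * INR n ^ 3 * (INR n - 1) ^ 3).
  { unfold den. rewrite !mult_IZR, !IZR_pow3, minus_IZR, <- INR_IZR_INZ. easy. }
  assert (Hnum : IZR num = (785397 * IZR s - 1000000 * IZR K) * INR n * (INR n - 1) ^ 3
     + 230000 * IZR s * (INR n - 1) ^ 3 - 3267800 * IZR s' * INR n ^ 3).
  { unfold num. rewrite minus_IZR, plus_IZR, !mult_IZR, minus_IZR, !mult_IZR, !IZR_pow3, minus_IZR, <- INR_IZR_INZ. easy. }
  clearbody num den. clear Hs Hs' Hs0 Hs1.
  assert (Hn3 : 0 < INR n ^ 3) by (apply pow_lt; lra).
  assert (Hm3 : 0 < (INR n - 1) ^ 3) by (apply pow_lt; lra).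
  assert (Hdpos : 0 < IZR den).
  { rewrite Hden. apply Rmult_lt_0_compat; [apply Rmult_lt_0_compat; [lra|easy]|easy]. }
  assert (Hratio : IZR num / IZR den <= gap n).
  { eapply Rle_trans; [|apply Hg]. right. rewrite Hnum, Hden.
    replace 0.785397 with (785397 / 1000000) by lra. replace 0.23 with (230000 / 1000000) by lra.
    replace 3.2678 with (3267800 / 1000000) by lra. field. repeat split; lra. }
  set (k := IZR K) in *. set (x := IZR w) in *.
  assert (Hb2 : 0 < INR b ^ 2) by (replace (INR b ^ 2) with (INR b * INR b) by ring; lra).
  set (rho := x / (k - x)).
  assert (Hrho : 0 <= rho) by (apply Rmult_le_pos; [lra|left; apply Rinv_0_lt_compat; lra]).
  assert (Hq : rho / (1 + rho) = x / k) by (unfold rho; field; lra).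
  assert (Hsq : (x / k) ^ 2 <= IZR num / IZR den).
  { apply Rmult_le_reg_r with (k ^ 2 * IZR den).
    - apply Rmult_lt_0_compat; [apply pow_lt|]; lra.
    - replace ((x / k) ^ 2 * (k ^ 2 * IZR den)) with (x * x * IZR den) by (field; lra).
      replace (IZR num / IZR den * (k ^ 2 * IZR den)) with (IZR num * k ^ 2) by (field; lra). easy. }
  set (t := INR a * INR c / INR b ^ 2).
  assert (Htb : t * INR b ^ 2 = INR a * INR c) by (unfold t; field; nra).
  assert (Ht : 0 < t < 1).
  { split; apply Rmult_lt_reg_r with (INR b ^ 2); try easy; lra. }
  assert (Hlt : 1 - t < rho ^ 2).
  { apply Rmult_lt_reg_r with (INR b ^ 2 * ((k - x) * (k - x))).
    - apply Rmult_lt_0_compat; [easy|]. apply Rmult_lt_0_compat; lra.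
    - replace (rho ^ 2 * (INR b ^ 2 * ((k - x) * (k - x)))) with (x * x * (INR b * INR b)) by (unfold rho; field; lra).
      replace ((1 - t) * (INR b ^ 2 * ((k - x) * (k - x)))) with ((INR b ^ 2 - t * INR b ^ 2) * ((k - x) * (k - x))) by ring.
      rewrite Htb. eapply Rle_lt_trans; [|exact H6]. right; ring. }
  assert (HQ := Q_lower t rho Ht Hrho Hlt). rewrite Hq in HQ. lra.
Qed.

(** The table is read as overlapping triples; its head is [pbar (n + 1)], one index ahead of [n]. *)
Fixpoint gap_check_list (cnt : nat) (n : Z) (l : list Z) : bool :=
  match cnt with
  | O => true
  | S k =>
      match l with
      | c :: ((b :: a :: _) as l') => gap_check n a b c && gap_check_list k (n - 1) l'
      | _ => false
      end
  end.

Lemma gap_check_list_sound cnt : forall N, (cnt <= N)%nat ->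
  gap_check_list cnt (Z.of_nat N) (pbar_table (S N)) = true ->
  forall n, (N - cnt < n <= N)%nat ->
  gap_check (Z.of_nat n) (Z.of_nat (pbar (n - 1))) (Z.of_nat (pbar n)) (Z.of_nat (pbar (n + 1))) = true.
Proof.
  induction cnt as [|k IH]; intros N HN H n Hn; [lia|].
  destruct N as [|N]; [lia|].
  assert (E0 := proj2 (pbar_table_spec (S (S N))) 0%nat ltac:(lia)).
  assert (E1 := proj2 (pbar_table_spec (S (S N))) 1%nat ltac:(lia)).
  assert (E2 := proj2 (pbar_table_spec (S (S N))) 2%nat ltac:(lia)).
  assert (Etl : tl (pbar_table (S (S N))) = pbar_table (S N)) by easy.
  destruct (pbar_table (S (S N))) as [|c [|b [|a l]]] eqn:E.
  - assert (L := proj1 (pbar_table_spec (S (S N)))). rewrite E in L. discriminate.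
  - assert (L := proj1 (pbar_table_spec (S (S N)))). rewrite E in L. discriminate.
  - assert (L := proj1 (pbar_table_spec (S (S N)))). rewrite E in L. discriminate.
  - cbn [nth] in E0, E1, E2. cbn [tl] in Etl. cbn [gap_check_list] in H.
    apply andb_true_iff in H. destruct H as [H1 H2].
    destruct (Nat.eq_dec n (S N)) as [->|Hne].
    + replace (S N - 1)%nat with (S (S N) - 2)%nat by lia.
      replace (S N + 1)%nat with (S (S N) - 0)%nat by lia.
      replace (pbar (S N)) with (pbar (S (S N) - 1)) by (f_equal; lia).
      rewrite <- E0, <- E1, <- E2. exact H1.
    + apply (IH N); [lia| |lia].
      replace (Z.of_nat N) with (Z.of_nat (S N) - 1)%Z by lia. rewrite <- Etl. exact H2.
Qed.

(** The 1410 steps run from 1501 down to 92, and the table reaches 1502 because of [pbar (n + 1)].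
    The virtual machine evaluates the check at [Qed]. *)
Lemma gap_check_finite : gap_check_list 1410 1501 (pbar_table 1502) = true.
Proof. vm_cast_no_check (eq_refl true). Qed.

Lemma gap_lt_Q_finite n : (92 <= n <= 1501)%nat -> 1 - gap n < Q (u n).
Proof.
  intros Hn. unfold u. apply gap_check_sound; [lia|].
  apply (gap_check_list_sound 1410 1501); [lia| |lia].
  exact gap_check_finite.
Qed.

(** * Upper bound for f *)

Lemma large_of_small_inverse s m : 0 < m <= 0.1043 -> s * m = 1 -> 9.5 < s.
Proof. intros Hm Hsm. destruct (Rle_dec s 9.5); [nra|lra]. Qed.

(** For [s = sqrt n] and [m = 1 / s], [a b = sqrt (s^4 - 1)] is compared with three terms of its
    binomial series; after squaring, the surplus is [m^8 / 8 + m^12 / 64]. *)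
Lemma sqrt_product_le (s m a b : R) : 0 < m <= 0.1043 -> s * m = 1 -> 0 < a -> 0 < b ->
  a * a = s * s - 1 -> b * b = s * s + 1 ->
  a * b <= s ^ 2 - m ^ 2 / 2 - m ^ 6 / 8.
Proof.
  intros Hm Hsm Ha Hb Ha2 Hb2. assert (Hs := large_of_small_inverse s m Hm Hsm).
  assert (H0 : 0 <= s ^ 2 - m ^ 2 / 2 - m ^ 6 / 8).
  { assert (m ^ 2 <= 1) by nra. assert (m ^ 6 <= 1).
    { replace (m ^ 6) with ((m ^ 2) ^ 3) by ring. rewrite <- (pow1 3). apply pow_incr. nra. }
    nra. }
  apply Rsqr_incr_0; [|nra|easy]. unfold Rsqr.
  replace (a * b * (a * b)) with ((s * s - 1) * (s * s + 1)) by (rewrite <- Ha2, <- Hb2; ring).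
  assert (E : (s ^ 2 - m ^ 2 / 2 - m ^ 6 / 8) * (s ^ 2 - m ^ 2 / 2 - m ^ 6 / 8) =
    s ^ 4 - (s * m) ^ 2 - (s * m) ^ 2 * m ^ 4 / 4 + m ^ 4 / 4 + m ^ 8 / 8 + m ^ 12 / 64) by field.
  rewrite E, Hsm.
  assert (0 <= m ^ 8) by (apply pow_le; lra). assert (0 <= m ^ 12) by (apply pow_le; lra). nra.
Qed.

(** By squaring, from [(a + b)^2 = 2 s^2 + 2 a b]. The second difference [- m^3 / 4], times [pi],
    bounds the exponent in [f] and supplies the leading term [pi / 4 * m^3] of [1 - f]. *)
Lemma sqrt_sum_le (s m a b : R) : 0 < m <= 0.1043 -> s * m = 1 -> 0 < a -> 0 < b ->
  a * a = s * s - 1 -> b * b = s * s + 1 ->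
  a + b <= 2 * s - m ^ 3 / 4.
Proof.
  intros Hm Hsm Ha Hb Ha2 Hb2. assert (Hs := large_of_small_inverse s m Hm Hsm). assert (Hp := sqrt_product_le s m a b Hm Hsm Ha Hb Ha2 Hb2).
  assert (m ^ 3 <= 1) by (rewrite <- (pow1 3); apply pow_incr; lra).
  apply Rsqr_incr_0; [|lra|lra]. unfold Rsqr.
  replace ((a + b) * (a + b)) with (a * a + b * b + 2 * (a * b)) by ring.
  replace ((2 * s - m ^ 3 / 4) * (2 * s - m ^ 3 / 4)) with
    (4 * s ^ 2 - (s * m) * m ^ 2 + m ^ 6 / 16) by field.
  rewrite Hsm, Ha2, Hb2. assert (0 <= m ^ 6) by (apply pow_le; lra). nra.
Qed.

(** By squaring, with [1 / a^2 + 1 / b^2 = 2 m^2 / (1 - m^4)] and the bound on [a b] inverted. *)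
Lemma sum_inv_sqrt_ge (s m a b : R) : 0 < m <= 0.1043 -> s * m = 1 -> 0 < a -> 0 < b ->
  a * a = s * s - 1 -> b * b = s * s + 1 ->
  (2 + 3 / 4 * m ^ 4) * m <= / a + / b.
Proof.
  intros Hm Hsm Ha Hb Ha2 Hb2. assert (Hs := large_of_small_inverse s m Hm Hsm). assert (Hp := sqrt_product_le s m a b Hm Hsm Ha Hb Ha2 Hb2).
  assert (Ha0 : 0 < / a) by (apply Rinv_0_lt_compat; easy).
  assert (Hb0 : 0 < / b) by (apply Rinv_0_lt_compat; easy).
  assert (Hm4 : 0 < m ^ 4) by (apply pow_lt; lra).
  assert (Hm41 : m ^ 4 <= 0.01).
  { apply Rle_trans with (0.1043 ^ 4); [apply pow_incr; lra|lra]. }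
  assert (Hss : s ^ 2 * m ^ 2 = 1) by (rewrite <- Rpow_mult_distr, Hsm; ring).
  apply Rsqr_incr_0; [|nra|lra]. unfold Rsqr.
  replace ((/ a + / b) * (/ a + / b)) with (/ (a * a) + / (b * b) + 2 * / (a * b)) by (field; lra).
  assert (H1 : 2 * m ^ 2 * (1 + m ^ 4 + m ^ 8) <= / (a * a) + / (b * b)).
  { rewrite Ha2, Hb2.
    replace (s * s) with (/ m ^ 2) by (apply Rmult_eq_reg_r with (m ^ 2); [rewrite Rinv_l; nra|nra]).
    replace (/ (/ m ^ 2 - 1) + / (/ m ^ 2 + 1)) with (2 * m ^ 2 * / (1 - m ^ 4)) by (field; repeat split; nra).
    apply Rmult_le_compat_l; [nra|].
    apply Rmult_le_reg_r with (1 - m ^ 4); [lra|]. rewrite Rinv_l by lra.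
    replace ((1 + m ^ 4 + m ^ 8) * (1 - m ^ 4)) with (1 - m ^ 12) by ring.
    assert (0 <= m ^ 12) by (apply pow_le; lra). lra. }
  assert (H2 : m ^ 2 * (1 + m ^ 4 / 2) <= / (a * b)).
  { apply Rmult_le_reg_r with (a * b); [apply Rmult_lt_0_compat; easy|].
    rewrite Rinv_l by nra.
    apply Rle_trans with (m ^ 2 * (1 + m ^ 4 / 2) * (s ^ 2 - m ^ 2 / 2)).
    - apply Rmult_le_compat_l; [nra|]. assert (0 <= m ^ 6) by (apply pow_le; lra). lra.
    - replace (m ^ 2 * (1 + m ^ 4 / 2) * (s ^ 2 - m ^ 2 / 2)) with
        ((1 + m ^ 4 / 2) * (s ^ 2 * m ^ 2 - m ^ 4 / 2)) by field.
      rewrite Hss. nra. }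
  assert (0 <= m ^ 10) by (apply pow_le; lra).
  replace ((2 + 3 / 4 * m ^ 4) * m * ((2 + 3 / 4 * m ^ 4) * m)) with (4 * m ^ 2 + 3 * m ^ 6 + 9 / 16 * m ^ 10) by field.
  replace (2 * m ^ 2 * (1 + m ^ 4 + m ^ 8)) with (2 * m ^ 2 + 2 * m ^ 6 + 2 * m ^ 10) in H1 by ring.
  replace (m ^ 2 * (1 + m ^ 4 / 2)) with (m ^ 2 + m ^ 6 / 2) in H2 by field.
  lra.
Qed.

Lemma sum_pow5_ge p r k : 0 <= k -> 2 * k <= p + r -> 2 * k ^ 5 <= p ^ 5 + r ^ 5.
Proof.
  intros Hk H. set (c := (p + r) / 2). set (e := (p - r) / 2).
  assert (Hkc : k <= c) by (unfold c; lra).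
  replace p with (c + e) by (unfold c, e; field). replace r with (c - e) by (unfold c, e; field).
  replace ((c + e) ^ 5 + (c - e) ^ 5) with (2 * c ^ 5 + 20 * c ^ 3 * e ^ 2 + 10 * c * e ^ 4) by ring.
  assert (k ^ 5 <= c ^ 5) by (apply pow_incr; lra).
  assert (0 <= c ^ 3 * e ^ 2) by (apply Rmult_le_pos; [apply pow_le; lra|apply pow2_ge_0]).
  assert (0 <= c * e ^ 4).
  { apply Rmult_le_pos; [lra|]. replace (e ^ 4) with ((e ^ 2) ^ 2) by ring. apply pow2_ge_0. }
  lra.
Qed.

(* The powers of [m = n^(-1/2)] in the expansion of [f]; the slack is of order [0.005 m^5] at [n = 92]. *)
Lemma f_polynomial_bound c m : 0.785397 <= c <= 0.7854 -> 0 < m <= 0.1043 ->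
  (1 - c * m ^ 3 + (c * m ^ 3) ^ 2 / 2) * (1 - 1258 / 10000 * m ^ 5 * (1 + 318 / 1000 * m)) ^ 2
  <= (1 - m ^ 4) * (1 - c * m ^ 3 + m ^ 4 - 23 / 100 * m ^ 5).
Proof.
  intros Hc Hm.
  assert (H2 : 0 < m ^ 2 <= 0.0109) by nra.
  assert (H3 : 0 < m ^ 3 <= 0.00114) by (split; [apply pow_lt; lra|simpl; nra]).
  assert (H5 : 0 < m ^ 5 <= 0.0000125).
  { split; [apply pow_lt; lra|]. apply Rle_trans with (0.1043 ^ 5); [apply pow_incr; lra|lra]. }
  set (v := 1258 / 10000 * (1 + 318 / 1000 * m)).
  assert (Hv : 0.1258 <= v <= 0.13) by (unfold v; lra).
  set (A := 1 - c * m ^ 3 + (c * m ^ 3) ^ 2 / 2).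
  assert (Hcm : 0 < c * m ^ 3 <= 0.786 * m ^ 3) by nra.
  (* [0.786 > c] and [0.3085 > c^2 / 2]. *)
  assert (HA : 1 - 0.786 * m ^ 3 <= A <= 1 - c * m ^ 3 + 0.3085 * m ^ 6).
  { unfold A. split; [nra|]. replace (m ^ 6) with (m ^ 3 * m ^ 3) by ring.
    assert ((c * m ^ 3) ^ 2 = c ^ 2 * (m ^ 3 * m ^ 3)) by ring.
    assert (c ^ 2 <= 0.617) by nra. assert (0 <= m ^ 3 * m ^ 3) by nra. nra. }
  replace (1258 / 10000 * m ^ 5 * (1 + 318 / 1000 * m)) with (m ^ 5 * v) by (unfold v; field).
  assert (Hw : 0 <= m ^ 5 * (2 * v - m ^ 5 * v ^ 2)).
  { apply Rmult_le_pos; [lra|]. assert (v ^ 2 <= 0.02) by nra. assert (0 <= v ^ 2) by nra. nra. }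
  assert (Hlow : m ^ 5 * (2 * v - 0.000001) <= m ^ 5 * (2 * v - m ^ 5 * v ^ 2)).
  { apply Rmult_le_compat_l; [lra|]. assert (0 <= v ^ 2 <= 0.02) by nra. nra. }
  assert (H1 : A * (1 - m ^ 5 * v) ^ 2 <= A - (1 - 0.786 * m ^ 3) * (m ^ 5 * (2 * v - 0.000001))).
  { replace (A * (1 - m ^ 5 * v) ^ 2) with (A - A * (m ^ 5 * (2 * v - m ^ 5 * v ^ 2))) by ring.
    assert ((1 - 0.786 * m ^ 3) * (m ^ 5 * (2 * v - 0.000001)) <= A * (m ^ 5 * (2 * v - m ^ 5 * v ^ 2))); [|lra].
    apply Rmult_le_compat; [lra| |lra|easy]. apply Rmult_le_pos; lra. }
  eapply Rle_trans; [exact H1|].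
  (* [1 - c m^3] is common to both sides and the terms in [m^4] on the right cancel; what remains
     carries [m^5], and this is the inequality after division by it. *)
  assert (Hmain : 0.3085 * m - (1 - 0.786 * m ^ 3) * (2 * v - 0.000001) <= - (23 / 100) + c * m ^ 2 - m ^ 3 + 23 / 100 * m ^ 4).
  { assert (Hv2 : (1 - 0.786 * m ^ 3) * (2 * v - 0.000001) >= 0.2515 + 0.08 * m - 0.205 * m ^ 3).
    { unfold v. nra. }
    assert (0 <= m ^ 4) by (apply pow_le; lra).
    assert (c * m ^ 2 >= 0.785 * m ^ 2) by nra.
    assert (m ^ 3 <= 0.1043 * m ^ 2) by (simpl; nra).
    nra. }
  apply Rle_trans with (1 - c * m ^ 3 + 0.3085 * m ^ 6 - (1 - 0.786 * m ^ 3) * (m ^ 5 * (2 * v - 0.000001))); [lra|].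
  replace (1 - c * m ^ 3 + 0.3085 * m ^ 6 - (1 - 0.786 * m ^ 3) * (m ^ 5 * (2 * v - 0.000001))) with
    (1 - c * m ^ 3 + m ^ 5 * (0.3085 * m - (1 - 0.786 * m ^ 3) * (2 * v - 0.000001))) by field.
  replace ((1 - m ^ 4) * (1 - c * m ^ 3 + m ^ 4 - 23 / 100 * m ^ 5)) with
    (1 - c * m ^ 3 + (m ^ 5 * (- (23 / 100) + c * m ^ 2 - m ^ 3 + 23 / 100 * m ^ 4))) by field.
  apply Rplus_le_compat_l, Rmult_le_compat_l; lra.
Qed.

(** [x^5 - x^4 - 1] and [y^5 - y^4 + 1] divided by the fifth power. The two factors bracket
    [1 - 1 / y], the correction in the asymptotic formula, and so link [f] with [pbar]. *)
Definition lower_factor (y : R) : R := 1 - / y - / y ^ 5.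
Definition upper_factor (y : R) : R := 1 - / y + / y ^ 5.

Lemma mu_pos n : (0 < n)%nat -> 0 < mu n.
Proof.
  intros H. apply Rmult_lt_0_compat; [apply PI_RGT_0|apply sqrt_lt_R0, lt_0_INR; easy].
Qed.

Lemma upper_factor_pos y : 1 < y -> 0 < upper_factor y.
Proof.
  intros Hy. unfold upper_factor.
  assert (/ y < 1) by (rewrite <- Rinv_1; apply Rinv_lt_contravar; lra).
  assert (0 < / y ^ 5) by (apply Rinv_0_lt_compat, pow_lt; lra). lra.
Qed.

Lemma mu_gt_1 n : (0 < n)%nat -> 1 < mu n.
Proof.
  intros H. unfold mu. assert (1 <= sqrt (INR n)).
  { rewrite <- sqrt_1. apply sqrt_le_1_alt. apply (le_INR 1); lia. }
  generalize PI_bounds_coarse. nra.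
Qed.

Lemma f_ov_factored n : (2 <= n)%nat ->
  f_ov n = exp (mu (n - 1) - 2 * mu n + mu (n + 1)) * (mu n ^ 4 / (mu (n - 1) ^ 2 * mu (n + 1) ^ 2)) *
   (lower_factor (mu (n - 1)) * lower_factor (mu (n + 1)) / upper_factor (mu n) ^ 2).
Proof.
  intros Hn. assert (Hx := mu_pos (n - 1) ltac:(lia)). assert (Hz := mu_pos (n + 1) ltac:(lia)).
  assert (Hy := mu_gt_1 n ltac:(lia)). assert (Hu := upper_factor_pos _ Hy).
  unfold f_ov, lower_factor. cbv zeta.
  set (x := mu (n - 1)) in *. set (y := mu n) in *. set (z := mu (n + 1)) in *.
  assert (E : y ^ 5 - y ^ 4 + 1 = y ^ 5 * upper_factor y) by (unfold upper_factor; field; lra).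
  rewrite E. field. repeat split; lra.
Qed.

(** [P], [R], [k] stand for the reciprocals of [x], [z], [y]. The product is at most the square of
    the mean [M] of its factors. The excess of [(P + R) / 2] over [k], convexity of the fifth power,
    and the opposite signs of the fifth powers put [M] below [1 - k + k^5] by [omega]. *)
Lemma factors_bound (k m P R : R) : 0 < m <= 0.1043 -> 0.3183 * m <= k <= m ->
  0 <= P <= 1 / 3 -> 0 <= R <= 1 / 3 -> 2 * k * (1 + 3 / 8 * m ^ 4) <= P + R ->
  (1 - P - P ^ 5) * (1 - R - R ^ 5) <=
  (1 - k + k ^ 5) ^ 2 * (1 - 1258 / 10000 * m ^ 5 * (1 + 318 / 1000 * m)) ^ 2.
Proof.
  intros Hm Hk HP HR H.
  assert (Hm4 : 0 < m ^ 4) by (apply pow_lt; lra).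
  assert (Hm5 : 0 < m ^ 5 <= 0.0001).
  { split; [apply pow_lt; lra|]. apply Rle_trans with (0.1043 ^ 5); [apply pow_incr; lra|lra]. }
  assert (Hk0 : 0 < k) by lra.
  assert (H2k : 2 * k <= P + R) by nra.
  assert (H5 := sum_pow5_ge P R k (Rlt_le _ _ Hk0) H2k).
  set (M := 1 - (P + R) / 2 - (P ^ 5 + R ^ 5) / 2).
  assert (H15 : forall w, 0 <= w <= 1 / 3 -> w ^ 5 <= 1 / 3).
  { intros w Hw. apply Rle_trans with ((1 / 3) ^ 5); [apply pow_incr; lra|lra]. }
  assert (HM0 : 0 <= M) by (generalize (H15 P HP) (H15 R HR); unfold M; lra).
  set (omega := 3 / 8 * k * m ^ 4 + 2 * k ^ 5).
  set (beta := 1 - k + k ^ 5).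
  assert (Hk5 : 0 < k ^ 5) by (apply pow_lt; lra).
  assert (HM1 : M <= beta - omega) by (unfold M, beta, omega; lra).
  assert (Hbeta : 0 < beta /\ beta * (1 + k) <= 1).
  { unfold beta. split; [lra|].
    replace ((1 - k + k ^ 5) * (1 + k)) with (1 - k ^ 2 * (1 - k ^ 3 - k ^ 4)) by ring.
    assert (k ^ 3 <= 0.1043 ^ 3) by (apply pow_incr; lra). assert (k ^ 4 <= 0.1043 ^ 4) by (apply pow_incr; lra).
    assert (0 <= k ^ 2 * (1 - k ^ 3 - k ^ 4)) by (apply Rmult_le_pos; [apply pow2_ge_0|lra]). lra. }
  assert (Hom0 : 0 < omega).
  { unfold omega. assert (0 < k * m ^ 4) by (apply Rmult_lt_0_compat; lra). lra. }
  (* [3/8 * 0.3183 + 2 * 0.3183^5 > 0.1258], with [0.3183 < 1 / pi]; dividing by [beta] gains the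
     factor [1 + k >= 1 + 0.318 m]. *)
  assert (Hom : 1258 / 10000 * m ^ 5 * (1 + 318 / 1000 * m) <= omega * (1 + k)).
  { apply Rmult_le_compat; [lra|lra| |lra].
    unfold omega. assert (0.3183 ^ 5 * m ^ 5 <= k ^ 5).
    { rewrite <- Rpow_mult_distr. apply pow_incr. lra. }
    assert (0.3183 * m * m ^ 4 <= k * m ^ 4) by (apply Rmult_le_compat_r; lra).
    lra. }
  set (omega' := 1258 / 10000 * m ^ 5 * (1 + 318 / 1000 * m)) in *.
  assert (Hom' : 0 <= omega' <= 0.001).
  { assert (0 <= m ^ 5 * m) by (apply Rmult_le_pos; lra).
    assert (m ^ 5 * m <= 0.0001 * 1) by (apply Rmult_le_compat; lra).
    unfold omega'. lra. }
  assert (HM2 : M <= beta * (1 - omega')).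
  { assert (omega * (beta * (1 + k)) <= omega * 1) by (apply Rmult_le_compat_l; lra).
    assert (beta * omega' <= beta * (omega * (1 + k))) by (apply Rmult_le_compat_l; lra). lra. }
  apply Rle_trans with (M ^ 2).
  - unfold M. assert (0 <= ((1 - P - P ^ 5) - (1 - R - R ^ 5)) ^ 2) by apply pow2_ge_0. lra.
  - rewrite <- Rpow_mult_distr. apply pow_incr. lra.
Qed.

(** [0.1043] lies just above [92^(-1/2)]; the later estimates are polynomial in [m] on this
    interval. *)
Lemma sqrt_data n : (92 <= n)%nat ->
  let s := sqrt (INR n) in let m := / s in
  let a := sqrt (INR (n - 1)) in let b := sqrt (INR (n + 1)) in
  0 < m <= 0.1043 /\ s * m = 1 /\ 0 < a /\ 0 < b /\ a * a = s * s - 1 /\ b * b = s * s + 1 /\ s * s = INR n.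
Proof.
  intros Hn. cbv zeta.
  assert (HnR : 92 <= INR n) by (apply (le_INR 92) in Hn; simpl in Hn; lra).
  assert (Hs : 9.59 <= sqrt (INR n)).
  { apply Rle_trans with (sqrt (9.59 ^ 2)); [rewrite sqrt_pow2; lra|]. apply sqrt_le_1_alt. lra. }
  assert (Hss : sqrt (INR n) * sqrt (INR n) = INR n) by (apply sqrt_sqrt; lra).
  assert (H1 : INR (n - 1) = INR n - 1) by (rewrite minus_INR by lia; simpl; ring).
  assert (H2 : INR (n + 1) = INR n + 1) by (rewrite plus_INR; simpl; ring).
  rewrite H1, H2, Hss. repeat split.
  - apply Rinv_0_lt_compat; lra.
  - apply Rle_trans with (/ 9.59); [apply Rinv_le_contravar; lra|lra].
  - field; lra.
  - apply sqrt_lt_R0; lra.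
  - apply sqrt_lt_R0; lra.
  - apply sqrt_sqrt; lra.
  - apply sqrt_sqrt; lra.
Qed.

(** In powers of [m = n^(-1/2)]: [pi / 4 * m^3] comes from the exponent of [f], [m^4] from
    [y^4 / (x^2 z^2) = 1 / (1 - m^4)], and [0.23 m^5] is what is kept of the [2 * 0.1258 m^5] from
    the remaining factors. *)
Lemma gap_eq n : (92 <= n)%nat -> let m := / sqrt (INR n) in
  gap n = PI / 4 * m ^ 3 - m ^ 4 + 0.23 * m ^ 5 - 1000 / mu (n - 1) ^ 5.
Proof.
  intros Hn. cbv zeta. destruct (sqrt_data n Hn) as [Hm [Hsm [_ [_ [_ [_ Hss]]]]]].
  unfold gap. set (s := sqrt (INR n)) in *.
  assert (Hs : s <> 0) by (intros E; rewrite E in Hsm; lra).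
  rewrite <- Hss.
  replace (s / (s * s) ^ 2) with ((/ s) ^ 3) by (field; easy).
  replace (/ (s * s) ^ 2) with ((/ s) ^ 4) by (field; easy).
  replace (s / (s * s) ^ 3) with ((/ s) ^ 5) by (field; easy). easy.
Qed.

(** The exponential, the prefactor and the correction factors are bounded separately in [m]. The
    term [1000 / mu (n - 1) ^ 5] is part of [gap], so that this one inequality serves both ranges of
    [n]. *)
Lemma f_ov_upper_bound n : (92 <= n)%nat -> f_ov n + 1000 / mu (n - 1) ^ 5 <= 1 - gap n.
Proof.
  intros Hn. rewrite gap_eq by easy. cbv zeta.
  destruct (sqrt_data n Hn) as [Hm [Hsm [Ha [Hb [Ha2 [Hb2 Hss]]]]]].
  assert (Hxp := mu_pos (n - 1) ltac:(lia)). assert (Hzp := mu_pos (n + 1) ltac:(lia)).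
  assert (Hy1 := mu_gt_1 n ltac:(lia)). assert (Hu := upper_factor_pos _ Hy1).
  rewrite f_ov_factored by lia.
  assert (HP := PI_bounds).
  set (s := sqrt (INR n)) in *. set (m := / s) in *.
  set (a := sqrt (INR (n - 1))) in *. set (b := sqrt (INR (n + 1))) in *.
  assert (Hs := large_of_small_inverse s m Hm Hsm).
  assert (Hsum := sqrt_sum_le s m a b Hm Hsm Ha Hb Ha2 Hb2).
  assert (Hinv := sum_inv_sqrt_ge s m a b Hm Hsm Ha Hb Ha2 Hb2).
  assert (Ex : mu (n - 1) = PI * a) by easy. assert (Ey : mu n = PI * s) by easy.
  assert (Ez : mu (n + 1) = PI * b) by easy.
  set (c := PI / 4).
  assert (Hc : 0.785397 <= c <= 0.7854) by (unfold c; lra).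
  assert (Hm3 : 0 < m ^ 3) by (apply pow_lt; lra).
  assert (Hm4 : 0 < m ^ 4 <= 0.01).
  { split; [apply pow_lt; lra|]. apply Rle_trans with (0.1043 ^ 4); [apply pow_incr; lra|lra]. }
  assert (He : exp (mu (n - 1) - 2 * mu n + mu (n + 1)) <= 1 - c * m ^ 3 + (c * m ^ 3) ^ 2 / 2).
  { eapply Rle_trans; [|apply exp_neg_quadratic_le; nra].
    apply exp_le_compat. rewrite Ex, Ey, Ez. unfold c. nra. }
  assert (Hpref : mu n ^ 4 / (mu (n - 1) ^ 2 * mu (n + 1) ^ 2) = / (1 - m ^ 4)).
  { rewrite Ex, Ey, Ez.
    replace ((PI * s) ^ 4 / ((PI * a) ^ 2 * (PI * b) ^ 2)) with (s ^ 4 / ((a * a) * (b * b))) by (field; repeat split; lra).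
    rewrite Ha2, Hb2. unfold m.
    assert (1 - (/ s) ^ 4 <> 0) by (fold m; lra). field. repeat split; nra. }
  assert (Hfac : lower_factor (mu (n - 1)) * lower_factor (mu (n + 1)) / upper_factor (mu n) ^ 2 <=
     (1 - 1258 / 10000 * m ^ 5 * (1 + 318 / 1000 * m)) ^ 2).
  { apply Rmult_le_reg_r with (upper_factor (mu n) ^ 2); [apply pow_lt; easy|].
    unfold Rdiv at 1. rewrite Rmult_assoc, Rinv_l by (apply pow_nonzero; lra). rewrite Rmult_1_r.
    rewrite (Rmult_comm (_ ^ 2) (upper_factor (mu n) ^ 2)).
    unfold lower_factor, upper_factor. rewrite <- !pow_inv.
    assert (HiPI : 0.3183 <= / PI <= 1).
    { split; [|rewrite <- Rinv_1; apply Rinv_le_contravar; lra].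
      apply Rle_trans with (/ 3.1416); [lra|apply Rinv_le_contravar; lra]. }
    assert (Hthird : forall w, w * w = s * s - 1 \/ w * w = s * s + 1 -> 0 < w -> 0 <= / (PI * w) <= 1 / 3).
    { intros w Hw Hw0. assert (1 <= w) by (destruct Hw; nra). split; [left; apply Rinv_0_lt_compat; nra|].
      apply Rle_trans with (/ 3); [|lra]. apply Rinv_le_contravar; nra. }
    apply factors_bound; [easy| | | |].
    - rewrite Ey, Rinv_mult. fold m. nra.
    - rewrite Ex. apply Hthird; auto.
    - rewrite Ez. apply Hthird; auto.
    - rewrite Ex, Ey, Ez, !Rinv_mult. fold m.
      replace (2 * (/ PI * m) * (1 + 3 / 8 * m ^ 4)) with (/ PI * ((2 + 3 / 4 * m ^ 4) * m)) by (field; lra).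
      rewrite <- Rmult_plus_distr_l. apply Rmult_le_compat_l; lra. }
  assert (Hpoly := f_polynomial_bound c m Hc Hm).
  rewrite Hpref.
  set (ex := exp _) in *. set (F := lower_factor _ * lower_factor _ / _) in *.
  set (E := 1 - c * m ^ 3 + (c * m ^ 3) ^ 2 / 2) in *.
  set (W := (1 - 1258 / 10000 * m ^ 5 * (1 + 318 / 1000 * m)) ^ 2) in *.
  assert (Hex : 0 < ex) by apply exp_pos.
  assert (HW : 0 <= W) by apply pow2_ge_0.
  assert (Hprod : ex * F <= E * W).
  { apply Rle_trans with (ex * W); [apply Rmult_le_compat_l; lra|apply Rmult_le_compat_r; lra]. }
  assert (Hfin : ex * / (1 - m ^ 4) * F <= 1 - c * m ^ 3 + m ^ 4 - 0.23 * m ^ 5).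
  { apply Rmult_le_reg_l with (1 - m ^ 4); [lra|].
    replace ((1 - m ^ 4) * (ex * / (1 - m ^ 4) * F)) with (ex * F) by (field; lra). lra. }
  lra.
Qed.

(** * Large n *)

(** By seventh roots: [0.35 = 7 * 0.05] and [1.6^7 > 18]. The value 119.9 lies below [mu 1500]. *)
Lemma exp_dominates y : 119.9 <= y -> 18 * y ^ 7 <= exp (0.35 * y).
Proof.
  intros Hy.
  assert (He : 2.5 <= exp 1).
  { assert (H := exp_partial_sum_le 1 3 ltac:(lra)). simpl in H. lra. }
  assert (Hw : 1.6 * y <= exp (0.05 * y)).
  { replace (0.05 * y) with (INR 5 * 1 + (0.05 * y - 5)) by (simpl; lra).
    rewrite exp_plus, <- exp_pow_INR.
    assert (2.5 ^ 5 <= exp 1 ^ 5) by (apply pow_incr; lra).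
    generalize (exp_ineq1_le (0.05 * y - 5)). intros H1.
    apply Rle_trans with (2.5 ^ 5 * (1 + (0.05 * y - 5))); [lra|].
    apply Rmult_le_compat; lra. }
  replace (0.35 * y) with (INR 7 * (0.05 * y)) by (simpl; lra). rewrite <- exp_pow_INR.
  apply Rle_trans with ((1.6 * y) ^ 7).
  - rewrite Rpow_mult_distr. apply Rmult_le_compat_r; [apply pow_le; lra|lra].
  - apply pow_incr. lra.
Qed.

(** [pi^2 / (8 y^2)] is [1 / (8 n)]. The error of order [e^(0.65 y)] has to stay below [K / y^5],
    and [K] itself carries [1 / y^2]; hence the power [y^7] that [e^(0.35 y)] must beat. *)
Lemma pbar_sandwich n : (1500 <= n)%nat ->
  let y := mu n in let K := PI ^ 2 / (8 * y ^ 2) * exp y in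
  K * lower_factor y <= INR (pbar n) <= K * upper_factor y.
Proof.
  intros Hn. cbv zeta. assert (H := pbar_asymptotic n Hn).
  assert (HnR : 1500 <= INR n) by (apply (le_INR 1500) in Hn; simpl in Hn; lra).
  assert (HP := PI_bounds).
  assert (Hs : 38.7 <= sqrt (INR n)).
  { apply Rle_trans with (sqrt (38.7 ^ 2)); [rewrite sqrt_pow2; lra|]. apply sqrt_le_1_alt. lra. }
  assert (Hss : sqrt (INR n) * sqrt (INR n) = INR n) by (apply sqrt_sqrt; lra).
  assert (Hy : 119.9 <= mu n) by (unfold mu; nra).
  assert (Hn4 : / (4 * INR n) = PI ^ 2 / (4 * mu n ^ 2)).
  { unfold mu. rewrite <- Hss at 1. field. lra. }
  set (y := mu n) in *.
  set (err := 20 * exp (0.65 * y)) in *.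
  assert (Hdom := exp_dominates y Hy).
  set (g := PI ^ 2 / (8 * y ^ 2)).
  assert (Hy2 : 0 < y ^ 2) by (apply pow_lt; lra).
  assert (Hg : 0 < g) by (unfold g; apply Rdiv_lt_0_compat; nra).
  assert (HA : (cosh y - sinh y / y) / (4 * INR n) = g * (exp y * (1 - / y) + exp (- y) * (1 + / y))).
  { unfold Rdiv at 1. rewrite Hn4. unfold cosh, sinh, g. field. lra. }
  rewrite HA in H. apply Rabs_le_between in H.
  assert (Hy5 : 0 < y ^ 5) by (apply pow_lt; lra).
  assert (Herr : err + g * (exp (- y) * (1 + / y)) <= g * exp y * / y ^ 5).
  { assert (Hiy : 0 < / y <= 1).
    { split; [apply Rinv_0_lt_compat; lra|rewrite <- Rinv_1; apply Rinv_le_contravar; lra]. }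
    assert (He1 : exp (- y) <= 1) by (rewrite <- exp_0; apply exp_le_compat; lra).
    assert (He0 := exp_pos (- y)).
    set (e := exp (0.65 * y)) in *.
    assert (He : 1 <= e) by (unfold e; rewrite <- exp_0; apply exp_le_compat; lra).
    assert (Hexp : exp y = e * exp (0.35 * y)) by (unfold e; rewrite <- exp_plus; f_equal; lra).
    assert (Hgy : g * (8 * y ^ 2) = PI ^ 2) by (unfold g; field; lra).
    assert (HPI2 : 9.8 <= PI ^ 2) by nra.
    apply Rmult_le_reg_r with (y ^ 5); [easy|].
    rewrite !Rmult_assoc, Rinv_l, Rmult_1_r by lra.
    assert (Herr1 : err <= g * (17 * y ^ 2 * e)).
    { unfold err. replace (g * (17 * y ^ 2 * e)) with (17 / 8 * (g * (8 * y ^ 2)) * e) by field. rewrite Hgy.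
      apply Rmult_le_compat_r; lra. }
    apply Rle_trans with (g * ((17 * y ^ 2 * e + 2) * y ^ 5)).
    - replace (g * ((17 * y ^ 2 * e + 2) * y ^ 5)) with ((g * (17 * y ^ 2 * e) + g * 2) * y ^ 5) by ring.
      apply Rmult_le_compat_r; [lra|]. apply Rplus_le_compat; [easy|].
      apply Rmult_le_compat_l; [lra|]. nra.
    - apply Rmult_le_compat_l; [lra|]. rewrite Hexp.
      apply Rle_trans with (e * (18 * y ^ 7)); [|apply Rmult_le_compat_l; lra].
      replace ((17 * y ^ 2 * e + 2) * y ^ 5) with (17 * y ^ 7 * e + 2 * y ^ 5) by ring.
      replace (y ^ 7) with (y ^ 2 * y ^ 5) by ring.
      assert (2 <= y ^ 2) by nra.
      assert (2 * y ^ 5 <= y ^ 2 * y ^ 5) by (apply Rmult_le_compat_r; lra).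
      assert (0 < y ^ 2 * y ^ 5) by (apply Rmult_lt_0_compat; lra). nra. }
  assert (0 <= g * (exp (- y) * (1 + / y))).
  { apply Rmult_le_pos; [lra|]. apply Rmult_le_pos; [left; apply exp_pos|].
    assert (0 < / y) by (apply Rinv_0_lt_compat; lra). lra. }
  unfold lower_factor, upper_factor. split; lra.
Qed.

Lemma lower_factor_bounds y : 100 <= y -> 0.98 <= lower_factor y <= 1.
Proof.
  intros Hy. unfold lower_factor.
  assert (H1 : 0 < / y <= 0.01).
  { split; [apply Rinv_0_lt_compat; lra|]. replace 0.01 with (/ 100) by lra. apply Rinv_le_contravar; lra. }
  rewrite <- pow_inv. assert (0 < (/ y) ^ 5) by (apply pow_lt; lra).
  assert ((/ y) ^ 5 <= 0.01 ^ 5) by (apply pow_incr; lra). lra.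
Qed.

Lemma upper_factor_bounds y : 100 <= y -> 0.98 <= upper_factor y <= 1.
Proof.
  intros Hy. unfold upper_factor.
  assert (H1 : 0 < / y <= 0.01).
  { split; [apply Rinv_0_lt_compat; lra|]. replace 0.01 with (/ 100) by lra. apply Rinv_le_contravar; lra. }
  rewrite <- pow_inv. assert (0 < (/ y) ^ 5) by (apply pow_lt; lra).
  assert ((/ y) ^ 5 <= / y * 0.01 ^ 4).
  { simpl pow at 1. apply Rmult_le_compat_l; [lra|]. change ((/ y) ^ 4 <= 0.01 ^ 4). apply pow_incr; lra. }
  lra.
Qed.

Lemma mu_ge_100 n : (1500 <= n)%nat -> 100 <= mu n.
Proof.
  intros Hn. assert (HnR : 1500 <= INR n) by (apply (le_INR 1500) in Hn; simpl in Hn; lra).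
  assert (Hs : 38.7 <= sqrt (INR n)).
  { apply Rle_trans with (sqrt (38.7 ^ 2)); [rewrite sqrt_pow2; lra|]. apply sqrt_le_1_alt. lra. }
  generalize PI_bounds_coarse. unfold mu. nra.
Qed.

(** The lower bounds at [n - 1] and [n + 1] and the upper bound at [n] combine to exactly [f_ov n].
    The bound 2 is for the case [u n >= 1], where [Q_ge_1] takes over. *)
Lemma f_ov_le_u_le_2 n : (1501 <= n)%nat -> 0 < f_ov n <= u n /\ u n <= 2.
Proof.
  intros Hn.
  destruct (pbar_sandwich (n - 1) ltac:(lia)) as [X1 X2].
  destruct (pbar_sandwich n ltac:(lia)) as [Y1 Y2].
  destruct (pbar_sandwich (n + 1) ltac:(lia)) as [Z1 Z2].
  assert (Hx := mu_ge_100 (n - 1) ltac:(lia)). assert (Hy := mu_ge_100 n ltac:(lia)).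
  assert (Hz := mu_ge_100 (n + 1) ltac:(lia)).
  assert (Lx := lower_factor_bounds _ Hx). assert (Ly := lower_factor_bounds _ Hy).
  assert (Lz := lower_factor_bounds _ Hz). assert (Ux := upper_factor_bounds _ Hx).
  assert (Uy := upper_factor_bounds _ Hy). assert (Uz := upper_factor_bounds _ Hz).
  rewrite f_ov_factored by lia. unfold u.
  destruct (sqrt_data n ltac:(lia)) as [Hm [Hsm [Ha [Hb [Ha2 [Hb2 Hss]]]]]].
  assert (Hsum := sqrt_sum_le _ _ _ _ Hm Hsm Ha Hb Ha2 Hb2).
  assert (HP := PI_bounds).
  assert (Hex : exp (mu (n - 1) - 2 * mu n + mu (n + 1)) <= 1).
  { rewrite <- exp_0. apply exp_le_compat. unfold mu.
    assert (0 < (/ sqrt (INR n)) ^ 3) by (apply pow_lt; lra). nra. }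
  assert (Hxz : mu n ^ 4 <= 1.01 * (mu (n - 1) ^ 2 * mu (n + 1) ^ 2)).
  { unfold mu.
    replace ((PI * sqrt (INR n)) ^ 4) with (PI ^ 4 * ((sqrt (INR n) * sqrt (INR n)) * (sqrt (INR n) * sqrt (INR n)))) by ring.
    replace ((PI * sqrt (INR (n - 1))) ^ 2 * (PI * sqrt (INR (n + 1))) ^ 2) with
      (PI ^ 4 * ((sqrt (INR (n - 1)) * sqrt (INR (n - 1))) * (sqrt (INR (n + 1)) * sqrt (INR (n + 1))))) by ring.
    rewrite Ha2, Hb2, Hss.
    assert (1501 <= INR n) by (apply (le_INR 1501) in Hn; simpl in Hn; lra).
    assert (0 < PI ^ 4) by (apply pow_lt; lra).
    assert (INR n * INR n <= 1.01 * ((INR n - 1) * (INR n + 1))) by nra.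
    nra. }
  set (x := mu (n - 1)) in *. set (y := mu n) in *. set (z := mu (n + 1)) in *.
  assert (Hx2 : 0 < x ^ 2) by (apply pow_lt; lra). assert (Hy2 : 0 < y ^ 2) by (apply pow_lt; lra).
  assert (Hz2 : 0 < z ^ 2) by (apply pow_lt; lra).
  assert (HPI2 : 0 < PI ^ 2) by (apply pow_lt; lra).
  set (A := PI ^ 2 / (8 * x ^ 2) * exp x) in *. set (B := PI ^ 2 / (8 * y ^ 2) * exp y) in *.
  set (C := PI ^ 2 / (8 * z ^ 2) * exp z) in *.
  assert (HA : 0 < A) by (apply Rmult_lt_0_compat; [apply Rdiv_lt_0_compat; lra|apply exp_pos]).
  assert (HB : 0 < B) by (apply Rmult_lt_0_compat; [apply Rdiv_lt_0_compat; lra|apply exp_pos]).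
  assert (HC : 0 < C) by (apply Rmult_lt_0_compat; [apply Rdiv_lt_0_compat; lra|apply exp_pos]).
  set (E := exp (x - 2 * y + z)) in *.
  assert (HE : 0 < E) by apply exp_pos.
  assert (HABC : A * C = E * (y ^ 4 / (x ^ 2 * z ^ 2)) * B ^ 2).
  { assert (Hexp : E * (exp y * exp y) = exp x * exp z) by (unfold E; rewrite <- !exp_plus; f_equal; ring).
    unfold A, B, C.
    replace (PI ^ 2 / (8 * x ^ 2) * exp x * (PI ^ 2 / (8 * z ^ 2) * exp z)) with
      (PI ^ 4 / (64 * (x ^ 2 * z ^ 2)) * (exp x * exp z)) by (field; lra).
    rewrite <- Hexp. field. lra. }
  set (G := E * (y ^ 4 / (x ^ 2 * z ^ 2))) in *.
  assert (HG : 0 < G).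
  { apply Rmult_lt_0_compat; [easy|]. apply Rdiv_lt_0_compat; [apply pow_lt; lra|].
    apply Rmult_lt_0_compat; easy. }
  assert (HG1 : G <= 1.01).
  { assert (Hq : y ^ 4 / (x ^ 2 * z ^ 2) <= 1.01).
    { apply Rmult_le_reg_r with (x ^ 2 * z ^ 2); [apply Rmult_lt_0_compat; easy|].
      unfold Rdiv. rewrite Rmult_assoc, Rinv_l by nra. lra. }
    assert (0 < y ^ 4 / (x ^ 2 * z ^ 2)).
    { apply Rdiv_lt_0_compat; [apply pow_lt; lra|apply Rmult_lt_0_compat; easy]. }
    unfold G. apply Rle_trans with (1 * 1.01); [apply Rmult_le_compat; lra|lra]. }
  set (p := INR (pbar (n - 1))) in *. set (q := INR (pbar n)) in *. set (r := INR (pbar (n + 1))) in *.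
  set (lx := lower_factor x) in *. set (ly := lower_factor y) in *. set (lz := lower_factor z) in *.
  set (ux := upper_factor x) in *. set (uy := upper_factor y) in *. set (uz := upper_factor z) in *.
  assert (Hp : 0 < A * lx) by (apply Rmult_lt_0_compat; lra).
  assert (Hr : 0 < C * lz) by (apply Rmult_lt_0_compat; lra).
  assert (Hq : 0 < B * ly) by (apply Rmult_lt_0_compat; lra).
  assert (Hq2 : 0 < q ^ 2) by (apply pow_lt; lra).
  split; [split|].
  - apply Rmult_lt_0_compat; [easy|]. apply Rdiv_lt_0_compat; [apply Rmult_lt_0_compat; lra|apply pow_lt; lra].
  - apply Rmult_le_reg_r with (q ^ 2); [easy|].
    replace (p * r / q ^ 2 * q ^ 2) with (p * r) by (field; lra).
    apply Rle_trans with (A * lx * (C * lz)); [|apply Rmult_le_compat; lra].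
    apply Rle_trans with (G * (lx * lz / uy ^ 2) * (B * uy) ^ 2).
    + apply Rmult_le_compat_l; [|apply pow_incr; lra].
      apply Rmult_le_pos; [lra|]. apply Rmult_le_pos; [apply Rmult_le_pos; lra|].
      left; apply Rinv_0_lt_compat, pow_lt; lra.
    + right. replace (A * lx * (C * lz)) with (A * C * (lx * lz)) by ring. rewrite HABC. field. lra.
  - apply Rmult_le_reg_r with (q ^ 2); [easy|].
    replace (p * r / q ^ 2 * q ^ 2) with (p * r) by (field; lra).
    apply Rle_trans with (A * ux * (C * uz)); [apply Rmult_le_compat; lra|].
    apply Rle_trans with (2 * (B * ly) ^ 2); [|apply Rmult_le_compat_l; [lra|apply pow_incr; lra]].
    replace (A * ux * (C * uz)) with (A * C * (ux * uz)) by ring. rewrite HABC.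
    replace (2 * (B * ly) ^ 2) with (B ^ 2 * (2 * ly ^ 2)) by ring.
    replace (G * B ^ 2 * (ux * uz)) with (B ^ 2 * (G * (ux * uz))) by ring.
    assert (0 < B ^ 2) by (apply pow_lt; lra).
    apply Rmult_le_compat_l; [lra|].
    assert (ux * uz <= 1) by nra. assert (0 <= ux * uz) by nra. assert (0.98 * 0.98 <= ly ^ 2) by nra. nra.
Qed.

(** For [t >= 1] the real square root of the nonpositive [(1 - t)^3] is 0 by convention, so
    [Q t = (3 t - 2) / t^2], and [(t - 1) (t - 2) <= 0] gives the claim. *)
Lemma Q_ge_1 t : 1 <= t <= 2 -> 1 <= Q t.
Proof.
  intros Ht. unfold Q.
  replace (sqrt ((1 - t) ^ 3)) with 0.
  - apply Rmult_le_reg_r with (t ^ 2); [apply pow_lt; lra|].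
    unfold Rdiv. rewrite Rmult_assoc, Rinv_l by (apply pow_nonzero; lra). nra.
  - symmetry. apply sqrt_neg_0. assert (0 <= (t - 1) ^ 3) by (apply pow_le; lra). nra.
Qed.

Lemma inv_mu_pow5_bound n : (1501 <= n)%nat ->
  1000 / mu (n - 1) ^ 5 <= 3.4 * (/ sqrt (INR n)) ^ 5.
Proof.
  intros Hn. destruct (sqrt_data n ltac:(lia)) as [Hm [Hsm [Ha [Hb [Ha2 [Hb2 Hss]]]]]].
  assert (HP := PI_bounds).
  assert (HnR : 1501 <= INR n) by (apply (le_INR 1501) in Hn; simpl in Hn; lra).
  unfold mu. set (s := sqrt (INR n)) in *. set (a := sqrt (INR (n - 1))) in *.
  assert (Hs : 0 < s) by (apply sqrt_lt_R0; lra).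
  assert (Has : 0.999 * s <= a).
  { apply Rsqr_incr_0; [|lra|lra]. unfold Rsqr. rewrite Ha2. nra. }
  assert (HP5 : 306 <= PI ^ 5).
  { apply Rle_trans with (3.14159 ^ 5); [lra|]. apply pow_incr; lra. }
  assert (Ha5 : (0.999 * s) ^ 5 <= a ^ 5) by (apply pow_incr; lra).
  assert (Hs5 : 0 < s ^ 5) by (apply pow_lt; easy).
  rewrite Rpow_mult_distr in *.
  assert (H5 : 304 * s ^ 5 <= PI ^ 5 * a ^ 5).
  { apply Rle_trans with (306 * (0.999 ^ 5 * s ^ 5)); [|apply Rmult_le_compat; lra].
    assert (0.994 <= 0.999 ^ 5) by lra. nra. }
  rewrite pow_inv.
  apply Rle_trans with (1000 * / (304 * s ^ 5)).
  - unfold Rdiv. apply Rmult_le_compat_l; [lra|]. apply Rinv_le_contravar; lra.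
  - rewrite Rinv_mult. assert (0 < / s ^ 5) by (apply Rinv_0_lt_compat; easy). lra.
Qed.

(** With [t = 1 - r^2] the right side is [Q t - t], about [2 r^3]; a lower bound [w] for [r], free
    of square roots, makes this gain explicit. *)
Lemma sqr_minus_ratio_sqr_ge w r : 0 <= w <= 0.01 -> w <= r ->
  r ^ 2 * (2 * w - 3 * w ^ 2) <= r ^ 2 - (r / (1 + r)) ^ 2.
Proof.
  intros Hw Hr.
  replace (r ^ 2 - (r / (1 + r)) ^ 2) with (r ^ 2 * (1 - (/ (1 + r)) ^ 2)) by (field; lra).
  apply Rmult_le_compat_l; [apply pow2_ge_0|].
  assert (H : (/ (1 + r)) ^ 2 <= (/ (1 + w)) ^ 2).
  { apply pow_incr. split; [left; apply Rinv_0_lt_compat; lra|apply Rinv_le_contravar; lra]. }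
  assert (H2 : (/ (1 + w)) ^ 2 <= 1 - 2 * w + 3 * w ^ 2).
  { rewrite pow_inv. apply Rmult_le_reg_l with ((1 + w) ^ 2); [apply pow_lt; lra|].
    rewrite Rinv_r by (apply pow_nonzero; lra).
    replace ((1 + w) ^ 2 * (1 - 2 * w + 3 * w ^ 2)) with (1 + 4 * w ^ 3 + 3 * w ^ 4) by ring.
    assert (0 <= w ^ 3) by (apply pow_le; lra). assert (0 <= w ^ 4) by (apply pow_le; lra). lra. }
  lra.
Qed.

Lemma f_ov_lt_Q_tail n : (1501 <= n)%nat -> f_ov n + 1000 / mu (n - 1) ^ 5 < Q (u n).
Proof.
  intros Hn. destruct (f_ov_le_u_le_2 n Hn) as [[Hf0 Hfu] Hu2].
  assert (Hup := f_ov_upper_bound n ltac:(lia)). rewrite gap_eq in Hup by lia. cbv zeta in Hup.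
  assert (Hinv := inv_mu_pow5_bound n Hn).
  assert (Hpos : 0 < 1000 / mu (n - 1) ^ 5).
  { apply Rdiv_lt_0_compat; [lra|]. apply pow_lt, mu_pos; lia. }
  destruct (sqrt_data n ltac:(lia)) as [_ [Hsm [_ [_ [_ [_ Hss]]]]]].
  assert (HnR : 1501 <= INR n) by (apply (le_INR 1501) in Hn; simpl in Hn; lra).
  assert (Hs : 38.7 <= sqrt (INR n)).
  { apply Rle_trans with (sqrt (38.7 ^ 2)); [rewrite sqrt_pow2; lra|]. apply sqrt_le_1_alt. lra. }
  assert (HP := PI_bounds).
  set (s := sqrt (INR n)) in *. set (m := / s) in *.
  assert (Hm : 0 < m <= 0.026).
  { unfold m. split; [apply Rinv_0_lt_compat; lra|].
    apply Rle_trans with (/ 38.7); [apply Rinv_le_contravar; lra|lra]. }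
  set (eps := 1000 / mu (n - 1) ^ 5) in *.
  assert (Hm2 : 0 < m ^ 2 <= 0.0007) by nra.
  assert (Hm3 : 0 < m ^ 3) by (apply pow_lt; lra).
  assert (Hm5 : 0 < m ^ 5) by (apply pow_lt; lra).
  assert (Hm43 : m ^ 4 <= 0.026 * m ^ 3) by (replace (m ^ 4) with (m * m ^ 3) by ring; apply Rmult_le_compat_r; lra).
  assert (Hm53 : m ^ 5 <= 0.001 * m ^ 3) by (replace (m ^ 5) with (m ^ 2 * m ^ 3) by ring; apply Rmult_le_compat_r; lra).
  assert (Hsf : 0.75 * m ^ 3 <= 1 - f_ov n) by nra.
  (* If [u n >= 1] then [Q (u n) >= 1], while [1 - f_ov n], of order [m^3], exceeds the fifth-order
     term. *)
  destruct (Rle_dec 1 (u n)) as [H1|H1].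
  - assert (HQ := Q_ge_1 (u n) (conj H1 Hu2)). nra.
  - rewrite Q_alt by lra.
    set (r := sqrt (1 - u n)). set (rf := sqrt (1 - f_ov n)).
    assert (Hrrf : r <= rf) by (apply sqrt_le_1_alt; lra).
    assert (Hrf2 : rf ^ 2 = 1 - f_ov n) by (apply pow2_sqrt; lra).
    assert (Hr0 : 0 <= r) by apply sqrt_pos.
    (* [Q] increases, so [u n] may be replaced by [f_ov n], for which [1 - f_ov n] has an explicit
       lower bound. *)
    assert (Hmono : (r / (1 + r)) ^ 2 <= (rf / (1 + rf)) ^ 2).
    { destruct Hrrf as [Hlt|Heq]; [left; apply ratio_sqr_mono; lra|rewrite Heq; lra]. }
    assert (Hw : 3 * m ^ 2 <= rf).
    { apply Rsqr_incr_0; [|lra|lra]. unfold Rsqr.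
      replace (rf * rf) with (rf ^ 2) by ring. rewrite Hrf2.
      replace (3 * m ^ 2 * (3 * m ^ 2)) with (9 * m ^ 4) by ring. lra. }
    assert (Hgain := sqr_minus_ratio_sqr_ge (3 * m ^ 2) rf ltac:(lra) Hw).
    (* [0.75 * 5.9 > 4]: the gain exceeds the [3.4 m^5] that bounds [1000 / mu (n - 1) ^ 5]. *)
    assert (Hbig : 4 * m ^ 5 <= rf ^ 2 * (2 * (3 * m ^ 2) - 3 * (3 * m ^ 2) ^ 2)).
    { rewrite Hrf2. apply Rle_trans with (0.75 * m ^ 3 * (5.9 * m ^ 2)).
      - replace (m ^ 5) with (m ^ 3 * m ^ 2) by ring. assert (0 < m ^ 3 * m ^ 2) by (apply Rmult_lt_0_compat; lra). lra.
      - apply Rmult_le_compat; [lra|lra|easy|].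
        replace ((3 * m ^ 2) ^ 2) with (9 * (m ^ 2 * m ^ 2)) by ring.
        assert (m ^ 2 * m ^ 2 <= 0.0007 * m ^ 2) by (apply Rmult_le_compat_r; lra). lra. }
    lra.
Qed.

Theorem theorem3p3 : forall n : nat, (92 <= n)%nat ->
  f_ov n + 1000 / (mu (n - 1)) ^ 5 < Q (u n).
Proof.
  intros n Hn. destruct (le_lt_dec n 1501) as [H|H].
  - apply Rle_lt_trans with (1 - gap n); [apply f_ov_upper_bound; easy|].
    apply gap_lt_Q_finite. lia.
  - apply f_ov_lt_Q_tail. lia.
Qed.
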